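(* For any $\theta\in\left[\frac12,1\right]$ and $\gamma\in\left[\frac12,1\right]$ satisfying $$\theta\le\gamma\le\tfrac12(\theta+1),$$ there exist a finitely generated group $G$ and a symmetric probability measure $\mu$ of finite support on $G$ such that the random walk on $G$ with step distribution $\mu$ has entropy exponent $\theta$ and speed exponent $\gamma$, i.e. $$\lim_{n\to\infty}\frac{\log H_\mu(n)}{\log n}=\theta\qquad\text{and}\qquad\lim_{n\to\infty}\frac{\log L_\mu(n)}{\log n}=\gamma.$$
   Context: $W_n=X_1\cdots X_n$ with $X_i$ i.i.d. of law $\mu$, with law $\mu^{\ast n}$. Speed: $L_\mu(n)=\mathbf E|W_n|_G$, where $|\cdot|_G$ is the word length for a finite generating set of $G$. Entropy: $H_\mu(n)=-\sum_x\mu^{\ast n}(x)\log\mu^{\ast n}(x)$. The exponent of a function $f$ is $\lim_n\log f(n)/\log n$ when the limit exists. *)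

(* Defs.v *)
From HB Require Import structures.
From mathcomp Require Import all_boot all_order all_algebra.
From mathcomp Require Import all_classical all_reals all_analysis.

Set Implicit Arguments.
Unset Strict Implicit.
Unset Printing Implicit Defensive.

Import Order.TTheory GRing.Theory Num.Theory.
Import numFieldNormedType.Exports.

Local Open Scope classical_set_scope.
Local Open Scope ring_scope.

(** Words in the alphabet [S] together with the inverses of its elements. *)
Definition word_in (G : groupType) (S : set G) (w : seq G) : Prop :=
  forall x, x \in w -> S x \/ S (x^-1)%g.

Definition word_value (G : groupType) (w : seq G) : G :=
  \big[*%g/1%g]_(x <- w) x.

Definition generates (G : groupType) (S : set G) : Prop :=
  forall g : G, exists2 w : seq G, word_in S w & word_value w = g.

Definition finitely_generated (G : groupType) : Prop :=
  exists2 S : set G, finite_set S & generates S.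

Definition word_sizes (G : groupType) (S : set G) (g : G) : set nat :=
  [set n | exists w : seq G, [/\ word_in S w, word_value w = g & size w = n]].

(** The least size of a word representing [g] (the default value [0] is taken
    only when no word represents [g], so never when [S] generates [G]). *)
Definition word_length (G : groupType) (S : set G) (g : G) : nat :=
  xget 0%N [set n | word_sizes S g n /\
                    forall m, word_sizes S g m -> (n <= m)%N].

(** Probability measures of finite support on the (discrete) group [G] are
    given by their mass function.  All the sums over [G] below are sums over
    finite supports; [\sum_(x \in setT)] would be [0] on an infinite support,
    which is why finiteness of the support is always assumed. *)
Definition finitely_supported_probability (R : realType) (G : groupType)
    (mu : G -> R) : Prop :=
  [/\ forall x, 0 <= mu x,
      finite_set [set x | mu x != 0]
    & \sum_(x \in [set: G]) mu x = 1].

Definition symmetric_measure (R : realType) (G : groupType)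
    (mu : G -> R) : Prop :=
  forall x, mu (x^-1)%g = mu x.

Definition convolution (R : realType) (G : groupType)
    (mu nu : G -> R) : G -> R :=
  fun x => \sum_(y \in [set: G]) mu y * nu (y^-1 * x)%g.

(** The law of [W_n = X_1 ... X_n] for i.i.d. increments of law [mu]. *)
Definition convolution_power (R : realType) (G : groupType)
    (mu : G -> R) (n : nat) : G -> R :=
  iter n (convolution mu) (fun x => (x == 1%g)%:R).

Definition speed (R : realType) (G : groupType) (S : set G)
    (mu : G -> R) (n : nat) : R :=
  \sum_(x \in [set: G]) convolution_power mu n x * (word_length S x)%:R.

(** Since [ln 0 = 0], points of mass [0] contribute [0]. *)
Definition entropy (R : realType) (G : groupType)
    (mu : G -> R) (n : nat) : R :=
  - \sum_(x \in [set: G]) convolution_power mu n x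
                          * ln (convolution_power mu n x).

Definition has_exponent (R : realType) (f : nat -> R) (a : R) : Prop :=
  (fun n : nat => ln (f n) / ln (n%:R : R)) @ \oo --> a.

(* Main.v *)
(** The group acts on points that carry an integer rotation; a point is a lamp
    seen from a walker on the integers, and there are lamps of every scale
    [2^s].  A lamp of scale [s] is addressed by its site together with the state
    of [q s] switches, those at distance [2^s, ..., 2^s + q s - 1] from the site,
    which the walker toggles at random when passing; at each step the walker
    turns by [+2] or [-2] the lamps of its site whose switches are all off.

    A lamp can only be met again before the walker has passed all its switches,
    or else if [q s] random bits agree.  Hence [n] steps turn at least
    [n / (2^s + q s + 2^(- q s) sqrt n)] lamps of scale [s], and on the other
    hand at most [sqrt n * 2^(q s)] and at most [sqrt n + n / 2^s] of them, up to
    constants.  For [q s] proportional to [s] with the right factor, the best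
    scale [2^s = n^(1 - theta)] yields [n^(theta + o(1))] lamps.  As the signs of
    the turns are independent, this number is the entropy up to [n^o(1)], and the
    sum of the absolute values of the rotations is [n^((1 + theta) / 2 + o(1))].

    The generator [Gf] turns lamps by [amp i] at level [2^i], a place which costs
    [2^i] letters to reach, with [amp i = 2^(floor (kappa i))].  A word of length
    [l] thus produces a sum of rotations of at most [l^(1 + kappa + o(1))], and
    the elements reached by the walk have words of no greater length than this
    requires, so that the speed exponent is the solution [gamma] of
    [gamma (1 + kappa) = (1 + theta) / 2].  The choice of
    [kappa] does not affect the law of the rotations, hence nor the entropy. *)

Require Import Defs.
From HB Require Import structures.
From mathcomp Require Import all_boot all_order all_algebra.
From mathcomp Require Import all_classical all_reals all_analysis.
From mathcomp Require Import zify ring lra.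

Set Implicit Arguments.
Unset Strict Implicit.
Unset Printing Implicit Defensive.

Import Order.TTheory GRing.Theory Num.Theory.
Import numFieldNormedType.Exports.

Local Open Scope classical_set_scope.
Local Open Scope ring_scope.

(** * Expectation over random words *)

Section Expectation.
Variable R : realType.

(** The obstacle is that the letters of the walk act on all scales at once, so a short word for the
    element reached after [n] steps has to reproduce infinitely many patterns of rotations
    simultaneously. What saves this is that a walk whose range is below [2^s] reaches no switch of
    the lamps of scale [s] it visits: all large scales carry one common pattern, that of lamps
    without switches. This pattern is written at every scale by a single word, and only the
    logarithmically many scales below the range are corrected one at a time, the trip to scale [2^s]
    costing no more than the range. A pattern is written as a commutator of conjugates of [Gf] with
    a reflection that selects the scales concerned. Such a commutator doubles rotations, whence the
    turns by 2. The exponent [(1 + theta) / 2] arises from [n^theta] lamps, each turned about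
    [n^(1 - theta)] times with independent signs and hence rotated by about
    [n^((1 - theta) / 2)]. *)

Definition avg (A : finType) (f : A -> R) : R := (#|A|%:R)^-1 * \sum_a f a.

Fixpoint Ex (A : finType) (n : nat) (phi : seq A -> R) : R :=
  if n is n'.+1 then avg (fun a => Ex n' (fun w => phi (a :: w)))
  else phi [::].

Lemma avg_le (A : finType) (f g : A -> R) :
  (forall a, f a <= g a) -> avg f <= avg g.
Proof.
by move=> fg; rewrite ler_wpM2l ?invr_ge0 ?ler0n// ler_sum.
Qed.

Lemma eq_avg (A : finType) (f g : A -> R) : f =1 g -> avg f = avg g.
Proof. by move=> fg; rewrite /avg (eq_bigr _ (fun a _ => fg a)). Qed.

Lemma avgD (A : finType) (f g : A -> R) :
  avg (fun a => f a + g a) = avg f + avg g.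
Proof. by rewrite /avg big_split mulrDr. Qed.

Lemma avgZ (A : finType) c (f : A -> R) : avg (fun a => c * f a) = c * avg f.
Proof. by rewrite /avg -mulr_sumr mulrCA. Qed.

Lemma avg_cst (A : finType) (c : R) : (0 < #|A|)%N -> avg (fun _ : A => c) = c.
Proof.
move=> A0; rewrite /avg sumr_const -[c *+ _]mulr_natl mulrA mulVf ?mul1r//.
by rewrite pnatr_eq0 -lt0n.
Qed.

Lemma avg_ge0 (A : finType) (f : A -> R) : (forall a, 0 <= f a) -> 0 <= avg f.
Proof. by move=> f0; rewrite mulr_ge0 ?invr_ge0 ?ler0n// sumr_ge0. Qed.

Lemma avg_bool (f : bool -> R) : avg f = (f true + f false) / 2.
Proof. by rewrite /avg card_bool big_bool mulrC. Qed.

Lemma avg_pair (A B : finType) (f : A * B -> R) :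
  avg f = avg (fun a => avg (fun b => f (a, b))).
Proof.
rewrite /avg card_prod natrM invfM -mulr_sumr mulrA pair_bigA /=.
by congr (_ * _); apply: eq_bigr => -[].
Qed.

Lemma eq_Ex (A : finType) n (f g : seq A -> R) :
  (forall w, size w = n -> f w = g w) -> Ex n f = Ex n g.
Proof.
elim: n f g => [|n IH] f g fg /=; first exact: fg.
by apply: eq_avg => a; apply: IH => w wn; apply: fg; rewrite /= wn.
Qed.

Lemma Ex_le (A : finType) n (f g : seq A -> R) :
  (forall w, size w = n -> f w <= g w) -> Ex n f <= Ex n g.
Proof.
elim: n f g => [|n IH] f g fg /=; first exact: fg.
by apply: avg_le => a; apply: IH => w wn; apply: fg; rewrite /= wn.
Qed.

Lemma Ex_ge0 (A : finType) n (f : seq A -> R) :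
  (forall w, size w = n -> 0 <= f w) -> 0 <= Ex n f.
Proof.
elim: n f => [|n IH] f f0 /=; first exact: f0.
by apply: avg_ge0 => a; apply: IH => w wn; apply: f0; rewrite /= wn.
Qed.

Lemma ExD (A : finType) n (f g : seq A -> R) :
  Ex n (fun w => f w + g w) = Ex n f + Ex n g.
Proof.
elim: n f g => [|n IH] f g //=.
by rewrite -avgD; apply: eq_avg => a; rewrite IH.
Qed.

Lemma ExZ (A : finType) n c (f : seq A -> R) :
  Ex n (fun w => c * f w) = c * Ex n f.
Proof.
elim: n f => [|n IH] f //=.
by rewrite -avgZ; apply: eq_avg => a; rewrite IH.
Qed.

Lemma ExN (A : finType) n (f : seq A -> R) : Ex n (fun w => - f w) = - Ex n f.
Proof.
by rewrite -mulN1r -ExZ; apply: eq_Ex => w _; rewrite mulN1r.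
Qed.

Lemma Ex_cst (A : finType) n (c : R) : (0 < #|A|)%N ->
  Ex n (fun _ : seq A => c) = c.
Proof.
by move=> A0; elim: n => //= n IH; rewrite (eq_avg (fun=> IH)) avg_cst.
Qed.

Lemma Ex_sum (A : finType) n (I : Type) (r : seq I) (P : pred I)
    (f : I -> seq A -> R) :
  Ex n (fun w => \sum_(i <- r | P i) f i w) = \sum_(i <- r | P i) Ex n (f i).
Proof.
elim: r => [|i r IH].
  have := @ExZ A n 0 (fun=> 0); rewrite !mul0r big_nil => E0.
  by rewrite -[RHS]E0; apply: eq_Ex => w _; rewrite big_nil.
rewrite big_cons; case: ifPn => Pi.
  by rewrite -IH -ExD; apply: eq_Ex => w _; rewrite big_cons Pi.
by rewrite -IH; apply: eq_Ex => w _; rewrite big_cons (negbTE Pi).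
Qed.

Lemma ExS (A : finType) n (f : seq A -> R) :
  Ex n.+1 f = avg (fun a => Ex n (fun w => f (a :: w))).
Proof. by []. Qed.

Lemma Ex_avg (A B : finType) n (f : B -> seq A -> R) :
  Ex n (fun w => avg (f^~ w)) = avg (fun b => Ex n (f b)).
Proof. by rewrite ExZ Ex_sum. Qed.

Lemma Ex_zip (A B : finType) n (f : seq (A * B) -> R) :
  Ex n f = Ex n (fun wa : seq A => Ex n (fun wb : seq B => f (zip wa wb))).
Proof.
elim: n f => [|n IH] f //=.
rewrite avg_pair; apply: eq_avg => a.
rewrite Ex_avg; apply: eq_avg => b.
by rewrite IH.
Qed.

End Expectation.

(** * Sums of independent signs grouped by address *)

Section RandomSigns.
Variables (R : realType) (K : eqType).
Implicit Types (ys : seq K) (es : seq bool) (a : K).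

Definition sgi (b : bool) : int := if b then 1 else -1.

Fixpoint ssum ys es a : int :=
  match ys, es with
  | y :: ys', b :: es' => (if y == a then sgi b else 0) + ssum ys' es' a
  | _, _ => 0
  end.

(** The number of ordered pairs of positions, diagonal included, with equal entries, i.e. the sum of
    the squared multiplicities. Returns of the walk enter the moment bounds through this
    quantity. *)
Definition pairs ys : nat := (\sum_(y <- ys) count_mem y ys)%N.

Lemma sum_undup (f : K -> R) ys :
  \sum_(a <- undup ys) (count_mem a ys)%:R * f a = \sum_(y <- ys) f y.
Proof.
rewrite -[RHS]big_undup_iterop_count; apply: eq_bigr => a _.
by rewrite mulr_natl /= Monoid.iteropE /= -iter_addr_0.
Qed.

Lemma ssum_notin ys es a : a \notin ys -> ssum ys es a = 0.
Proof.
elim: ys es => [|y ys IH] [|b es] //=.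
by rewrite inE negb_or eq_sym => /andP[/negPf-> /IH->].
Qed.

Lemma Ex_bool_cons n (f : seq bool -> R) :
  Ex n.+1 f = Ex n (fun w => (f (true :: w) + f (false :: w)) / 2).
Proof.
rewrite ExS avg_bool -ExD mulrC -ExZ; apply: eq_Ex => w _; exact: mulrC.
Qed.

Lemma ssum_consE y ys b es a : ssum (y :: ys) (b :: es) a =
  (if y == a then sgi b else 0) + ssum ys es a.
Proof. by []. Qed.

Lemma Ex_ssum2 ys a :
  Ex (size ys) (fun es => ((ssum ys es a)%:~R ^+ 2 : R)) = (count_mem a ys)%:R.
Proof.
elim: ys => [|y ys IH]; first by rewrite /= mulr0z expr0n.
rewrite [size _]/= Ex_bool_cons [count_mem _ _]/= natrD -IH; case: eqP => ya.
  rewrite -[X in X + _](@Ex_cst R bool (size ys)) ?card_bool// -ExD.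
  apply: eq_Ex => es _; rewrite !ssum_consE ya eqxx !intrD /=; lra.
rewrite add0r; apply: eq_Ex => es _; rewrite !ssum_consE; case: eqP => //.
by rewrite !add0r => _; lra.
Qed.

Lemma Ex_ssum4 ys a :
  Ex (size ys) (fun es => ((ssum ys es a)%:~R ^+ 4 : R)) <=
  3 * (count_mem a ys)%:R ^+ 2.
Proof.
suff -> : Ex (size ys) (fun es => ((ssum ys es a)%:~R ^+ 4 : R)) =
  3 * (count_mem a ys)%:R ^+ 2 - 2 * (count_mem a ys)%:R.
  by rewrite lerBlDr lerDl mulr_ge0.
elim: ys => [|y ys IH]; first by rewrite /= mulr0z !expr0n /= !mulr0 subr0.
rewrite [size _]/= Ex_bool_cons [count_mem _ _]/= natrD.
have -> : (y == a)%:R = (if y == a then 1 else 0) :> R by case: eqP.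
case: eqP => ya.
  transitivity (Ex (size ys) (fun es => (1 + 6 * (ssum ys es a)%:~R ^+ 2)
     + (ssum ys es a)%:~R ^+ 4 : R)).
    apply: eq_Ex => es _; rewrite !ssum_consE ya eqxx !intrD /=; by field.
  rewrite !ExD ExZ IH Ex_ssum2 Ex_cst ?card_bool//; by field.
rewrite add0r -IH; apply: eq_Ex => es _; rewrite !ssum_consE; case: eqP => //.
by rewrite !add0r => _; field.
Qed.

(** When all other signs are fixed, the last sign attached to an address is still free, and at most
    one of its two values meets the prescription; each distinct address thus costs a factor
    [1/2]. *)
Lemma Ex_ssum_all ys (c : K -> int) :
  Ex (size ys) (fun es => (all (fun a => ssum ys es a == c a) (undup ys))%:R : R)
  <= 2^-1 ^+ size (undup ys).
Proof.
elim: ys c => [|y ys IH] c; first by rewrite /= expr0.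
have consE b es a : (ssum (y :: ys) (b :: es) a == c a) =
    (ssum ys es a == c a - (if y == a then sgi b else 0)).
  by rewrite ssum_consE [RHS]eq_sym subr_eq eq_sym addrC.
rewrite [size _]/= ExS avg_bool /=; case: ifPn => yys.
  have E b : Ex (size ys) (fun es => (all (fun a => ssum (y :: ys) (b :: es) a
      == c a) (undup ys))%:R : R) <= 2^-1 ^+ size (undup ys).
    by under eq_Ex do under eq_all do rewrite consE; exact: IH.
  by have := E true; have := E false; lra.
have E b : Ex (size ys) (fun es => (all (fun a => ssum (y :: ys) (b :: es) a
    == c a) (y :: undup ys))%:R : R)
  <= (sgi b == c y)%:R * 2^-1 ^+ size (undup ys).
  rewrite (le_trans _ (ler_wpM2l _ (IH c)))// -ExZ; apply: Ex_le => es _.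
  rewrite /= eqxx ssum_notin// addr0; case: eqP => //= _; last by rewrite mul0r.
  rewrite mul1r; set p := all _ _; set p' := all _ _.
  suff -> : p = p' by [].
  apply: eq_in_all => a; rewrite mem_undup => ays; case: (y =P a) => [ya|_].
    by rewrite -ya (negbTE yys) in ays.
  by rewrite add0r.
have := E true; have := E false; rewrite /= exprS.
have : (true && (1 == c y))%:R + (-1 == c y)%:R <= 1 :> R.
  by case: eqP => [<-|]; case: eqP => //=; rewrite ?addr0 ?add0r ?ler01.
have : 0 <= 2^-1 ^+ size (undup ys) :> R by rewrite exprn_ge0 ?invr_ge0.
rewrite /=; nra.
Qed.

Lemma sumr_seq_cst (T : Type) (s : seq T) (c : R) :
  \sum_(i <- s) c = c *+ size s.
Proof. by rewrite big_const_seq count_predT iter_addr_0. Qed.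

Lemma sum_count ys : \sum_(a <- undup ys) (count_mem a ys)%:R = (size ys)%:R :> R.
Proof.
have := sum_undup (fun=> 1) ys; rewrite sumr_seq_cst.
by move=> <-; apply: eq_bigr => a _; rewrite mulr1.
Qed.

Lemma sum_count2 ys :
  \sum_(a <- undup ys) (count_mem a ys)%:R ^+ 2 = (pairs ys)%:R :> R.
Proof.
have := sum_undup (fun a => (count_mem a ys)%:R) ys; rewrite natr_sum => <-.
by apply: eq_bigr => a _; rewrite expr2.
Qed.

Definition absum ys es : R := \sum_(a <- undup ys) `|ssum ys es a|%:~R.

(** Sum over the addresses of [1 >= x / M - x ^+ 2 / (4 * M ^+ 2)], a rearranged square, where [x]
    is the multiplicity. *)
Lemma size_undup_ge ys (M : R) : 0 < M ->
  (size ys)%:R / M - (pairs ys)%:R / (4 * M ^+ 2) <= (size (undup ys))%:R.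
Proof.
move=> M0; rewrite -sum_count -sum_count2 !mulr_suml -sumrB.
rewrite -[leRHS](@sumr_seq_cst K (undup ys) 1); apply: ler_sum => a _.
set x := (_)%:R; have := sqr_ge0 (x / M / 2 - 1).
have -> : x ^+ 2 / (4 * M ^+ 2) = (x / M / 2) ^+ 2 by field; rewrite gt_eqF.
by nra.
Qed.

(* [|x| >= x^2 - x^4 / 4], rescaled by [M]. *)
Lemma abs_moments_ge (x M : R) : 0 < M ->
  x ^+ 2 / M - x ^+ 4 / (4 * M ^+ 3) <= `|x|.
Proof.
move=> M0; pose y := `|x| / M.
have y0 : 0 <= y by rewrite divr_ge0// ltW.
have -> : `|x| = M * y by rewrite /y mulrCA divff ?mulr1// gt_eqF.
have -> : x ^+ 2 / M - x ^+ 4 / (4 * M ^+ 3) = M * (y ^+ 2 - y ^+ 4 / 4).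
  rewrite /y -[x ^+ 4]/(x ^+ (2 * 2)) exprM -(real_normK (num_real x)); field.
  by rewrite gt_eqF.
rewrite ler_pM2l//; have [y1|y1] := leP y 1.
  have : 0 <= y ^+ 4 by rewrite exprn_ge0.
  by nra.
have := sqr_ge0 (y ^+ 2 / 2 - 1); rewrite -[y ^+ 4]/(y ^+ (2 * 2)) exprM; nra.
Qed.

(** A lower bound on first absolute moments from second and fourth moments. The scale [M] stands for
    the typical rotation of one lamp and is later of the order of the square root of the expected
    number of returns. *)
Lemma Ex_absum_ge ys (M : R) : 0 < M ->
  (size ys)%:R / M - 3 * (pairs ys)%:R / (4 * M ^+ 3) <=
  Ex (size ys) (absum ys).
Proof.
move=> M0; rewrite /absum Ex_sum -sum_count -sum_count2 mulr_suml mulr_sumr.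
rewrite mulr_suml -sumrB; apply: ler_sum => a _.
apply: (@le_trans _ _ (Ex (size ys) (fun es => M^-1 * (ssum ys es a)%:~R ^+ 2 +
  (- (4 * M ^+ 3)^-1) * (ssum ys es a)%:~R ^+ 4))).
  rewrite ExD !ExZ Ex_ssum2 mulrC lerD2l mulNr lerN2 mulrC ler_wpM2r//.
    by rewrite invr_ge0 mulr_ge0// exprn_ge0// ltW.
  exact: Ex_ssum4.
apply: Ex_le => es _; rewrite intr_norm; apply: le_trans (abs_moments_ge _ M0).
by rewrite mulNr mulrC [X in _ - X]mulrC.
Qed.

(** Cauchy-Schwarz over the distinct addresses, then the second moments. *)
Lemma Ex_absum2 ys : Ex (size ys) (fun es => absum ys es ^+ 2) <=
  (size (undup ys))%:R * (size ys)%:R.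
Proof.
rewrite -(sum_count ys); under eq_bigr do rewrite -Ex_ssum2.
rewrite -Ex_sum -ExZ; apply: Ex_le => es _.
rewrite /absum expr2; set S := \sum_(a <- _) _; set Q := \sum_(a <- _) _.
have -> : S * S = \sum_(a <- undup ys) \sum_(b <- undup ys)
    `|ssum ys es a|%:~R * `|ssum ys es b|%:~R.
  by rewrite mulr_suml; apply: eq_bigr => a _; rewrite mulr_sumr.
apply: (@le_trans _ _ (\sum_(a <- undup ys) \sum_(b <- undup ys)
  ((ssum ys es a)%:~R ^+ 2 / 2 + (ssum ys es b)%:~R ^+ 2 / 2))).
  apply: ler_sum => a _; apply: ler_sum => b _; rewrite !intr_norm.
  have := sqr_ge0 (`|(ssum ys es a)%:~R : R| - `|(ssum ys es b)%:~R|).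
  rewrite -(real_normK (num_real ((ssum ys es a)%:~R : R))).
  rewrite -(real_normK (num_real ((ssum ys es b)%:~R : R))); nra.
under eq_bigr do rewrite big_split /= sumr_seq_cst -mulr_suml.
rewrite big_split /= sumr_seq_cst -/Q sumrMnl -mulr_suml -/Q -mulrnDl.
by rewrite -splitr mulr_natl.
Qed.

Lemma Ex_absum_le ys (M : R) : 0 < M ->
  Ex (size ys) (absum ys) <=
  (size ys)%:R / (2 * M) + (size (undup ys))%:R * M / 2.
Proof.
move=> M0; rewrite /absum Ex_sum -(sum_count ys) mulr_suml.
have -> : (size (undup ys))%:R * M / 2 = \sum_(a <- undup ys) (M / 2).
  by rewrite sumr_seq_cst -[RHS]mulr_natl mulrA.
rewrite -big_split /=; apply: ler_sum => a _.
rewrite -(@Ex_cst R bool (size ys) (M / 2)) ?card_bool// -Ex_ssum2 mulrC -ExZ.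
rewrite -ExD; apply: Ex_le => es _; rewrite intr_norm.
move: (_%:~R) => x; have := sqr_ge0 (`|x| / M - 1).
rewrite -(real_normK (num_real x)) => h.
have -> : (2 * M)^-1 * `|x| ^+ 2 + M / 2 =
  `|x| + M / 2 * (`|x| / M - 1) ^+ 2 by field; rewrite gt_eqF.
by rewrite lerDl mulr_ge0// divr_ge0// ltW.
Qed.

End RandomSigns.

(** * Simple random walk on the integers *)

Section SimpleWalk.
Variable R : realType.
Implicit Types (es : seq bool) (c h : int).

Definition psum es : int := \sum_(e <- es) sgi e.

Fixpoint below h c es : bool :=
  if es is e :: es' then (c < h) && below h (c + sgi e) es' else c < h.

Fixpoint mx es : int :=
  if es is e :: es' then Num.max 0 (sgi e + mx es') else 0.

Fixpoint mn es : int :=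
  if es is e :: es' then Num.max 0 (- sgi e + mn es') else 0.

Fixpoint sites es : seq int :=
  if es is e :: es' then 0 :: map (fun c => c + sgi e) (sites es')
  else [:: 0].

Fixpoint returns c es : bool :=
  if es is e :: es' then (c == 0) || returns (c + sgi e) es' else c == 0.

(* the walk started at [c] reaches [P] before it reaches [0] *)
Fixpoint climbs (P : int) c es : bool :=
  if es is e :: es' then
    (c != 0) && ((P <= c) || climbs P (c + sgi e) es')
  else P <= c.

(** The walk is recentred at each time: this counts the times at which it leaves its position and
    climbs [P] above it before coming back. *)
Fixpoint climb_count P es : nat :=
  if es is e :: es' then (climbs P (sgi e) es' + climb_count P es')%N else 0%N.

Lemma psum_cons e es : psum (e :: es) = sgi e + psum es.
Proof. by rewrite /psum big_cons. Qed.

Lemma mx_ge0 es : 0 <= mx es.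
Proof. by case: es => //= e es; rewrite le_max lexx. Qed.

Lemma mn_ge0 es : 0 <= mn es.
Proof. by case: es => //= e es; rewrite le_max lexx. Qed.

Lemma norm_laplacian c :
  (`|c + 1|%:~R + `|c - 1|%:~R) / 2 = `|c|%:~R + (c == 0)%:R :> R.
Proof.
have -> : (c == 0)%:R = (c == 0)%:Z%:~R :> R by case: eqP.
apply: (mulIf (_ : 2 != 0)); rewrite ?pnatr_eq0// divfK ?pnatr_eq0//.
rewrite -!intrD -[2]/(2%:~R) -intrM; congr (_%:~R).
by case: eqP => [->|c0] //; lia.
Qed.

Lemma Ex_path_cons n (f : seq bool -> R) :
  Ex n.+1 f = (Ex n (fun es => f (true :: es)) +
               Ex n (fun es => f (false :: es))) / 2.
Proof. by rewrite ExS avg_bool. Qed.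

(** A discrete Tanaka formula: the Laplacian of the absolute value is the point mass at 0, so visits
    to 0 are the mean growth of the absolute value. *)
Lemma Ex_zero_count (n : nat) c :
  \sum_(k < n.+1) Ex k (fun es => (c + psum es == 0)%:R : R) =
  Ex n.+1 (fun es => `|c + psum es|%:~R) - `|c|%:~R.
Proof.
elim: n c => [|n IH] c.
  rewrite big_ord1 Ex_path_cons /= !psum_cons /psum !big_nil !addr0 /=.
  by rewrite norm_laplacian addrC addKr.
rewrite big_ord_recl [X in X + _]/= {1}/psum big_nil addr0.
transitivity ((c == 0)%:R + (\sum_(k < n.+1) Ex k
   (fun es => (c + 1 + psum es == 0)%:R : R) + \sum_(k < n.+1) Ex k
   (fun es => (c - 1 + psum es == 0)%:R : R)) / 2).
  congr (_ + _); rewrite -big_split /= mulr_suml; apply: eq_bigr => k _.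
  rewrite avg_bool; congr ((_ + _) / 2);
    by apply: eq_Ex => es _; rewrite psum_cons addrA.
rewrite !IH [in RHS]Ex_path_cons.
have E s : Ex n.+1 (fun es => `|c + psum (s :: es)|%:~R : R) =
    Ex n.+1 (fun es => `|c + sgi s + psum es|%:~R).
  by apply: eq_Ex => es _; rewrite psum_cons addrA.
rewrite !E /=; have := norm_laplacian c; lra.
Qed.

Lemma Ex_psum2 n : Ex n (fun es => (psum es)%:~R ^+ 2 : R) = n%:R.
Proof.
elim: n => [|n IH]; first by rewrite /= /psum big_nil mulr0z expr0n.
rewrite Ex_bool_cons -(natr1 n) -IH -[X in _ + X](@Ex_cst R bool n) ?card_bool//.
rewrite -ExD; apply: eq_Ex => es _; rewrite !psum_cons !intrD /=; by field.
Qed.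

Lemma Ex_zero_count_le (n : nat) :
  \sum_(k < n.+1) Ex k (fun es => (psum es == 0)%:R : R) <=
  Num.sqrt n.+1%:R.
Proof.
have := Ex_zero_count n 0; rewrite normr0 mulr0z subr0.
under eq_bigr do under eq_Ex do rewrite add0r.
move=> ->; have s0 : 0 < Num.sqrt n.+1%:R :> R by rewrite sqrtr_gt0 ltr0n.
set s := Num.sqrt _ in s0 *.
have s2 : s ^+ 2 = n.+1%:R by rewrite sqr_sqrtr// ler0n.
apply: (@le_trans _ _ (Ex n.+1 (fun es =>
   (2 * s)^-1 * (psum es)%:~R ^+ 2 + s / 2))).
  apply: Ex_le => es _; rewrite add0r intr_norm; move: (_%:~R) => x.
  rewrite -(real_normK (num_real x)); have := sqr_ge0 (`|x| / s - 1) => h.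
  have -> : (2 * s)^-1 * `|x| ^+ 2 + s / 2 =
    `|x| + s / 2 * (`|x| / s - 1) ^+ 2 by field; rewrite gt_eqF.
  by rewrite lerDl mulr_ge0// divr_ge0// ltW.
rewrite ExD ExZ Ex_psum2 Ex_cst ?card_bool// -s2.
rewrite le_eqVlt; apply/orP; left; apply/eqP; field; by rewrite gt_eqF.
Qed.

(** The right-hand side is the Green function at 0 of the walk killed at [h]: it vanishes at [h],
    and its mean over the two neighbours falls short of it by 1 at 0 and by 0 elsewhere below
    [h]. *)
Lemma Ex_below_count_le (h : int) (n : nat) c : 0 <= h -> c <= h ->
  \sum_(k < n.+1) Ex k (fun es => ((c + psum es == 0) && below h c es)%:R : R)
  <= 2 * (h - Num.max c 0)%:~R.
Proof.
move=> h0 ch; elim: n c ch => [|n IH] c ch.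
  rewrite big_ord1 /= /psum big_nil addr0; case: eqP => [->|_] /=; last first.
    by rewrite mulr_ge0// ler0z; lia.
  case: ltP => h1 /=; last by rewrite mulr_ge0// ler0z; lia.
  by rewrite -[1]/(1%:~R) -[2]/(2%:~R) -intrM ler_int; lia.
rewrite big_ord_recl [X in X + _]/= {1}/psum big_nil addr0.
have [hc|ch'] := leP h c.
  rewrite big1 => [|k _].
    by rewrite andbF addr0 mulr_ge0// ler0z; lia.
  rewrite Ex_path_cons /= ltNge hc /=.
  have E s : Ex k (fun es => ((c + psum (s :: es) == 0) && false)%:R : R) = 0.
    rewrite -[RHS](@Ex_cst R bool k) ?card_bool//.
    by apply: eq_Ex => es _; rewrite andbF.
  by rewrite !E addr0 mul0r.
rewrite andbT.
have -> : \sum_(i < n.+1) Ex (bump 0 i)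
    (fun es => ((c + psum es == 0) && below h c es)%:R : R) =
  (\sum_(k < n.+1) Ex k
   (fun es => ((c + 1 + psum es == 0) && below h (c + 1) es)%:R : R) +
   \sum_(k < n.+1) Ex k
   (fun es => ((c - 1 + psum es == 0) && below h (c - 1) es)%:R : R)) / 2.
  rewrite -big_split /= mulr_suml; apply: eq_bigr => k _.
  rewrite avg_bool ch' /=; congr ((_ + _) / 2);
    by apply: eq_Ex => es _; rewrite psum_cons addrA.
have c1 : c + 1 <= h by lia.
have c2 : c - 1 <= h by lia.
have := IH _ c1; have := IH _ c2.
have : (c == 0)%:Z + (h - Num.max (c + 1) 0) + (h - Num.max (c - 1) 0) <=
   2 * (h - Num.max c 0).
  by case: eqP => c0; lia.
rewrite -(ler_int R) intrM !intrD.
have -> : (c == 0)%:R = (c == 0)%:Z%:~R :> R by case: eqP.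
lra.
Qed.

(** Prepending a step replaces the maximum [m] by [max 0 (sgi e + m)], which raises the mean square
    by at most 1. *)
Lemma Ex_mx2 n : Ex n (fun es => (mx es)%:~R ^+ 2 : R) <= n%:R.
Proof.
elim: n => [|n IH]; first by rewrite /= mulr0z expr0n.
rewrite Ex_bool_cons -(natr1 n); apply: le_trans (lerD IH (lexx 1)).
rewrite -[X in _ + X](@Ex_cst R bool n) ?card_bool//.
rewrite -ExD; apply: Ex_le => es _ /=; have := mx_ge0 es.
move: (mx es) => m m0; rewrite -!rmorphXn /= -[1]/(1%:~R) -!intrD.
rewrite ler_pdivrMr// -[2]/(2%:~R) -intrM ler_int.
have [->|] := eqVneq m 0; first by rewrite /=; lia.
by move=> m1; rewrite !max_r; lia.
Qed.

Lemma Ex_mn2 n : Ex n (fun es => (mn es)%:~R ^+ 2 : R) <= n%:R.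
Proof.
elim: n => [|n IH]; first by rewrite /= mulr0z expr0n.
rewrite Ex_bool_cons -(natr1 n); apply: le_trans (lerD IH (lexx 1)).
rewrite -[X in _ + X](@Ex_cst R bool n) ?card_bool//.
rewrite -ExD; apply: Ex_le => es _ /=; have := mn_ge0 es.
move: (mn es) => m m0; rewrite -!rmorphXn /= -[1]/(1%:~R) -!intrD.
rewrite ler_pdivrMr// -[2]/(2%:~R) -intrM ler_int.
have [->|] := eqVneq m 0; first by rewrite /=; lia.
by move=> m1; rewrite !max_r; lia.
Qed.

Lemma Ex_second_moment (f : seq bool -> int) n : (0 < n)%N ->
  Ex n (fun es => (f es)%:~R ^+ 2 : R) <= n%:R ->
  Ex n (fun es => (f es)%:~R : R) <= Num.sqrt n%:R.
Proof.
move=> n0 f2; have s0 : 0 < Num.sqrt n%:R :> R by rewrite sqrtr_gt0 ltr0n.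
set s := Num.sqrt _ in s0 *.
have s2 : s ^+ 2 = n%:R by rewrite sqr_sqrtr// ler0n.
apply: (@le_trans _ _ (Ex n (fun es =>
   (2 * s)^-1 * (f es)%:~R ^+ 2 + s / 2))).
  apply: Ex_le => es _; move: (_%:~R) => x.
  have -> : (2 * s)^-1 * x ^+ 2 + s / 2 =
    x + s / 2 * (x / s - 1) ^+ 2 by field; rewrite gt_eqF.
  by rewrite lerDl mulr_ge0 ?sqr_ge0// divr_ge0// ltW.
rewrite ExD ExZ Ex_cst ?card_bool//.
apply: (@le_trans _ _ ((2 * s)^-1 * s ^+ 2 + s / 2)).
  by rewrite lerD2r ler_wpM2l ?s2// invr_ge0 mulr_ge0// ltW.
rewrite le_eqVlt; apply/orP; left; apply/eqP; field; by rewrite gt_eqF.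
Qed.

(** Gambler's ruin: [max c 0 / P] is harmonic away from 0, with value 0 at 0 and 1 at [P]. *)
Lemma Ex_climbs (P : int) n c : 0 < P -> c <= P ->
  Ex n (fun es => (climbs P c es)%:R : R) <= (Num.max c 0)%:~R / P%:~R.
Proof.
move=> P0; have P0' : 0 < P%:~R :> R by rewrite ltr0z.
elim: n c => [|n IH] c cP.
  rewrite /=; case: (leP P c) => [Pc|_] /=; last first.
    by rewrite divr_ge0 ?ler0z ?(ltW P0) ?le_max ?lexx ?orbT.
  have -> : c = P by lia.
  by rewrite max_l ?divff ?gt_eqF// ltW.
rewrite Ex_path_cons /=; have [->|c0] := eqVneq c 0.
  under eq_Ex do rewrite /=; rewrite /= Ex_cst ?card_bool//.
  by rewrite addr0 mul0r divr_ge0 ?ler0z ?(ltW P0) ?le_max ?lexx ?orbT.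
have [Pc|cP'] := leP P c => /=.
  rewrite Ex_cst ?card_bool//; have -> : c = P by lia.
  by rewrite max_l ?(ltW P0)// !divff ?gt_eqF// lexx.
have c1 : c + 1 <= P by lia.
have c2 : c - 1 <= P by lia.
have := IH _ c1; have := IH _ c2 => h1 h2.
have -> : (Num.max c 0)%:~R / P%:~R = ((Num.max (c + 1) 0)%:~R / P%:~R +
   (Num.max (c - 1) 0)%:~R / P%:~R) / 2 :> R.
  have -> : Num.max (c - 1) 0 = Num.max c 0 *+ 2 - Num.max (c + 1) 0.
    by move: c0; lia.
  by rewrite intrB -[_ *+ 2]mulr_natr intrM; field; rewrite gt_eqF.
rewrite ler_wpM2r// lerD//.
Qed.

Lemma Ex_climb_count (P : int) n : 0 < P ->
  Ex n (fun es => (climb_count P es)%:R : R) <= n%:R / P%:~R.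
Proof.
move=> P0; have P0' : 0 < P%:~R :> R by rewrite ltr0z.
elim: n => [|n IH]; first by rewrite /= mul0r.
rewrite Ex_path_cons /=.
have E s : Ex n (fun es => (climbs P (sgi s) es + climb_count P es)%:R : R) <=
    1 / P%:~R + n%:R / P%:~R.
  under eq_Ex do rewrite natrD; rewrite ExD lerD//.
  have sP : sgi s <= P by case: s => /=; lia.
  apply: le_trans (Ex_climbs n P0 sP) _; rewrite ler_wpM2r ?invr_ge0 ?(ltW P0')//.
  by rewrite -[1]/(1%:~R) ler_int; case: s {sP} => /=; lia.
by have := E true; have := E false; rewrite -(natr1 n) mulrDl; lra.
Qed.

Lemma mem_returns es c : (- c \in sites es) = returns c es.
Proof.
elim: es c => [|e es IH] c /=; first by rewrite inE oppr_eq0.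
rewrite inE oppr_eq0; congr (_ || _); rewrite -IH.
have -> : - c = - (c + sgi e) + sgi e by rewrite opprD subrK.
by rewrite (mem_map (@addIr _ (sgi e))).
Qed.

Lemma sites_range es c : c \in sites es -> - mn es <= c <= mx es.
Proof.
elim: es c => [|e es IH] c /=; first by rewrite inE => /eqP->; rewrite oppr0 lexx.
rewrite inE => /orP[/eqP->|/mapP[c' /IH + ->]].
  by rewrite oppr_le0 !le_max !lexx.
by case: e => /=; lia.
Qed.

Lemma size_undup_range (s : seq int) (a b : int) : a <= b + 1 ->
  (forall c, c \in s -> a <= c <= b) ->
  (size (undup s))%:Z <= b - a + 1.
Proof.
move=> ab sab.
have E : {subset undup s <= [seq a + k%:Z | k <- iota 0 (absz (b - a + 1)%R)]}.
  move=> c; rewrite mem_undup => /sab cab.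
  apply/mapP; exists (absz (c - a)); last by lia.
  by rewrite mem_iota; lia.
have := uniq_leq_size (undup_uniq s) E; rewrite size_map size_iota; lia.
Qed.

Lemma size_undup_sites es :
  (size (undup (sites es)))%:Z <= mx es + mn es + 1.
Proof.
rewrite -[X in _ + X + 1]opprK; apply: size_undup_range; last exact: sites_range.
by have := mx_ge0 es; have := mn_ge0 es; lia.
Qed.

Lemma size_undup_sites_cons e es : size (undup (sites (e :: es))) =
  (~~ returns (sgi e) es + size (undup (sites es)))%N.
Proof.
rewrite /= -mem_returns.
have -> : (0 \in map (fun c => c + sgi e) (sites es)) = (- sgi e \in sites es).
  by rewrite -[0](subrK (sgi e)) (mem_map (@addIr _ (sgi e))) sub0r.
rewrite undup_map_inj ?size_map; last by move=> x y /addIr.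
by case: (_ \in _); rewrite /= ?size_map.
Qed.

End SimpleWalk.

(** * Addresses of lamps *)

Section XorSums.
Variables (R : realType) (K : eqType).

Fixpoint xsum (ys : seq K) (bs : seq bool) (a : K) : bool :=
  match ys, bs with
  | y :: ys', b :: bs' => ((y == a) && b) (+) xsum ys' bs' a
  | _, _ => false
  end.

Lemma xsum_notin ys bs a : a \notin ys -> xsum ys bs a = false.
Proof.
elim: ys bs => [|y ys IH] [|b bs] //=.
by rewrite inE negb_or eq_sym => /andP[/negPf-> /IH->].
Qed.

(** Every index of [Q] receives at least one uniform bit, so the parities over [Q] are jointly
    uniform; the last bit received by each index gives the factor [1/2]. *)
Lemma Ex_xsum_all ys (Q : seq K) (c : K -> bool) :
  uniq Q -> {subset Q <= ys} ->
  Ex (size ys) (fun bs => (all (fun a => xsum ys bs a == c a) Q)%:R : R)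
  <= 2^-1 ^+ size Q.
Proof.
elim: ys Q c => [|y ys IH] Q c uQ Qys.
  by case: Q uQ Qys => [|a Q] _ Qys; [rewrite /= expr0|have := Qys a (mem_head _ _)].
have consE b bs a : (xsum (y :: ys) (b :: bs) a == c a) =
    (xsum ys bs a == c a (+) ((y == a) && b)).
  by rewrite /=; case: (_ && b); case: xsum; case: (c a).
rewrite [size _]/= ExS avg_bool; have [yin|] := boolP ((y \in ys) || (y \notin Q)).
  have Qys' : {subset Q <= ys}.
    move=> a aQ; have := Qys a aQ; rewrite inE => /orP[/eqP ay|//].
    by move: yin; rewrite -ay aQ orbF.
  have E b : Ex (size ys) (fun bs => (all (fun a => xsum (y :: ys) (b :: bs) a
      == c a) Q)%:R : R) <= 2^-1 ^+ size Q.
    by under eq_Ex do under eq_all do rewrite consE; exact: IH.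
  by have := E true; have := E false; lra.
rewrite negb_or negbK => /andP[yys yQ].
have Qys' : {subset rem y Q <= ys}.
  move=> a; rewrite mem_rem_uniq// inE => /andP[ay aQ].
  by have := Qys a aQ; rewrite inE (negbTE ay).
have E b : Ex (size ys) (fun bs => (all (fun a => xsum (y :: ys) (b :: bs) a
    == c a) Q)%:R : R) <= (b == c y)%:R * 2^-1 ^+ size (rem y Q).
  rewrite (le_trans _ (ler_wpM2l _ (IH (rem y Q) c (rem_uniq _ uQ) Qys')))//.
  rewrite -ExZ; apply: Ex_le => bs _.
  rewrite (perm_all _ (perm_to_rem yQ)) /= eqxx xsum_notin//= addbF.
  case: eqP => //= _; last by rewrite mul0r.
  rewrite mul1r; set p := all _ _; set p' := all _ _.
  suff -> : p = p' by [].
  apply: eq_in_all => a /Qys' ays; case: (y =P a) => [ya|_] //.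
  by rewrite -ya (negbTE yys) in ays.
have := E true; have := E false.
have -> : 2^-1 ^+ size Q = 2^-1 * 2^-1 ^+ size (rem y Q) :> R.
  by rewrite -exprS size_rem// prednK//; case: (Q) yQ.
have : (true == c y)%:R + (false == c y)%:R = 1 :> R.
  by case: (c y); rewrite /= ?addr0 ?add0r.
have : 0 <= 2^-1 ^+ size (rem y Q) :> R by rewrite exprn_ge0 ?invr_ge0.
nra.
Qed.

Fixpoint flatp (bs : seq (bool * bool)) : seq bool :=
  if bs is b :: bs' then [:: b.1, b.2 & flatp bs'] else [::].

Lemma Ex_flatp n (f : seq bool -> R) :
  Ex n (fun bs => f (flatp bs)) = Ex n.*2 f.
Proof.
elim: n f => [|n IH] f //; rewrite doubleS !ExS avg_pair.
apply: eq_avg => b1; rewrite ExS; apply: eq_avg => b2.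
by rewrite -IH.
Qed.

End XorSums.

(** A move with two switch bits, one used before it and one after. This symmetric shape makes the
    inverse of a step again a step, so that the uniform law on steps is symmetric. *)
Definition bstep := (bool * (bool * bool))%type.

(* A point [(c, e)] is a lamp whose site is at distance [-c] from the cursor
   and whose environment differs by [e] from the current one; it is lit by [y]
   exactly when it is [origin]. *)
Definition epoint := (int * (int -> bool))%type.

Definition origin : epoint := (0, fun=> false).

(** * Position and environment of a lamp as a Markov chain; its returns *)

Section EnvironmentChain.
Variables (R : realType) (P : int) (q : nat).
Hypothesis P0 : 0 < P.
Implicit Types (x : epoint) (a : bstep) (w : seq bstep).

(** Index [c - P] is the switch at distance [c] from the site. A walker closer than [P] to the site
    therefore changes nothing. *)
Definition tog (c : int) (b : bool) (e : int -> bool) : int -> bool :=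
  fun i => e i (+) [&& b, i == c - P, 0 <= i & i < q%:Z].

Definition estep a x : epoint :=
  let c' := x.1 + sgi a.1 in (c', tog c' a.2.2 (tog x.1 a.2.1 x.2)).

Definition einv a x : epoint :=
  let c' := x.1 - sgi a.1 in (c', tog c' a.2.1 (tog x.1 a.2.2 x.2)).

(** A point is turned when it sits at [origin]. The list gives, for the two such instants of each
    step, the starting point that is at [origin] then, obtained by pulling [origin] back through the
    earlier steps. *)
Fixpoint addrs w : seq epoint :=
  if w is a :: w' then [:: origin, einv a origin & map (einv a) (addrs w')]
  else [::].

Fixpoint hits x w : nat :=
  if w is a :: w' then
    ((x == origin) + (estep a x == origin) + hits (estep a x) w')%N
  else 0%N.

Definition efin x w : epoint := foldl (fun x a => estep a x) x w.

Lemma tog_false c e : tog c false e = e.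
Proof. by apply/funext => i; rewrite /tog addbF. Qed.

Lemma togK c b : involutive (tog c b).
Proof. by move=> e; apply/funext => i; rewrite /tog addbK. Qed.

Lemma tog_low c b e : c < P -> tog c b e = e.
Proof.
move=> cP; apply/funext => i; rewrite /tog.
have -> : [&& b, i == c - P, 0 <= i & i < q%:Z] = false.
  by apply/negP => /and4P[_ /eqP-> h _]; lia.
by rewrite addbF.
Qed.

Lemma estepK a : cancel (estep a) (einv a).
Proof. by move=> [c e]; rewrite /einv /estep /= addrK !togK. Qed.

Lemma einvK a : cancel (einv a) (estep a).
Proof. by move=> [c e]; rewrite /einv /estep /= subrK !togK. Qed.

Lemma einv_inj a : injective (einv a).
Proof. exact: can_inj (einvK a). Qed.

Lemma einv_eq a x y : (einv a x == y) = (x == estep a y).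
Proof. by rewrite (can2_eq (einvK a) (estepK a)). Qed.

Lemma count_einv a x (s : seq epoint) :
  count_mem x (map (einv a) s) = count_mem (estep a x) s.
Proof. by rewrite count_map; apply: eq_count => y /=; rewrite einv_eq. Qed.

Lemma count_addrs w x : count_mem x (addrs w) = hits x w.
Proof.
elim: w x => [|a w IH] x //=.
by rewrite count_einv IH einv_eq !(eq_sym origin) addnA.
Qed.

Lemma pairs_cons (K : eqType) (y : K) ys :
  pairs (y :: ys) = (pairs ys + (count_mem y ys).*2.+1)%N.
Proof.
rewrite /pairs big_cons /= eqxx.
have -> : (\sum_(z <- ys) ((y == z) + count_mem z ys) =
    count_mem y ys + \sum_(z <- ys) count_mem z ys)%N.
  rewrite big_split /=; congr (_ + _)%N; rewrite -sum1_count [RHS]big_mkcond /=.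
  by apply: eq_bigr => z _; rewrite eq_sym; case: eqP.
lia.
Qed.

Lemma pairs_map (K K' : eqType) (f : K -> K') ys : injective f ->
  pairs (map f ys) = pairs ys.
Proof.
move=> fI; elim: ys => [|y ys IH]; first by rewrite /pairs !big_nil.
rewrite map_cons !pairs_cons IH count_map; congr (_ + (_).*2.+1)%N.
by apply: eq_count => z /=; rewrite (inj_eq fI).
Qed.

(** A step added at the front creates coincidences of its two addresses with the later ones only;
    seen from the time of the address itself, these are returns of [origin] to [origin].
    Coincidences are thereby reduced to return probabilities. *)
Lemma pairs_addrs a w : pairs (addrs (a :: w)) =
  (pairs (addrs w) + (hits origin (a :: w)).*2 + (hits origin w).*2)%N.
Proof.
rewrite [addrs _]/= !pairs_cons pairs_map; last exact: einv_inj.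
rewrite [count_mem origin _]/= !count_einv einvK !count_addrs.
rewrite einv_eq eq_sym /= eqxx; lia.
Qed.

Lemma efin_cons x a w : efin x (a :: w) = efin (estep a x) w.
Proof. by []. Qed.

Fixpoint stays x w : nat :=
  if w is a :: w' then ((x == origin) + stays (estep a x) w')%N
  else (x == origin).

Lemma hits_stays x w : (hits x w <= (stays x w).*2)%N.
Proof.
suff : (hits x w + (x == origin) <= (stays x w).*2)%N by lia.
elim: w x => [|a w IH] x /=; first by lia.
by have := IH (estep a x); lia.
Qed.

Lemma card_bstep : (0 < #|{: bstep}|)%N.
Proof. by rewrite !card_prod card_bool. Qed.

Lemma avg_sum (A : finType) (I : Type) (r : seq I) (f : I -> A -> R) :
  avg (fun b => \sum_(i <- r) f i b) = \sum_(i <- r) avg (f i).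
Proof. by rewrite /avg exchange_big mulr_sumr. Qed.

Lemma Ex_stays n x : Ex n (fun w => (stays x w)%:R : R) =
  \sum_(k < n.+1) Ex k (fun w => (efin x w == origin)%:R).
Proof.
elim: n x => [|n IH] x; first by rewrite big_ord1.
rewrite big_ord_recl [X in X + _]/= -[X in X + _](avg_cst _ card_bstep).
have -> : \sum_(i < n.+1) Ex (lift ord0 i)
    (fun w => (efin x w == origin)%:R : R) =
    avg (fun a => \sum_(k < n.+1)
      Ex k (fun w => (efin (estep a x) w == origin)%:R)) by rewrite avg_sum.
rewrite -avgD ExS; apply: eq_avg => a; rewrite -IH.
by under eq_Ex do rewrite /= natrD; rewrite ExD Ex_cst ?card_bstep.
Qed.

Fixpoint tidx (c : int) (es : seq bool) : seq int :=
  if es is e :: es' then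
    [:: c - P, c + sgi e - P & tidx (c + sgi e) es']
  else [::].

Lemma size_tidx c es : size (tidx c es) = (size es).*2.
Proof. by elim: es c => //= e es IH c; rewrite IH. Qed.

Lemma efin_pos x w : (efin x w).1 = x.1 + psum (unzip1 w).
Proof.
elim: w x => [|a w IH] x; first by rewrite /= /psum big_nil addr0.
by rewrite efin_cons IH /= psum_cons addrA.
Qed.

Lemma efin_env x w i : 0 <= i < q%:Z ->
  (efin x w).2 i =
  x.2 i (+) xsum (tidx x.1 (unzip1 w)) (flatp (unzip2 w)) i.
Proof.
move=> iq; elim: w x => [|a w IH] x; first by rewrite /= addbF.
rewrite efin_cons IH /= /tog iq !(eq_sym i) !andbT.
by case: (_ == i); case: (_ == i); case: a => [? [[] []]] /=;
  rewrite ?andbF ?andbT /=; case: (x.2 i); case: xsum.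
Qed.

Lemma below_visit (h c m : int) es : c <= m -> m < h -> ~~ below h c es ->
  m - P \in tidx c es.
Proof.
elim: es c => [|e es IH] c cm mh /=; first by lia.
have -> : (c < h) = true by lia.
rewrite /= !inE => nb; case: (eqVneq c m) => [->|c'm]; first by rewrite eqxx.
by rewrite IH ?orbT//; case: e nb => /=; lia.
Qed.

(** A return before the walk reaches [P + q] is charged to the killed walk. Otherwise the path has
    crossed all [q] switches; given the path, their bits are independent and uniform, and all of
    them must vanish. *)
Lemma Ex_return n :
  Ex n (fun w => (efin origin w == origin)%:R : R) <=
  Ex n (fun es => ((psum es == 0) && below (P + q%:Z) 0 es)%:R)
  + 2^-1 ^+ q * Ex n (fun es => (psum es == 0)%:R).
Proof.
rewrite Ex_zip -ExZ -ExD; apply: Ex_le => es esn.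
have pos (w : seq (bool * bool)) : size w = n -> (efin origin (zip es w)).1 = psum es.
  by move=> wn; rewrite efin_pos unzip1_zip ?add0r// esn wn.
have [ps|ps] := eqVneq (psum es) 0; last first.
  rewrite mulr0 addr0 /= -[leRHS](@Ex_cst R (bool * bool)%type n).
    apply: Ex_le => w wn; case: eqP => // ow.
    by rewrite -(pos w wn) ow eqxx in ps.
  by rewrite card_prod card_bool.
have [nb|nb] := boolP (below _ _ _).
  rewrite /= mulr1; apply: (@le_trans _ _ 1).
    rewrite -[leRHS](@Ex_cst R (bool * bool)%type n) ?card_prod ?card_bool//.
    by apply: Ex_le => w _; case: eqP.
  by rewrite lerDl exprn_ge0 ?invr_ge0.
rewrite /= add0r mulr1.
pose Q := [seq k%:Z | k <- iota 0 q].
have uQ : uniq Q by rewrite map_inj_uniq ?iota_uniq// => ? ? [].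
have Qs : {subset Q <= tidx 0 es}.
  move=> i /mapP[k]; rewrite mem_iota => kq ->.
  have := @below_visit (P + q%:Z) 0 (P + k%:Z) es.
  have -> : P + k%:Z - P = k%:Z by lia.
  by apply => //; lia.
have := Ex_xsum_all R (fun=> false) uQ Qs.
rewrite size_map size_iota size_tidx esn -Ex_flatp; apply: le_trans.
apply: Ex_le => w wn; case: eqP => [ow|_] //=.
suff -> : all (fun i => xsum (tidx 0 es) (flatp w) i == false) Q by [].
apply/allP => i /mapP[k]; rewrite mem_iota => kq ->.
have kq' : 0 <= k%:Z < q%:Z by lia.
have := efin_env origin (zip es w) kq'.
rewrite ow unzip1_zip ?esn ?wn// unzip2_zip ?esn ?wn//=.
by move=> <-.
Qed.

Lemma Ex_hits_origin n :
  Ex n (fun w => (hits origin w)%:R : R) <=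
  2 * (2 * (P + q%:Z)%:~R + 2^-1 ^+ q * Num.sqrt n.+1%:R).
Proof.
apply: (@le_trans _ _ (2 * Ex n (fun w => (stays origin w)%:R))).
  rewrite -ExZ; apply: Ex_le => w _.
  by rewrite -natrM ler_nat mul2n hits_stays.
rewrite ler_wpM2l// Ex_stays; apply: le_trans.
  by apply: ler_sum => k _; apply: Ex_return.
rewrite big_split /= -mulr_sumr; apply: lerD.
  have h0 : 0 <= P + q%:Z by lia.
  have := @Ex_below_count_le R (P + q%:Z) n 0 h0 h0.
  rewrite max_l// subr0; apply: le_trans; apply: ler_sum => k _.
  by apply: Ex_le => es _; rewrite add0r.
by rewrite ler_wpM2l ?exprn_ge0 ?invr_ge0// Ex_zero_count_le.
Qed.

Lemma hits_mono n k : (k <= n)%N ->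
  Ex k (fun w => (hits origin w)%:R : R) <=
  2 * (2 * (P + q%:Z)%:~R + 2^-1 ^+ q * Num.sqrt n.+1%:R).
Proof.
move=> kn; apply: le_trans (Ex_hits_origin k) _.
rewrite ler_wpM2l// lerD2l ler_wpM2l ?exprn_ge0 ?invr_ge0//.
by rewrite ler_sqrt ?ler0n// ler_nat.
Qed.

Lemma Ex_pairs_addrs n :
  Ex n (fun w => (pairs (addrs w))%:R : R) <=
  4 * n%:R * (2 * (2 * (P + q%:Z)%:~R + 2^-1 ^+ q * Num.sqrt n.+1%:R)).
Proof.
set G := 2 * _.
have Gk k : (k <= n)%N -> Ex k (fun w => (hits origin w)%:R : R) <= G.
  exact: hits_mono.
suff H : forall k, (k <= n)%N ->
    Ex k (fun w => (pairs (addrs w))%:R : R) <= 4 * k%:R * G by exact: H.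
elim=> [|k IH] kn; first by rewrite /= /pairs big_nil mulr0 mul0r.
apply: (@le_trans _ _ (Ex k (fun w => (pairs (addrs w))%:R) +
  2 * Ex k.+1 (fun w => (hits origin w)%:R) +
  2 * Ex k (fun w => (hits origin w)%:R))); last first.
  have := IH (ltnW kn); have := Gk _ kn; have := Gk _ (ltnW kn).
  rewrite -(natr1 k); lra.
rewrite !ExS -avgZ.
rewrite -[X in X + _ + _](avg_cst _ card_bstep) -avgD.
rewrite -[X in _ + X](avg_cst _ card_bstep) -avgD.
apply: avg_le => a; rewrite -!ExZ -!ExD; apply: Ex_le => w _.
have aux (x y z : nat) :
    (x + y.*2 + z.*2)%:R <= x%:R + 2 * y%:R + 2 * z%:R :> R.
  by rewrite -!mul2n natrD natrD !natrM.
by rewrite pairs_addrs; exact: aux.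
Qed.

End EnvironmentChain.

(** * Upper bounds on the number of distinct lamps met *)

Section DistinctAddresses.
Variables (R : realType) (P : int) (q : nat).
Hypothesis P0 : 0 < P.
Implicit Types (x : epoint) (a : bstep) (w : seq bstep).

Local Notation stp := (estep P q).
Local Notation back := (einv P q).
Local Notation adr := (addrs P q).
Local Notation hit := (hits P q).

Definition naddr w : nat := size (undup (adr w)).

(** The starting address counts only if it is not met again in [w]. The second address of the step
    is also the first one of the nonempty [w], so it never adds anything. *)
Lemma naddr_cons a w : w != [::] ->
  (naddr (a :: w) <= (hit (stp a origin) w == 0) + naddr w)%N.
Proof.
move=> w0; rewrite /naddr /=.
have ow : origin \in adr w by case: w w0 => //= *; rewrite mem_head.
have -> : back a origin \in map (back a) (adr w) by rewrite map_f.
have -> : (origin \in back a origin :: map (back a) (adr w)) =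
    (stp a origin \in origin :: adr w).
  rewrite !inE; congr (_ || _); first by rewrite eq_sym einv_eq eq_sym.
  by rewrite -[origin in LHS](estepK P q a) (mem_map (@einv_inj P q a)).
rewrite inE undup_map_inj; last exact: einv_inj.
rewrite -count_addrs.
have -> : (count_mem (stp a origin) (adr w) == 0%N) =
  (stp a origin \notin adr w) by rewrite eqn0Ngt -has_count has_pred1.
by case: (_ == origin); case: (_ \in _); rewrite /= ?size_map.
Qed.

Lemma tog_below (c : int) b : c < P -> tog P q c b (fun=> false) = fun=> false.
Proof. exact: tog_low. Qed.

(** Until the walk has risen to [P] the environment of the lamp is untouched, so that coming back to
    the site means meeting the lamp. *)
Lemma hits0_path c w : w != [::] -> c < P -> hit (c, fun=> false) w = 0%N ->
  ~~ returns c (unzip1 w) || climbs P c (unzip1 w).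
Proof.
elim: w c => [//|[s [b1 b2]] w IH] c _ cP /=.
set x' := stp _ _ => h.
have /eqP c0 : (c == 0) = false.
  by apply/negP => /eqP c0; move: h; rewrite c0 eqxx.
have -> : (c == 0) = false by apply/eqP.
have -> : (P <= c) = false by lia.
rewrite /=; have [Pc|c'P] := leP P (c + sgi s).
  apply/orP; right; case: (unzip1 w) => [|s' es] //=.
  by rewrite Pc; have -> : (c + sgi s == 0) = false by lia.
have x'E : x' = (c + sgi s, fun=> false).
  by rewrite /x' /estep /= (tog_below _ cP) tog_below.
case: w IH h => [|a w] IH h.
  rewrite /=; case: eqP => // c'0; move: h.
  by rewrite x'E c'0 eqxx /= addn0; case: eqP.
rewrite IH//; move: h; rewrite x'E /=; lia.
Qed.

(** A lamp that is not met again either has a site that is not visited again, and then accounts for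
    a new distinct site, or is left by a climb to [P]. *)
Lemma naddr_le w :
  (naddr w <= size (undup (sites (unzip1 w))) + climb_count P (unzip1 w) + 1)%N.
Proof.
elim: w => [//|a w IH].
have [->|w0] := eqVneq w [::].
  apply: (@leq_trans 2); first by rewrite (leq_trans (size_undup _)).
  by rewrite addn1 ltnS (leq_trans _ (leq_addr _ _))// size_undup_sites_cons;
    case: a => [[]].
apply: leq_trans (naddr_cons a w0) _.
have -> : unzip1 (a :: w) = a.1 :: unzip1 w by [].
rewrite size_undup_sites_cons [climb_count _ _]/=.
suff : (hit (stp a origin) w == 0%N) ->
    ~~ returns (sgi a.1) (unzip1 w) || climbs P (sgi a.1) (unzip1 w).
  case: (_ == 0%N) => h; last by lia.
  by have /orP[->|->] := h isT; lia.
move=> /eqP h.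
have E0 : tog P q 0 a.2.1 (fun=> false) = fun=> false by rewrite tog_below.
have [aP|Pa] := ltP (sgi a.1) P.
  apply: hits0_path => //; move: h.
  by rewrite /estep /= E0 add0r tog_below.
apply/orP; right; case: (unzip1 w) => //= *.
by rewrite Pa; case: (a.1).
Qed.

Lemma Ex_unzip1 (A B : finType) n (f : seq A -> R) : (0 < #|B|)%N ->
  Ex n (fun w : seq (A * B) => f (unzip1 w)) = Ex n f.
Proof.
move=> B0; rewrite Ex_zip; apply: eq_Ex => u un.
rewrite -[RHS](@Ex_cst R B n _ B0); apply: eq_Ex => v vn.
by rewrite unzip1_zip// un vn.
Qed.

Definition env_in (e : int -> bool) := forall i, e i -> 0 <= i < q%:Z.

Lemma tog_env_in c b e : env_in e -> env_in (tog P q c b e).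
Proof.
move=> he i; rewrite /tog; case: (boolP (e i)) => [/he//|_] /=.
by case/and4P => _ _ -> ->.
Qed.

Lemma mem_addrs w x : x \in adr w ->
  - x.1 \in sites (unzip1 w) /\ env_in x.2.
Proof.
elim: w x => [//|a w IH] x /=.
have s0 : 0 \in sites (unzip1 w) by case: (unzip1 w) => *; rewrite mem_head.
have e0 : env_in (fun=> false) by [].
rewrite !inE => /or3P[/eqP->|/eqP->|/mapP[y /IH[ys ye] ->]].
- by split=> //; rewrite inE oppr_eq0 eqxx.
- split; last by do 2 apply: tog_env_in.
  rewrite /= opprB subr0; apply/orP; right; apply/mapP.
  by exists 0; rewrite ?add0r.
- split; last by do 2 apply: tog_env_in.
  apply/orP; right; apply/mapP.
  by exists (- y.1); rewrite // opprB addrC.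
Qed.

Fixpoint all_envs (k : nat) : seq (int -> bool) :=
  if k is k'.+1 then
    all_envs k' ++ [seq (fun i => e i (+) (i == k'%:Z)) | e <- all_envs k']
  else [:: fun=> false].

Lemma size_all_envs k : size (all_envs k) = (2 ^ k)%N.
Proof. by elim: k => //= k IH; rewrite size_cat size_map IH expnS; lia. Qed.

Lemma mem_all_envs (k : nat) (e : int -> bool) :
  (forall i, e i -> 0 <= i < k%:Z) -> e \in all_envs k.
Proof.
elim: k e => [|k IH] e he /=.
  rewrite inE; apply/eqP/funext => i; apply/negbTE/negP => /he; lia.
rewrite mem_cat; have [ek|ek] := boolP (e k%:Z); apply/orP; [right|left].
  apply/mapP; exists (fun i => e i (+) (i == k%:Z)).
    apply: IH => i; case: eqP => [->|ik]; first by rewrite ek.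
    by rewrite addbF => /he; lia.
  by apply/funext => i; rewrite addbK.
apply: IH => i ei; have := he i ei.
have : i <> k%:Z by move=> ik; move: ek; rewrite -ik ei.
lia.
Qed.

Lemma naddr_le_envs w :
  (naddr w <= size (undup (sites (unzip1 w))) * 2 ^ q)%N.
Proof.
rewrite -size_all_envs -(size_map -%R) -(size_allpairs pair).
apply: uniq_leq_size; first exact: undup_uniq.
move=> x; rewrite mem_undup => /mem_addrs[xs /mem_all_envs xe].
apply/allpairsP; exists x; split => //; last by case: x {xs xe}.
by apply/mapP; exists (- x.1); rewrite ?opprK// mem_undup.
Qed.

Lemma Ex_sites n : (0 < n)%N ->
  Ex n (fun es => (size (undup (sites es)))%:R : R) <=
  2 * Num.sqrt n%:R + 1.
Proof.
move=> n0; apply: (@le_trans _ _ (Ex n (fun es =>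
    ((mx es)%:~R + (mn es)%:~R) + 1 : R))).
  apply: Ex_le => es _; have := size_undup_sites es.
  by rewrite -(ler_int R) !intrD.
rewrite !ExD Ex_cst ?card_bool// lerD2r.
have := Ex_second_moment n0 (Ex_mx2 R n); have := Ex_second_moment n0 (Ex_mn2 R n).
lra.
Qed.

Lemma Ex_naddr_envs n : (0 < n)%N ->
  Ex n (fun w => (naddr w)%:R : R) <= (2 * Num.sqrt n%:R + 1) * 2 ^+ q.
Proof.
move=> n0; apply: le_trans (ler_wpM2r _ (Ex_sites n0)); last exact: exprn_ge0.
rewrite -[X in X * _](Ex_unzip1 (B := (bool * bool)%type)) ?card_prod ?card_bool//.
rewrite mulrC -ExZ; apply: Ex_le => w _.
by rewrite -natrX -natrM ler_nat mulnC naddr_le_envs.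
Qed.

Lemma Ex_naddr_climbs n : (0 < n)%N ->
  Ex n (fun w => (naddr w)%:R : R) <=
  2 * Num.sqrt n%:R + 2 + n%:R / P%:~R.
Proof.
move=> n0; apply: (@le_trans _ _ (Ex n (fun es =>
    (size (undup (sites es)))%:R + (climb_count P es)%:R + 1 : R))).
  rewrite -[leRHS](Ex_unzip1 (B := (bool * bool)%type)) ?card_prod ?card_bool//.
  apply: Ex_le => w _; rewrite -natrD natr1 ler_nat -addn1; exact: naddr_le.
rewrite !ExD Ex_cst ?card_bool//.
have := Ex_sites n0; have := Ex_climb_count R n P0; lra.
Qed.

End DistinctAddresses.

(** * Entropy and speed of random walks *)

Lemma fsum_seq (R : realType) (G : choiceType) (f : G -> R) (r : seq G) :
  (forall x, x \notin r -> f x = 0) ->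
  \sum_(x \in [set: G]) f x = \sum_(x <- undup r) f x.
Proof.
move=> fr; rewrite (fsbigE (undup r)) ?undup_uniq//.
  by apply: eq_bigl => x; rewrite in_setT.
by move=> x _; rewrite mem_undup => /fr.
Qed.

Lemma sum_indicator_le1 (R : realType) (G : eqType) (r : seq G) (x : G) :
  uniq r -> \sum_(g <- r) (x == g)%:R <= 1 :> R.
Proof.
move=> ur; have [xr|xr] := boolP (x \in r).
  rewrite (bigD1_seq x)//= eqxx big1 ?addr0// => g.
  by rewrite eq_sym => /negbTE->.
rewrite big_seq big1 ?ler01// => g gr; case: eqP => // xg.
by rewrite xg gr in xr.
Qed.

Lemma Ex_one_point (R : realType) (A : finType) n (w : seq A) :
  (0 < #|A|)%N -> size w = n ->
  Ex n (fun w' => (w' == w)%:R : R) = (#|A|%:R ^+ n)^-1.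
Proof.
move=> A0; elim: n w => [|n IH] [|a w] //= => [_|[wn]]; first by rewrite expr0 invr1.
rewrite /avg (bigD1 a)//= big1 ?addr0 => [|b ba].
  rewrite exprS invfM -(IH w wn); congr (_ * _); apply: eq_Ex => w' _.
  by rewrite eqseq_cons eqxx.
rewrite -[RHS](@Ex_cst R A n)//; apply: eq_Ex => w' _.
by rewrite eqseq_cons (negbTE ba).
Qed.

Section MassFunction.
Variables (R : realType) (A : finType) (G : choiceType).
Hypothesis A0 : (0 < #|A|)%N.

Definition mass n (X : seq A -> G) (g : G) : R :=
  Ex n (fun w => (X w == g)%:R).

Definition values n (X : seq A -> G) : seq G :=
  [seq X (tval t) | t : n.-tuple A].

Lemma mem_values n X w : size w = n -> X w \in values n X.
Proof.
move=> /eqP wn; rewrite /values.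
by apply/fintype.imageP; exists (Tuple wn).
Qed.

Lemma mass_ge0 n X g : 0 <= mass n X g.
Proof. by apply: Ex_ge0 => w _; rewrite ler0n. Qed.

Lemma mass_notin n X g : g \notin values n X -> mass n X g = 0.
Proof.
move=> gX; rewrite /mass -[RHS](@Ex_cst R A n)//; apply: eq_Ex => w wn.
by case: eqP => // Xg; rewrite -Xg mem_values in gX.
Qed.

Lemma mass_gt0 n X w : size w = n -> 0 < mass n X (X w).
Proof.
move=> wn; apply: (@lt_le_trans _ _ (Ex n (fun w' => (w' == w)%:R))).
  by rewrite Ex_one_point// invr_gt0 exprn_gt0// ltr0n.
by apply: Ex_le => w' _; case: (w' =P w) => [->|_]; rewrite ?eqxx// ler0n.
Qed.

Lemma sum_mass n X (phi : G -> R) :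
  \sum_(g <- undup (values n X)) mass n X g * phi g = Ex n (phi \o X).
Proof.
transitivity (Ex n (fun w => \sum_(g <- undup (values n X))
    phi g * (X w == g)%:R)).
  by rewrite Ex_sum; apply: eq_bigr => g _; rewrite ExZ mulrC.
apply: eq_Ex => w wn; rewrite (bigD1_seq (X w)) ?undup_uniq//=; last first.
  by rewrite mem_undup mem_values.
rewrite eqxx mulr1 big1 ?addr0// => g gX.
by rewrite eq_sym (negbTE gX) mulr0.
Qed.

Lemma fsum_mass n X (phi : G -> R) :
  \sum_(g \in [set: G]) mass n X g * phi g = Ex n (phi \o X).
Proof.
rewrite (@fsum_seq _ _ _ (values n X)) ?sum_mass// => g gX.
by rewrite mass_notin// mul0r.
Qed.

(* Gibbs' inequality *)
Lemma entropy_le_cross n X (q : G -> R) :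
  (forall w, size w = n -> 0 < q (X w)) ->
  \sum_(g <- undup (values n X)) q g <= 1 ->
  Ex n (fun w => - ln (mass n X (X w))) <= Ex n (fun w => - ln (q (X w))).
Proof.
move=> q0 q1; rewrite -subr_le0 -ExN -ExD.
apply: (@le_trans _ _ (Ex n (fun w => q (X w) / mass n X (X w) + (- 1)))).
  apply: Ex_le => w wn; rewrite opprK addrC.
  have p0 := mass_gt0 X wn; have q0' := q0 w wn.
  rewrite -lnV ?posrE// -lnM ?posrE// ?invr_gt0//.
  set r := _ / _; have r0 : 0 < r by rewrite mulr_gt0// invr_gt0.
  by have := @le_ln1Dx R (r - 1); rewrite addrCA subrr addr0; apply; lra.
rewrite ExD Ex_cst// -(@sum_mass n X (fun g => q g / mass n X g)) subr_le0.
apply: le_trans q1; rewrite big_seq_cond [leRHS]big_seq_cond.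
apply: ler_sum => g /andP[]; rewrite mem_undup => /fintype.imageP[t _ ->] _.
rewrite mulrCA divff ?mulr1// gt_eqF// mass_gt0//; exact: size_tuple.
Qed.

(** Gibbs' inequality against the law obtained by decoding a uniform word of random length, the
    length [l] having weight [2^-1 ^+ l.+1]; the random length stands in for a prefix condition on
    [code]. *)
Lemma entropy_le_code (B : finType) (B0 : (0 < #|B|)%N) n X
    (code : seq A -> seq B) (decode : seq B -> G) :
  (forall w, size w = n -> decode (code w) = X w) ->
  Ex n (fun w => - ln (mass n X (X w))) <=
  Ex n (fun w => (size (code w)).+1%:R * ln 2 + (size (code w))%:R * ln #|B|%:R).
Proof.
move=> codeK.
pose N := (\max_(t : n.-tuple A) size (code t)).+1.
pose q g := \sum_(l < N) 2^-1 ^+ l.+1 * Ex l (fun w : seq B => (decode w == g)%:R) : R.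
have q_ge w : size w = n ->
    2^-1 ^+ (size (code w)).+1 * (#|B|%:R ^+ size (code w))^-1 <= q (X w).
  move=> wn; have lN : (size (code w) < N)%N.
    move/eqP: (wn) => wn'; rewrite ltnS.
    exact: (@leq_bigmax _ (fun t : n.-tuple A => size (code t)) (Tuple wn')).
  rewrite /q (bigD1 (Ordinal lN))//= -[leLHS]addr0; apply: lerD; last first.
    apply: sumr_ge0 => i _; rewrite mulr_ge0 ?exprn_ge0 ?invr_ge0//.
    by apply: Ex_ge0 => *; rewrite ler0n.
  rewrite ler_wpM2l ?exprn_ge0 ?invr_ge0//.
  have sc : size (code w) = size (code w) by [].
  have := @Ex_le R B (size (code w)) (fun w' => (w' == code w)%:R)
    (fun w' => (decode w' == X w)%:R).
  rewrite (Ex_one_point _ B0 sc); apply => w' _.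
  by case: (w' =P code w) => [->|_]; rewrite ?codeK ?eqxx// ler0n.
have b0 : 0 < #|B|%:R :> R by rewrite ltr0n.
have q0 w : size w = n -> 0 < q (X w).
  move=> wn; apply: lt_le_trans (q_ge w wn).
  by rewrite mulr_gt0 ?invr_gt0 ?exprn_gt0.
apply: le_trans (entropy_le_cross q0 _) _; last first.
  apply: Ex_le => w wn; have := q_ge w wn; move: (size _) => l hq.
  have : ln (2^-1 ^+ l.+1 * (#|B|%:R ^+ l)^-1) <= ln (q (X w)).
    by rewrite ler_ln ?posrE ?q0// mulr_gt0 ?invr_gt0 ?exprn_gt0.
  rewrite lnM ?posrE ?invr_gt0 ?exprn_gt0// lnV ?posrE ?exprn_gt0//.
  rewrite !lnXn// ?invr_gt0// lnV ?posrE// -(mulr_natl (- ln 2)).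
  by rewrite -(mulr_natl (ln _)); lra.
rewrite /q exchange_big /=.
apply: (@le_trans _ _ (\sum_(l < N) 2^-1 ^+ l.+1)).
  apply: ler_sum => l _; rewrite -mulr_sumr -[leRHS]mulr1.
  rewrite ler_wpM2l ?exprn_ge0 ?invr_ge0//.
  rewrite -Ex_sum -[leRHS](@Ex_cst R B l 1)//; apply: Ex_le => w _.
  exact: sum_indicator_le1 (undup_uniq _).
have geo m : \sum_(l < m) 2^-1 ^+ l.+1 = 1 - 2^-1 ^+ m :> R.
  elim: m => [|m IH]; first by rewrite big_ord0 expr0 subrr.
  rewrite big_ord_recr /= IH exprS; lra.
by rewrite geo gerBl exprn_ge0 ?invr_ge0.
Qed.

End MassFunction.

Section RandomWalkOnGroup.
Variables (R : realType) (A : finType) (G : groupType) (h : A -> G).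
Hypothesis A0 : (0 < #|A|)%N.

Definition walk (w : seq A) : G := word_value (map h w).

Definition step_law : G -> R := mass R 1 walk.

Lemma word_value_cons (x : G) w : word_value (x :: w) = (x * word_value w)%g.
Proof. by rewrite /word_value big_cons. Qed.

Lemma walk_cons a w : walk (a :: w) = (h a * walk w)%g.
Proof. exact: word_value_cons. Qed.

Lemma walk1 a : walk [:: a] = h a.
Proof. by rewrite walk_cons /walk /word_value big_nil mulg1. Qed.

Lemma convolution_power_walk n :
  convolution_power step_law n = mass R n walk.
Proof.
apply/funext; elim: n => [|n IH] g.
  by rewrite /convolution_power /= /mass /= /walk /word_value big_nil eq_sym.
rewrite /convolution_power iterS -/(convolution_power _ _) (funext IH).
rewrite /convolution fsum_mass// /= /mass ExS; apply: eq_avg => a /=.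
apply: eq_Ex => w _; rewrite walk1 walk_cons.
congr ((nat_of_bool _)%:R).
by apply/eqP/eqP => [->|<-]; [rewrite mulVKg|rewrite mulKg].
Qed.

Lemma step_law_probability : finitely_supported_probability step_law.
Proof.
split=> [x||]; first exact: mass_ge0.
  apply: (@sub_finite_set _ _ [set` values 1 walk]); last exact: finite_seq.
  by move=> x /=; apply: contraNT => xv; rewrite /step_law mass_notin.
have := @fsum_mass R A G A0 1 walk (fun=> 1); under eq_fsbigr do rewrite mulr1.
by rewrite /step_law => ->; rewrite Ex_cst.
Qed.

Lemma step_law_symmetric (s : A -> A) : injective s ->
  (forall a, h (s a) = ((h a)^-1)%g) -> symmetric_measure step_law.
Proof.
move=> sI hs g; rewrite /step_law /mass !ExS /avg /=; congr (_ * _).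
rewrite (reindex_inj sI) /=; apply: eq_bigr => a _.
rewrite !walk1 hs.
by rewrite (can_eq invgK).
Qed.

Lemma speed_walk (S : set G) n : speed S step_law n =
  Ex n (fun w => (word_length S (walk w))%:R).
Proof. by rewrite /speed convolution_power_walk fsum_mass. Qed.

Lemma entropy_walk n : entropy step_law n =
  Ex n (fun w => - ln (mass R n walk (walk w))).
Proof.
by rewrite /entropy convolution_power_walk fsum_mass// ExN.
Qed.

End RandomWalkOnGroup.

(** Entropy dominates conditional entropy: for each [u], Gibbs' inequality compares the conditional
    law given [u] with the unconditional mass function. A bound on the conditional atoms then bounds
    the conditional entropy from below. *)
Lemma entropy_ge_conditional (R : realType) (A B : finType) (G : choiceType)
    n (X : seq (A * B) -> G) (f : seq A -> nat) :
  (0 < #|A|)%N -> (0 < #|B|)%N ->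
  (forall u g, size u = n ->
     Ex n (fun v => (X (zip u v) == g)%:R : R) <= 2^-1 ^+ f u) ->
  ln 2 * Ex n (fun u => (f u)%:R) <=
  Ex n (fun w => - ln (mass R n X (X w))).
Proof.
move=> A0 B0 Xf; rewrite Ex_zip -ExZ; apply: Ex_le => u un.
have AB0 : (0 < #|{: A * B}|)%N by rewrite card_prod muln_gt0 A0.
have sz v : size v = n -> size (zip u v) = n.
  by move=> vn; rewrite size_zip un vn minnn.
apply: le_trans (entropy_le_cross (X := fun v => X (zip u v)) B0
  (q := mass R n X) _ _); last 2 first.
- by move=> v vn; apply: mass_gt0 => //; exact: sz.
- rewrite /mass -Ex_sum -[leRHS](@Ex_cst R {: A * B} n 1)//; apply: Ex_le => w _.
  exact: sum_indicator_le1 (undup_uniq _).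
rewrite -[leLHS](@Ex_cst R B n)//; apply: Ex_le => v vn.
have p0 := mass_gt0 R B0 (fun v => X (zip u v)) vn.
rewrite -lnV ?posrE// mulrC.
have -> : (f u)%:R * ln 2 = ln (2 ^+ f u) :> R by rewrite lnXn// mulr_natl.
rewrite ler_ln ?posrE ?exprn_gt0 ?invr_gt0//.
rewrite -[leLHS]invrK lef_pV2 ?posrE ?invr_gt0 ?exprn_gt0//.
by rewrite -exprVn; apply: Xf.
Qed.

(** * Groups of permutations generated by moves *)

(* A set of moves: permutations of [mpoint], indexed by a finite alphabet
   closed under inversion.  Words act from the right. *)
Structure moves := Moves {
  mpoint : Type;
  letter : finType;
  mact : letter -> mpoint -> mpoint;
  minv : letter -> letter;
  mactK : forall l, cancel (mact l) (mact (minv l));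
  mactVK : forall l, cancel (mact (minv l)) (mact l) }.

Definition wact (M : moves) (w : seq (letter M)) (x : mpoint M) : mpoint M :=
  foldl (fun x l => mact l x) x w.

Definition winv (M : moves) (w : seq (letter M)) : seq (letter M) :=
  rev (map (@minv M) w).

Lemma wact_cat (M : moves) (v w : seq (letter M)) x :
  wact (v ++ w) x = wact w (wact v x).
Proof. exact: foldl_cat. Qed.

Lemma wact_cons (M : moves) l (w : seq (letter M)) x :
  wact (l :: w) x = wact w (mact l x).
Proof. by []. Qed.

Lemma winv_cons (M : moves) l (w : seq (letter M)) :
  winv (l :: w) = winv w ++ [:: minv l].
Proof. by rewrite /winv /= rev_cons cats1. Qed.

Lemma wactK (M : moves) (w : seq (letter M)) : cancel (wact w) (wact (winv w)).
Proof.
elim: w => [|l w IH] x //.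
by rewrite winv_cons wact_cat wact_cons IH /= mactK.
Qed.

Lemma wactVK (M : moves) (w : seq (letter M)) : cancel (wact (winv w)) (wact w).
Proof.
elim: w => [|l w IH] x //.
by rewrite winv_cons wact_cat wact_cons /= mactVK IH.
Qed.

Lemma size_winv (M : moves) (w : seq (letter M)) : size (winv w) = size w.
Proof. by rewrite size_rev size_map. Qed.

(** Elements are functions for which some word is asserted to exist in [Prop], so that equality in
    the group is equality of actions. *)
Record generated (M : moves) := Generated {
  gfun : mpoint M -> mpoint M;
  gword : exists w, gfun = wact w }.

Section GeneratedGroup.
Variable M : moves.
Implicit Types f g : generated M.

Lemma gfun_inj : injective (@gfun M).
Proof.
move=> [f fw] [g gw] /= fg; subst g; congr Generated; exact: Prop_irrelevance.
Qed.

Definition of_word (w : seq (letter M)) : generated M :=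
  Generated (ex_intro _ w erefl).

Definition some_word f : seq (letter M) := projT1 (cid (gword f)).

Lemma some_wordK f : of_word (some_word f) = f.
Proof.
by apply: gfun_inj => /=; rewrite /some_word; case: (cid (gword f)) => w /= ->.
Qed.

Definition gen_one : generated M := of_word [::].
Definition gen_mul f g : generated M := of_word (some_word f ++ some_word g).
Definition gen_inv f : generated M := of_word (winv (some_word f)).

Lemma of_word_eq v w : wact v =1 wact w <-> of_word v = of_word w.
Proof.
split=> [vw|/(congr1 (@gfun M)) /= ->//].
by apply: gfun_inj; apply/funext.
Qed.

Lemma gfun_of_word w : gfun (of_word w) = wact w. Proof. by []. Qed.

Lemma wact_some_word f : wact (some_word f) = gfun f.
Proof. by rewrite -[in RHS](some_wordK f). Qed.

Lemma gen_mulE v w : gen_mul (of_word v) (of_word w) = of_word (v ++ w).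
Proof.
by apply/of_word_eq => x; rewrite !wact_cat !wact_some_word.
Qed.

Fact gen_mulA : associative gen_mul.
Proof.
move=> f g k; rewrite -(some_wordK f) -(some_wordK g) -(some_wordK k).
by rewrite !gen_mulE catA.
Qed.

Fact gen_mul1 : left_id gen_one gen_mul.
Proof. by move=> f; rewrite -(some_wordK f) gen_mulE. Qed.

Fact gen_mulr1 : right_id gen_one gen_mul.
Proof. by move=> f; rewrite -(some_wordK f) gen_mulE cats0. Qed.

Fact gen_mulV : left_inverse gen_one gen_inv gen_mul.
Proof.
move=> f; rewrite -[X in gen_mul _ X]some_wordK gen_mulE.
by apply/of_word_eq => x; rewrite wact_cat wactVK.
Qed.

Fact gen_mulrV : right_inverse gen_one gen_inv gen_mul.
Proof.
move=> f; rewrite -[X in gen_mul X _]some_wordK gen_mulE.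
by apply/of_word_eq => x; rewrite wact_cat wactK.
Qed.

HB.instance Definition _ := gen_eqMixin (generated M).
HB.instance Definition _ := gen_choiceMixin (generated M).
HB.instance Definition _ := isGroup.Build (generated M)
  gen_mulA gen_mul1 gen_mulr1 gen_mulV gen_mulrV.

Lemma of_wordM v w : of_word (v ++ w) = (of_word v * of_word w)%g.
Proof. by symmetry; exact: gen_mulE. Qed.

Lemma of_wordV w : of_word (winv w) = ((of_word w)^-1)%g.
Proof.
apply: (mulgI (of_word w)); rewrite mulgV -of_wordM.
by apply/of_word_eq => x; rewrite wact_cat wactK.
Qed.

Lemma of_word_flatten (A : Type) (h : A -> seq (letter M)) (w : seq A) :
  word_value (map (fun a => of_word (h a)) w) = of_word (flatten (map h w)).
Proof.
elim: w => [|a w IH]; first by rewrite /word_value big_nil.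
by rewrite /= of_wordM -IH /word_value big_cons.
Qed.

Definition letter_set : set (generated M) := [set g | exists l, g = of_word [:: l]].

Lemma of_word_letters (w : seq (letter M)) :
  of_word w = word_value (map (fun l => of_word [:: l]) w).
Proof. by rewrite of_word_flatten; congr of_word; elim: w => //= l w <-. Qed.

Lemma letter_set_finite : finite_set letter_set.
Proof.
apply: (@sub_finite_set _ _ [set` [seq of_word [:: l] | l : letter M]]).
  by move=> g [l ->] /=; exact: fintype.image_f.
exact: finite_seq.
Qed.

Lemma letter_set_generates : generates letter_set.
Proof.
move=> g; exists (map (fun l => of_word [:: l]) (some_word g)).
  by move=> x /mapP[l _ ->]; left; exists l.
by rewrite -of_word_letters some_wordK.
Qed.

Lemma generated_finitely_generated : finitely_generated (generated M).
Proof. by exists letter_set; [exact: letter_set_finite|exact: letter_set_generates]. Qed.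

End GeneratedGroup.

(** * Word length, and its comparison with the number of letters *)

Section WordLength.
Variables (G : groupType) (S : set G).

Lemma word_length_le (w : seq G) : word_in S w ->
  (word_length S (word_value w) <= size w)%N.
Proof.
move=> wS; rewrite /word_length; case: xgetP => [n _ [_]|] //.
by apply; exists w.
Qed.

Hypothesis S_gen : generates S.

Lemma word_length_attained (g : G) :
  exists w, [/\ word_in S w, word_value w = g & size w = word_length S g].
Proof.
have [w wS wg] := S_gen g.
pose p n := `[< word_sizes S g n >].
have exp : exists n, p n by exists (size w); apply/asboolP; exists w.
rewrite /word_length; case: xgetP => [n _ [[w' h] _]|none]; first by exists w'.
case: (ex_minnP exp) => n /asboolP pn nmin.
by case: (none n); split=> // m /asboolP /nmin.
Qed.

End WordLength.

Section ComparisonOfWordLengths.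
Variables (M : moves) (S : set (generated M)).
Hypotheses (S_fin : finite_set S) (S_gen : generates S).

Lemma word_value_flatten (G : groupType) (A : Type) (h : A -> seq G) w :
  word_value (flatten (map h w)) = word_value (map (fun a => word_value (h a)) w).
Proof.
elim: w => [|a w IH] /=; first by rewrite /word_value !big_nil.
by rewrite word_value_cons -IH /word_value big_cat.
Qed.

Lemma size_flatten_le (A B : eqType) (h : A -> seq B) (K : nat) (w : seq A) :
  (forall a, a \in w -> (size (h a) <= K)%N) ->
  (size (flatten (map h w)) <= K * size w)%N.
Proof.
elim: w => [|a w IH] hK /=; first by rewrite muln0.
rewrite size_cat mulnS leq_add ?hK ?mem_head// IH// => b bw.
by rewrite hK// inE bw orbT.
Qed.

(** With the converse estimate that follows, length for any finite generating set agrees up to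
    constant factors with the number of letters, so the speed exponent is the same for all of
    them. *)
Lemma word_length_of_word : exists K : nat, forall w : seq (letter M),
  (word_length S (of_word w) <= K * size w)%N.
Proof.
exists (\max_(l : letter M) word_length S (of_word [:: l])) => w.
have [v vP] := choice (fun l : letter M =>
  word_length_attained S_gen (of_word [:: l])).
rewrite of_word_letters.
have -> : map (fun l => of_word [:: l]) w =
    map (fun l => word_value (v l)) w.
  by apply: eq_map => l; case: (vP l).
rewrite -word_value_flatten; apply: leq_trans (word_length_le _) _.
  move=> x /flatten_mapP[l _]; case: (vP l) => vS _ _; exact: vS.
apply: size_flatten_le => l _; case: (vP l) => _ _ ->.
exact: (@leq_bigmax _ (fun l => word_length S (of_word [:: l]))).
Qed.

Lemma of_word_word_length : exists K : nat, forall g : generated M,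
  exists2 w, of_word w = g & (size w <= K * word_length S g)%N.
Proof.
have [s sS] : exists s : seq (generated M), S = [set` s].
  by have /finite_seqP[s ->] := S_fin; exists s.
pose r (x : generated M) := some_word x.
pose r' (x : generated M) : seq (letter M) :=
  if x \in s then r x else winv (r (x^-1)%g).
pose K := (\max_(x <- s) size (r x))%N; exists K => g.
have sK y : y \in s -> (size (r y) <= K)%N.
  by move=> ys; rewrite /K; apply: (leq_bigmax_seq (F := fun z => size (r z))).
have [v [vS vg vl]] := word_length_attained S_gen g.
exists (flatten (map r' v)).
  rewrite -of_word_flatten -vg; congr word_value.
  rewrite -[RHS]map_id; apply: eq_map => x; rewrite /r'.
  by case: ifP => _; rewrite ?of_wordV some_wordK ?invgK.
rewrite -vl; apply: size_flatten_le => x /vS; rewrite sS /= /r'.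
case: ifPn => [xs _|_ [//|xs]].
  exact: sK.
by rewrite size_winv; exact: sK.
Qed.

End ComparisonOfWordLengths.

(** * The group *)

(** The walk uses [Gt] (move the cursor), [Gx] (flip the switch at the cursor) and [Gy] (turn
    lamps). The others let its elements be written briefly: [Gp] and [Gj] travel between scales and
    levels, [Gu] shifts the environment and [Gv] flips its bit 0, [Ga] and [Gb] reflect rotations,
    [Gf] turns by large amounts. Conjugated by a power of [Gp], [Ga] singles out one scale, whereas
    [Gb] acts on all of them. *)
Inductive generator :=
  | Gt | Gx | Gp | Gj | Gu | Gv | Ga | Gb | Gy | Gf.

Definition generator_list := [:: Gt; Gx; Gp; Gj; Gu; Gv; Ga; Gb; Gy; Gf].

Definition generator_index (g : generator) : nat :=
  match g with
  | Gt => 0 | Gx => 1 | Gp => 2 | Gj => 3 | Gu => 4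
  | Gv => 5 | Ga => 6 | Gb => 7 | Gy => 8 | Gf => 9
  end.

Lemma generator_indexK : cancel generator_index (nth Gt generator_list).
Proof. by case. Qed.

HB.instance Definition _ := Countable.copy generator (can_type generator_indexK).

Lemma generator_enumP (g : generator) : count_mem g generator_list = 1%N.
Proof. by case: g. Qed.

HB.instance Definition _ := fintype.isFinite.Build generator generator_enumP.

(* In a point [((p, j), x)] the coordinates [p] and [j] select a scale and an
   amplifier level when they are powers of two, and [x] is the address of a
   lamp; an integer, the rotation of that lamp, is attached to every point. *)
Definition bpoint := ((int * int) * epoint)%type.

Definition log2 (p : int) : nat := trunc_log 2 (absz p).
Definition pow2 (s : nat) : int := (2 ^ s)%N%:Z.
Definition is_pow2 (p : int) : bool := p == pow2 (log2 p).

Lemma log2_pow2 s : log2 (pow2 s) = s.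
Proof. by rewrite /log2 /pow2 absz_nat trunc_expnK. Qed.

Lemma is_pow2_pow2 s : is_pow2 (pow2 s).
Proof. by rewrite /is_pow2 log2_pow2. Qed.

Lemma pow2_gt0 s : 0 < pow2 s.
Proof. by rewrite /pow2 ltz_nat expn_gt0. Qed.

Lemma is_pow2_gt0 p : is_pow2 p -> 0 < p.
Proof. by move=> /eqP->; exact: pow2_gt0. Qed.

Section Moves.
(* [q s] is the number of environment bits at scale [2 ^ s]; [Gf] adds
   [amp i] at level [2 ^ i]. *)
Variables (q amp : nat -> nat).

Definition bmove (g : generator) (s : bool) (b : bpoint) : bpoint :=
  let: ((p, j), (c, e)) := b in
  match g with
  | Gt => ((p, j), (c + sgi s, e))
  | Gx => ((p, j), (c, tog p (q (log2 p)) c true e))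
  | Gp => ((p + sgi s, j), (c, e))
  | Gj => ((p, j + sgi s), (c, e))
  | Gu => ((p, j), (c, fun i => e (i + sgi s)))
  | Gv => ((p, j), (c, fun i => e i (+) (i == 0)))
  | _ => b
  end.

(* Comparing [Gf] with its conjugate by a reflection isolates the shift of the
   reflected point. *)
Definition reflects (g : generator) (b : bpoint) : bool :=
  let: ((p, j), x) := b in
  match g with
  | Ga => [&& p == 0, j == 0 & x == origin]
  | Gb => [&& is_pow2 p, j == 0 & x == origin]
  | _ => false
  end.

(** The value 2 of [Gy] matches the doubling of rotations by commutators with reflections. As only
    powers of two are active, a word of length [l] has access to logarithmically many levels. *)
Definition shifts (g : generator) (b : bpoint) : int :=
  let: ((p, j), x) := b in
  match g with
  | Gy => if [&& is_pow2 p, j == 0 & x == origin] then 2 else 0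
  | Gf => if [&& is_pow2 p, is_pow2 j & x == origin]
          then (amp (log2 j))%:Z else 0
  | _ => 0
  end.

Definition lmove (l : generator * bool) (z : bpoint * int) : bpoint * int :=
  (bmove l.1 l.2 z.1,
   (if reflects l.1 z.1 then - z.2 else z.2) + sgi l.2 * shifts l.1 z.1).

Definition linv (l : generator * bool) : generator * bool := (l.1, ~~ l.2).

Lemma sgiN s : sgi (~~ s) = - sgi s. Proof. by case: s. Qed.

Lemma bmoveK g s : cancel (bmove g s) (bmove g (~~ s)).
Proof.
case=> [[p j] [c e]]; case: g => //=; rewrite ?sgiN ?addrK ?togK//.
  by congr (_, (_, _)); apply/funext => i; rewrite subrK.
by congr (_, (_, _)); apply/funext => i; rewrite addbK.
Qed.

Lemma lmoveK l : cancel (lmove l) (lmove (linv l)).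
Proof.
case: l => g s [b k]; rewrite /lmove /linv /= bmoveK; congr (_, _).
case: b => [[p j] [c e]].
case: g => //=; rewrite ?mulr0 ?addr0 ?sgiN ?mulNr ?addrK//.
all: by case: [&& _, _ & _]; rewrite ?opprK.
Qed.

Lemma lmoveVK l : cancel (lmove (linv l)) (lmove l).
Proof. by move=> z; rewrite -[X in lmove X _](_ : linv (linv l) = l) ?lmoveK//;
  case: l => ? []. Qed.

Definition lamp_moves : moves := Moves lmoveK lmoveVK.

Local Notation wact := (@wact lamp_moves).

Definition step_type := (bstep * (bool * bool))%type.

Definition step_word (a : step_type) : seq (letter lamp_moves) :=
  nseq a.1.2.1 (Gx, true) ++ [:: (Gy, a.2.1); (Gt, a.1.1)]
  ++ nseq a.1.2.2 (Gx, true) ++ [:: (Gy, a.2.2)].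

Definition walk_word (w : seq step_type) : seq (letter lamp_moves) :=
  flatten (map step_word w).

Definition scale_rot (p j : int) (w : seq step_type) (x : epoint) : int :=
  if is_pow2 p && (j == 0)
  then 2 * ssum (addrs p (q (log2 p)) (unzip1 w)) (flatp (unzip2 w)) x else 0.

Lemma wact_nseq_x (b : bool) p j c e k :
  wact (nseq b (Gx, true)) (((p, j), (c, e)), k) =
  (((p, j), (c, tog p (q (log2 p)) c b e)), k).
Proof.
by case: b; rewrite /= /lmove /= ?tog_false// mulr0 addr0.
Qed.

Lemma ssum_map (K K' : eqType) (f : K -> K') (ys : seq K) es (a : K) :
  injective f -> ssum (map f ys) es (f a) = ssum ys es a.
Proof.
by move=> fI; elim: ys es => [|y ys IH] [|e es] //=; rewrite (inj_eq fI) IH.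
Qed.

Lemma wact_step_word a p j x k :
  wact (step_word a) (((p, j), x), k) =
  (((p, j), estep p (q (log2 p)) a.1 x),
   k + if is_pow2 p && (j == 0) then
     2 * ((if x == origin then sgi a.2.1 else 0) +
          (if estep p (q (log2 p)) a.1 x == origin then sgi a.2.2 else 0))
   else 0).
Proof.
have lmy u v m : @mact lamp_moves (Gy, u) (((p, j), v), m) = (((p, j), v),
    m + sgi u * (if [&& is_pow2 p, j == 0 & v == origin] then 2 else 0)).
  by case: v.
have wact_nil z : wact [::] z = z by [].
have lmt u c e m : @mact lamp_moves (Gt, u) (((p, j), (c, e)), m) =
    (((p, j), (c + sgi u, e)), m).
  by rewrite /= /lmove /= mulr0 addr0.
case: a => [[s [b1 b2]] [n1 n2]]; case: x => c e.
have -> : step_word ((s, (b1, b2)), (n1, n2)) = nseq b1 (Gx, true) ++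
  ([:: (Gy, n1); (Gt, s)] ++ (nseq b2 (Gx, true) ++ [:: (Gy, n2)])) by [].
rewrite wact_cat wact_nseq_x wact_cat 2!wact_cons lmy lmt.
rewrite wact_nil wact_cat wact_nseq_x wact_cons lmy.
rewrite wact_nil.
(* A switch letter does not disturb the turn that follows it: at the site itself [c = 0 < p], hence
   no switch of that lamp is in reach. *)
have -> : [&& is_pow2 p, j == 0 & (c, tog p (q (log2 p)) c b1 e) == origin] =
    [&& is_pow2 p, j == 0 & (c, e) == origin].
  case pp : (is_pow2 p) => //=; congr (_ && _); rewrite /origin -!pair_eqE /=.
  by case: eqP => //= ->; rewrite tog_low// is_pow2_gt0.
congr (_, _); rewrite -addrA; congr (_ + _).
case: (is_pow2 p) => /=; last by rewrite !mulr0 addr0.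
case: (j == 0) => /=; last by rewrite !mulr0 addr0.
rewrite mulrDr; congr (_ + _); case: (_ == origin);
  by rewrite ?mulr0// mulrC.
Qed.

Lemma wact_walk_word w p j x k :
  wact (walk_word w) (((p, j), x), k) =
  (((p, j), efin p (q (log2 p)) x (unzip1 w)), k + scale_rot p j w x).
Proof.
elim: w x k => [|a w IH] x k.
  by rewrite /= /scale_rot /= mulr0 if_same addr0.
have -> : walk_word (a :: w) = step_word a ++ walk_word w by [].
rewrite wact_cat wact_step_word IH.
congr (_, _); rewrite -addrA; congr (_ + _); rewrite /scale_rot.
case: (is_pow2 p && (j == 0)) => [|//].
rewrite -mulrDr; congr (_ * _); rewrite [RHS]/= -addrA.
rewrite (eq_sym origin) einv_eq (eq_sym origin); congr (_ + (_ + _)).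
rewrite -{2}(estepK p (q (log2 p)) a.1 x) ssum_map//; exact: einv_inj.
Qed.

Definition step_inv (a : step_type) : step_type :=
  ((~~ a.1.1, (a.1.2.2, a.1.2.1)), (~~ a.2.2, ~~ a.2.1)).

Lemma step_inv_inj : injective step_inv.
Proof.
by apply: (can_inj (g := step_inv)) => -[[s [b1 b2]] [n1 n2]];
  rewrite /step_inv /= !negbK.
Qed.

Lemma estep_inv a x p n : estep p n (step_inv a).1 x = einv p n a.1 x.
Proof.
by case: a => [[s [b1 b2]] n']; case: x => c e; rewrite /estep /einv /= sgiN.
Qed.

(** Reversing a step exchanges each switch letter with the adjacent turn. The two commute, because
    the walker at the site of a lamp is not at any of its switches. *)
Lemma of_step_word_inv a :
  of_word (step_word (step_inv a)) = ((of_word (step_word a))^-1)%g.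
Proof.
apply: (mulgI (of_word (step_word a))); rewrite mulgV -of_wordM.
apply/of_word_eq => -[[[p j] x] k]; rewrite wact_cat !wact_step_word.
rewrite estep_inv estepK /= -addrA; congr (_, _); rewrite -[RHS]addr0.
congr (_ + _); case: ifP => _; last by rewrite addr0.
rewrite -mulrDr !sgiN.
by case: eqP; case: eqP => _ _; rewrite ?addr0 ?add0r; lia.
Qed.

End Moves.

(** * Spelling elements by short words *)

Section Spelling.
Variables (q amp : nat -> nat).
Local Notation M := (lamp_moves q amp).
Local Notation mp := (bpoint * int)%type.
Implicit Types (f g : mp -> mp) (b : bpoint).

Definition spells f (n : nat) :=
  exists2 w : seq (letter M), @wact M w =1 f & (size w <= n)%N.

Definition basemap (m : bpoint -> bpoint) : mp -> mp := fun z => (m z.1, z.2).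

Definition rotation (c : bpoint -> int) : mp -> mp :=
  fun z => (z.1, z.2 + c z.1).

Definition reflection (P : bpoint -> bool) : mp -> mp :=
  fun z => (z.1, if P z.1 then - z.2 else z.2).

Lemma spells_ext f g n : f =1 g -> spells f n -> spells g n.
Proof. by move=> fg [w wf wn]; exists w => // z; rewrite wf fg. Qed.

Lemma spells_le f m n : (m <= n)%N -> spells f m -> spells f n.
Proof. by move=> mn [w wf wm]; exists w => //; exact: leq_trans mn. Qed.

Lemma spells_id : spells id 0.
Proof. by exists [::]. Qed.

Lemma spells_comp f g m n : spells f m -> spells g n -> spells (g \o f) (m + n).
Proof.
move=> [v vf vm] [w wg wn]; exists (v ++ w); last by rewrite size_cat leq_add.
by move=> z; rewrite wact_cat vf wg.
Qed.

(** The hypothesis says that [h] is the conjugate of [g] by [f]; stating it as an intertwining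
    relation avoids naming the inverse of [f]. *)
Lemma spells_conj f g m n : spells f m -> spells g n ->
  forall h, f \o h =1 g \o f -> spells h (n + 2 * m).
Proof.
move=> [v vf vm] [w wg wn] h fh; exists (v ++ (w ++ winv v)).
  by move=> z; rewrite !wact_cat vf wg -(fh z : f (h z) = g (f z)) -vf wactK.
by rewrite !size_cat size_winv; lia.
Qed.

Lemma spells_iter m l k : spells (basemap m) l ->
  spells (basemap (iter k m)) (k * l).
Proof.
move=> ml; elim: k => [|k IH].
  by apply: spells_ext spells_id => -[].
rewrite mulSn; apply: (spells_ext (f := basemap m \o basemap (iter k m))).
  by move=> z.
by rewrite addnC; exact: spells_comp.
Qed.

(** * Commuting families: rotations under addition, reflections under exclusive or *)

Section AbelianFamily.
Variables (V : Type) (idx : V) (op : Monoid.com_law idx).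
Variable D : (bpoint -> V) -> mp -> mp.
Hypotheses
  (D_ext : forall c c', c =1 c' -> D c =1 D c')
  (D_idx : D (fun=> idx) =1 id)
  (D_op : forall c c', D c' \o D c =1 D (fun b => op (c b) (c' b)))
  (D_conj : forall c m, basemap m \o D (c \o m) =1 D c \o basemap m).

Lemma spells_family_conj m l c n : spells (basemap m) l -> spells (D c) n ->
  spells (D (c \o m)) (n + 2 * l).
Proof. by move=> ml cn; apply: (spells_conj ml cn); exact: D_conj. Qed.

Lemma spells_family_op c c' n n' : spells (D c) n -> spells (D c') n' ->
  spells (D (fun b => op (c b) (c' b))) (n + n').
Proof. by move=> cn cn'; apply: spells_ext (spells_comp cn cn'); exact: D_op. Qed.

Lemma spells_family_seq (I : eqType) (r : seq I) (c : I -> bpoint -> V)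
    (l : I -> nat) :
  (forall i, i \in r -> spells (D (c i)) (l i)) ->
  spells (D (fun b => \big[op/idx]_(i <- r) c i b)) (\sum_(i <- r) l i).
Proof.
elim: r => [|i r IH] h.
  rewrite big_nil; apply: spells_ext (spells_ext (fun z => esym (D_idx z)) spells_id).
  by apply: D_ext => b; rewrite big_nil.
rewrite big_cons; apply: spells_ext; last first.
  apply: spells_family_op; first by apply: h; rewrite mem_head.
  by apply: IH => j jr; apply: h; rewrite inE jr orbT.
by apply: D_ext => b; rewrite big_cons.
Qed.

(* Reading the summands while moving by [m] between them makes the cost of the
   moves linear in the number of summands. *)
Lemma spells_family_tour m l (k : nat) (c : nat -> bpoint -> V) (n : nat -> nat) :
  spells (basemap m) l ->
  (forall i, (i < k)%N -> spells (D (c i)) (n i)) ->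
  spells (D (fun b => \big[op/idx]_(i < k) c i (iter i m b)))
    (\sum_(i < k) n i + k * (2 * l)).
Proof.
move=> ml; elim: k c n => [|k IH] c n h.
  rewrite big_ord0 mul0n; apply: spells_ext (spells_ext (fun z => esym (D_idx z)) spells_id).
  by apply: D_ext => b; rewrite big_ord0.
have IH' := IH (c \o succn) (n \o succn) (fun i ik => h i.+1 ik).
have := spells_family_op (h 0%N isT) (spells_family_conj ml IH').
rewrite big_ord_recl mulSn => hs; apply: spells_ext (spells_le _ hs).
  apply: D_ext => b; rewrite big_ord_recl /=; congr (op _ _).
  by apply: eq_bigr => i _; rewrite /= -iterSr.
rewrite [X in (_ <= _ + X + _)%N](eq_bigr (fun i : 'I_k => n i.+1))//=; lia.
Qed.

End AbelianFamily.

Lemma spells_letter (l : letter M) f : @mact M l =1 f -> spells f 1.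
Proof. by exists [:: l]. Qed.

Definition move_site (a : int) b : bpoint := (b.1, (b.2.1 + a, b.2.2)).
Definition move_scale (a : int) b : bpoint := ((b.1.1 + a, b.1.2), b.2).
Definition move_level (a : int) b : bpoint := ((b.1.1, b.1.2 + a), b.2).
Definition flip_env (e : int -> bool) b : bpoint :=
  (b.1, (b.2.1, fun i => b.2.2 i (+) e i)).

Lemma spells_power (mv : int -> bpoint -> bpoint) :
  (forall b, mv 0 b = b) -> (forall x y b, mv x (mv y b) = mv (y + x) b) ->
  (forall s, spells (basemap (mv (sgi s))) 1) ->
  forall a, spells (basemap (mv a)) (absz a).
Proof.
move=> mv0 mvD mv1 a; pose s := 0 <= a.
have E k b : iter k (mv (sgi s)) b = mv (k%:Z * sgi s) b.
  elim: k => [|k IH]; first by rewrite mul0r mv0.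
  by rewrite /= IH mvD -addn1 PoszD mulrDl mul1r.
have := spells_iter (absz a) (mv1 s); rewrite muln1; apply: spells_ext => -[b k].
rewrite /basemap /= E; congr (mv _ _, _); rewrite /s /sgi.
by case: (leP 0 a) => h; lia.
Qed.

Lemma spells_site a : spells (basemap (move_site a)) (absz a).
Proof.
apply: spells_power => [[? [? ?]]|x y b|s] //.
- by rewrite /move_site /= addr0.
- by rewrite /move_site /= addrA.
apply: (@spells_letter (Gt, s)) => -[[[p j] [c e]] k].
by rewrite /= /lmove /= mulr0 addr0.
Qed.

Lemma spells_scale a : spells (basemap (move_scale a)) (absz a).
Proof.
apply: spells_power => [[[? ?] ?]|x y b|s] //.
- by rewrite /move_scale /= addr0.
- by rewrite /move_scale /= addrA.
apply: (@spells_letter (Gp, s)) => -[[[p j] [c e]] k].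
by rewrite /= /lmove /= mulr0 addr0.
Qed.

Lemma spells_level a : spells (basemap (move_level a)) (absz a).
Proof.
apply: spells_power => [[[? ?] ?]|x y b|s] //.
- by rewrite /move_level /= addr0.
- by rewrite /move_level /= addrA.
apply: (@spells_letter (Gj, s)) => -[[[p j] [c e]] k].
by rewrite /= /lmove /= mulr0 addr0.
Qed.

(** A Horner scheme: treat bit 0, shift the environment by one, recurse, and shift back, which makes
    three letters per bit. *)
Lemma spells_flip_env (e : int -> bool) (n : nat) :
  (forall i, e i -> 0 <= i < n%:Z) -> spells (basemap (flip_env e)) (3 * n).
Proof.
elim: n e => [|n IH] e he.
  rewrite muln0; apply: (spells_ext _ spells_id) => -[[x [c e']] k].
  rewrite /basemap /flip_env /=; congr (_, (_, _), _); apply/funext => i.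
  have -> : e i = false by apply/negbTE/negP => /he; lia.
  by rewrite addbF.
have he' i : e (i + 1) && (i != -1) -> 0 <= i < n%:Z.
  by move=> /andP[/he + i1]; lia.
have shift s : spells (basemap (fun b => (b.1, (b.2.1, fun i => b.2.2 (i + sgi s))))) 1.
  apply: (@spells_letter (Gu, s)) => -[[[p j] [c e']] k].
  by rewrite /= /lmove /= mulr0 addr0.
have head : spells (basemap (fun b => (b.1, (b.2.1, fun i => b.2.2 i (+)
    (e 0 && (i == 0)))))) 1.
  case: (e 0); last first.
    apply: spells_le (leq0n 1) _; apply: (spells_ext _ spells_id).
    move=> -[[x [c e']] k]; congr (_, (_, _), _); apply/funext => i.
    by rewrite /= addbF.
  apply: (@spells_letter (Gv, true)) => -[[[p j] [c e']] k].
  by rewrite /= /lmove /= mulr0 addr0.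
have tail := spells_conj (shift true) (IH _ he').
apply: (@spells_le _ (1 + (3 * n + 2 * 1))); first by lia.
apply: spells_ext (spells_comp head (tail (basemap (flip_env
    (fun i => e i && (i != 0)))) _)).
  move=> -[[x [c e']] k]; rewrite /basemap /flip_env /=.
  congr (_, (_, _), _); apply/funext => i.
  by case: (eqVneq i 0) => [->|_]; case: (e _); rewrite ?andbT ?andbF ?addbF.
move=> -[[x [c e']] k]; rewrite /basemap /flip_env /=.
congr (_, (_, _), _); apply/funext => i; congr (_ (+) (_ && _)).
by lia.
Qed.

Lemma spells_rotation_conj m l c n : spells (basemap m) l ->
  spells (rotation c) n -> spells (rotation (c \o m)) (n + 2 * l).
Proof. exact: spells_family_conj. Qed.

Lemma spells_reflection_conj m l P n : spells (basemap m) l ->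
  spells (reflection P) n -> spells (reflection (P \o m)) (n + 2 * l).
Proof. exact: spells_family_conj. Qed.

End Spelling.

(** * Prescribed rotations of finitely many lamps *)

Section LampConfigurations.
#[local] Arguments shifts : simpl never.
Variables (q amp : nat -> nat).
Local Notation spells := (spells q amp).
Local Notation M := (lamp_moves q amp).
Implicit Types (b : bpoint) (x : epoint).

(** It carries [x] to [origin], so that conjugation by it turns a letter acting at [origin] into one
    acting at [x]. *)
Definition translate x b : bpoint := flip_env x.2 (move_site (- x.1) b).

Lemma translateE x p j y : (translate x ((p, j), y)).1 = (p, j). Proof. by []. Qed.

Lemma translate_origin x p j y :
  ((translate x ((p, j), y)).2 == origin) = (y == x).
Proof.
case: x y => [c e] [c' e']; rewrite /translate /flip_env /move_site /origin /=.
apply/eqP/eqP => [[cc ee]|[-> ->]].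
  congr (_, _); first by move: cc; lia.
  apply/funext => i; have := congr1 (@^~ i) ee => /=.
  by case: (e i); case: (e' i).
congr (_, _); first by rewrite subrr.
by apply/funext => i; rewrite addbb.
Qed.

Lemma reflectsGa b :
  reflects Ga b = [&& b.1.1 == 0, b.1.2 == 0 & b.2 == origin].
Proof. by case: b => -[]. Qed.

Lemma reflectsGb b :
  reflects Gb b = [&& is_pow2 b.1.1, b.1.2 == 0 & b.2 == origin].
Proof. by case: b => -[]. Qed.

Lemma shiftsGf b : shifts amp Gf b =
  if [&& is_pow2 b.1.1, is_pow2 b.1.2 & b.2 == origin]
  then (amp (log2 b.1.2))%:Z else 0.
Proof. by case: b => -[]. Qed.

Section Window.
Variables (a k n : nat) (A : seq epoint).
Hypothesis A_in : forall x, x \in A ->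
  - a%:Z <= x.1 < k%:Z - a%:Z /\ (forall i, x.2 i -> 0 <= i < n%:Z).

Lemma big_by_site (V : Type) (idx : V) (op : Monoid.com_law idx)
    (F : epoint -> V) :
  \big[op/idx]_(i < k) \big[op/idx]_(x <- A | x.1 == i%:Z - a%:Z) F x =
  \big[op/idx]_(x <- A) F x.
Proof.
rewrite (exchange_big_dep xpredT)//= big_seq [RHS]big_seq.
apply: eq_bigr => -[z e] /A_in[/= /andP[ax xk] _].
have ik : (absz (z + a%:Z)%R < k)%N by lia.
rewrite (big_pred1 (Ordinal ik))// => i /=.
by apply/idP/eqP => [h|->]; [apply: val_inj => /=; lia|rewrite /=; lia].
Qed.

(** A single tour passes over the [k] sites of the window and treats the lamps of each site in turn;
    per lamp only the environment is rewritten, with at most [3 * n] letters before and after. *)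
Lemma spells_family_points (V : Type) (idx : V) (op : Monoid.com_law idx)
    (D : (bpoint -> V) -> bpoint * int -> bpoint * int)
    (f : epoint -> bpoint -> V) (l : epoint -> nat) :
  (forall c c', c =1 c' -> D c =1 D c') ->
  (D (fun=> idx) =1 id) ->
  (forall c c', D c' \o D c =1 D (fun b => op (c b) (c' b))) ->
  (forall c m, basemap m \o D (c \o m) =1 D c \o basemap m) ->
  (forall x, x \in A -> spells (D (f x)) (l x)) ->
  spells (D (fun b => \big[op/idx]_(x <- A) f x (translate x b)))
    (\sum_(x <- A) (l x + 6 * n) + 2 * k + 2 * a).
Proof.
move=> D_ext D_idx D_op D_conj fl.
pose c i b := \big[op/idx]_(x <- A | x.1 == i%:Z - a%:Z) f x (flip_env x.2 b).
have cl i : spells (D (c i))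
    (\sum_(x <- A | x.1 == i%:Z - a%:Z) (l x + 6 * n)).
  rewrite -big_filter; apply: spells_ext; last first.
    apply: (spells_family_seq D_ext D_idx D_op) => x.
    rewrite mem_filter => /andP[_ xA].
    have := spells_family_conj D_conj (spells_flip_env _ _ (A_in xA).2) (fl x xA).
    by apply: spells_le; lia.
  by apply: D_ext => b; rewrite /c -[RHS]big_filter.
have := spells_family_tour D_ext D_idx D_op D_conj (k := k)
  (spells_site q amp (-1)) (fun i _ => cl i).
rewrite (big_by_site addn) => tour.
have := spells_family_conj D_conj (spells_site q amp a%:Z) tour.
have E : (fun b => \big[op/idx]_(i < k) c i (iter i (move_site (-1)) b))
    \o move_site a%:Z =1 (fun b => \big[op/idx]_(x <- A) f x (translate x b)).
  move=> b /=; rewrite -big_by_site; apply: eq_bigr => i _; rewrite /c.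
  apply: eq_bigr => x /eqP xi; congr (f x (flip_env _ _)).
  have itE (m : nat) b' : iter m (move_site (-1)) b' = move_site (- m%:Z) b'.
    elim: m => [|m IH]; first by case: b' => ? [? ?]; rewrite /move_site /= addr0.
    by rewrite iterS IH /move_site /=; congr (_, (_, _)); lia.
  by rewrite itE /move_site /=; congr (_, (_, _)); rewrite xi; lia.
move=> h; apply: spells_ext (D_ext _ _ E) (spells_le _ h).
by rewrite /=; lia.
Qed.

Definition rotation_ext c c' : c =1 c' -> rotation c =1 rotation c'.
Proof. by move=> cc z; rewrite /rotation cc. Qed.

Lemma rotation0 : rotation (fun=> 0) =1 id.
Proof. by case=> b m; rewrite /rotation /= addr0. Qed.

Lemma rotationD c c' :
  rotation c' \o rotation c =1 rotation (fun b => c b + c' b).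
Proof. by case=> b m; rewrite /rotation /= addrA. Qed.

Lemma rotation_conj c m :
  basemap m \o rotation (c \o m) =1 rotation c \o basemap m.
Proof. by []. Qed.

Lemma reflection_ext P P' : P =1 P' -> reflection P =1 reflection P'.
Proof. by move=> cc z; rewrite /reflection cc. Qed.

Lemma reflection0 : reflection (fun=> false) =1 id.
Proof. by case. Qed.

Lemma reflectionD P P' :
  reflection P' \o reflection P =1 reflection (fun b => P b (+) P' b).
Proof.
by case=> b m; rewrite /reflection /=; case: (P b); case: (P' b);
  rewrite ?opprK.
Qed.

Lemma reflection_conj P m :
  basemap m \o reflection (P \o m) =1 reflection P \o basemap m.
Proof. by []. Qed.

Lemma spells_rotation_points f l :
  (forall x, x \in A -> spells (rotation (f x)) (l x)) ->
  spells (rotation (fun b => \sum_(x <- A) f x (translate x b)))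
    (\sum_(x <- A) (l x + 6 * n) + 2 * k + 2 * a).
Proof.
exact: (spells_family_points rotation_ext rotation0 rotationD rotation_conj).
Qed.

Lemma spells_reflection_points f l :
  (forall x, x \in A -> spells (reflection (f x)) (l x)) ->
  spells (reflection (fun b => \big[addb/false]_(x <- A) f x (translate x b)))
    (\sum_(x <- A) (l x + 6 * n) + 2 * k + 2 * a).
Proof.
exact: (spells_family_points reflection_ext reflection0 reflectionD
  reflection_conj).
Qed.

End Window.

Lemma spells_rotation_opp c m :
  spells (rotation c) m -> spells (rotation (fun b => - c b)) m.
Proof.
case=> w wc wm; exists (winv w); last by rewrite size_winv.
move=> z; rewrite -[RHS](wactK w) wc; congr (wact _ _).
by case: z => b j; rewrite /rotation /= subrK.
Qed.

Lemma spells_rotationM c m (a : int) : spells (rotation c) m ->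
  spells (rotation (fun b => a * c b)) (absz a * m).
Proof.
move=> cm.
have H (k : nat) : spells (rotation (fun b => k%:Z * c b)) (k * m).
  elim: k => [|k IH].
    apply: (spells_ext _ (spells_id q amp)) => -[b j].
    by rewrite /rotation /= mul0r addr0.
  have := spells_family_op rotationD cm IH.
  rewrite mulSn; apply: spells_ext; apply: rotation_ext => b.
  by rewrite -addn1 PoszD mulrDl mul1r addrC.
case: (lerP 0 a) => a0.
  by have := H (absz a); rewrite gez0_abs.
have := spells_rotation_opp (H (absz a)); apply: spells_ext.
by apply: rotation_ext => b; rewrite ltz0_abs// mulNr opprK.
Qed.

Lemma spells_amplifier a :
  spells (rotation (fun b => a * shifts amp Gf b)) (absz a).
Proof.
rewrite -[absz a]muln1; apply: spells_rotationM.
apply: (@spells_letter _ _ (Gf, true)) => -[[[p j] [c e]] k].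
by rewrite /= /lmove /= mul1r.
Qed.

Lemma spells_reflects g : g = Ga \/ g = Gb -> spells (reflection (reflects g)) 1.
Proof.
move=> gab; apply: (@spells_letter _ _ (g, true)) => -[[[p j] [c e]] k].
by case: gab => ->; rewrite /= /lmove /= addr0.
Qed.

(** On [P] the reflection conjugates the rotation into its inverse, so the commutator doubles it;
    outside [P] the two rotations cancel. *)
Lemma spells_commutator c P m m' :
  spells (rotation c) m -> spells (reflection P) m' ->
  spells (rotation (fun b => if P b then 2 * c b else 0)) (2 * m + 2 * m').
Proof.
move=> cm Pm; have cm' := spells_rotation_opp cm.
have := spells_comp (spells_comp cm Pm) (spells_comp cm' Pm).
move=> h; apply: spells_ext (spells_le _ h); last by lia.
case=> b k; rewrite /rotation /reflection /=; congr (_, _).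
by case: (P b); lia.
Qed.

Lemma bigxor_mem (K : eqType) (r : seq K) y (a : bool) : uniq r ->
  \big[addb/false]_(x <- r) (a && (y == x)) = a && (y \in r).
Proof.
elim: r => [|x r IH] /=; first by rewrite big_nil andbF.
move=> /andP[xr ur]; rewrite big_cons IH// inE; case: a {IH} => //=.
by case: (eqVneq y x) => //= ->; rewrite (negbTE xr).
Qed.

Lemma big_at (K : eqType) (r : seq K) y (F : K -> int) : uniq r ->
  \sum_(x <- r) (if y == x then F x else 0) = if y \in r then F y else 0.
Proof.
move=> ur; case: ifPn => yr.
  rewrite (bigD1_seq y)//= eqxx big1 ?addr0// => x xy.
  by rewrite eq_sym (negbTE xy).
rewrite big_seq big1// => x xr; case: eqP => // yx.
by rewrite yx xr in yr.
Qed.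

Section Levels.
Variables (a k n : nat) (A : seq epoint).
Hypothesis uA : uniq A.
Hypothesis A_in : forall x, x \in A ->
  - a%:Z <= x.1 < k%:Z - a%:Z /\ (forall i, x.2 i -> 0 <= i < n%:Z).

Definition tour_cost (l : epoint -> nat) : nat :=
  (\sum_(x <- A) (l x + 6 * n) + 2 * k + 2 * a)%N.

Lemma spells_reflect_all_scales :
  spells (reflection (fun b => [&& is_pow2 b.1.1, b.1.2 == 0 & b.2 \in A]))
    (tour_cost (fun=> 1%N)).
Proof.
have := spells_reflection_points A_in
  (fun x (_ : x \in A) => spells_reflects (or_intror erefl)).
apply: spells_ext; apply: reflection_ext => -[[p j] y].
rewrite [RHS]andbA -bigxor_mem//; apply: eq_bigr => x _.
by rewrite reflectsGb translateE translate_origin andbA.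
Qed.

Lemma spells_reflect_scale s :
  spells (reflection (fun b => [&& b.1.1 == pow2 s, b.1.2 == 0 & b.2 \in A]))
    (tour_cost (fun=> 1%N) + 2 * 2 ^ s).
Proof.
have := spells_reflection_points A_in
  (fun x (_ : x \in A) => spells_reflects (or_introl erefl)).
move=> h; have := spells_reflection_conj (spells_scale q amp (- pow2 s)) h.
rewrite abszN absz_nat; apply: spells_ext; apply: reflection_ext => -[[p j] y].
rewrite [RHS]/= -subr_eq0 [RHS]andbA -bigxor_mem//; apply: eq_bigr => x _.
by rewrite reflectsGa translateE translate_origin andbA.
Qed.

Hypotheses (amp0 : amp 0 = 1%N) (amp_gt0 : forall i, (0 < amp i)%N)
  (amp_double : forall i, (amp i.+1 <= 2 * amp i)%N).

(** Greedy expansion in the mixed base [amp]. As [amp] at most doubles, a remainder below [amp h.+1]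
    leaves a digit at most 1 at place [h], and only the top digit can be large. *)
Lemma amp_digits_nat (c i : nat) : exists kappa : nat -> nat,
  [/\ c = (\sum_(h < i.+1) amp h * kappa h)%N,
      kappa i = (c %/ amp i)%N & forall h, (h < i)%N -> (kappa h <= 1)%N].
Proof.
elim: i c => [|i IH] c.
  exists (fun=> c); split=> //; first by rewrite big_ord1 amp0 mul1n.
  by rewrite amp0 divn1.
have [kappa [rE ki k1]] := IH (c %% amp i.+1)%N.
exists (fun h => if h == i.+1 then c %/ amp i.+1 else kappa h)%N; split=> //.
- rewrite big_ord_recr /= eqxx {1}(divn_eq c (amp i.+1)) addnC rE mulnC.
  congr (_ + _)%N; apply: eq_bigr => h _; case: eqP => // hi.
  by have := ltn_ord h; lia.
- by rewrite eqxx.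
move=> h hi; case: eqP => [|_]; first lia.
have [hi'|hi'] := ltnP h i; first exact: k1.
have -> : h = i by lia.
rewrite ki -ltnS ltn_divLR//; apply: leq_trans (amp_double i).
exact: ltn_pmod.
Qed.

Lemma amp_digits (c : int) (i : nat) : exists kappa : nat -> int,
  c = \sum_(h < i.+1) (amp h)%:Z * kappa h /\
  forall h, (h <= i)%N -> (absz (kappa h) <= 1 + absz c %/ amp i)%N.
Proof.
have [kappa [cE ki k1]] := amp_digits_nat (absz c) i.
exists (fun h => sgz c * (kappa h)%:Z); split.
  rewrite {1}[c]intEsg {1}cE (big_morph Posz PoszD erefl) mulr_sumr.
  by apply: eq_bigr => h _; rewrite PoszM mulrCA.
move=> h hi; rewrite abszM absz_nat.
have sg1 : (absz (sgz c) <= 1)%N by rewrite /sgz; case: ifP => //; case: ifP.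
apply: (@leq_trans (kappa h)); first by rewrite -[leqRHS]mul1n leq_mul.
have [hi'|hi'] := ltnP h i; first by rewrite (leq_trans (k1 _ hi'))// leq_addr.
by have -> : h = i by [lia]; rewrite ki leq_addl.
Qed.

Variables (sc : int -> bool) (r : nat).
Hypotheses (sc_pow2 : forall p, sc p -> is_pow2 p)
  (sc_reflection : spells (reflection
     (fun b => [&& sc b.1.1, b.1.2 == 0 & b.2 \in A])) r).

(** Brought from level [2 ^ i] to level 0, [Gf] still acts on further levels and on all scales. The
    commutator with a reflection confined to level 0 and to the scales [sc] retains the wanted part
    alone. *)
Lemma spells_level_rotation (kappa : epoint -> int) i :
  spells (rotation (fun b => if [&& sc b.1.1, b.1.2 == 0 & b.2 \in A]
    then 2 * ((amp i)%:Z * kappa b.2) else 0))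
   (2 * (tour_cost (fun x => absz (kappa x)) + 2 * 2 ^ i) + 2 * r).
Proof.
have := spells_rotation_points A_in
  (fun x (_ : x \in A) => spells_amplifier (kappa x)).
move=> h; have := spells_rotation_conj (spells_level q amp (pow2 i)) h.
rewrite absz_nat => {}h.
apply: spells_ext (spells_commutator h sc_reflection).
apply: rotation_ext => -[[p j] y] /=; case: ifP => // /and3P[scp /eqP-> yA].
congr (2 * _).
transitivity (\sum_(x <- A) (if y == x then kappa x * (amp i)%:Z else 0)).
  apply: eq_bigr => x _; rewrite shiftsGf translateE translate_origin /=.
  rewrite (sc_pow2 scp) add0r is_pow2_pow2 log2_pow2 /=.
  by case: ifP => // _; rewrite mulr0.
by rewrite big_at// yA mulrC.
Qed.

Lemma spells_values (c : epoint -> int) i :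
  spells (rotation (fun b => if [&& sc b.1.1, b.1.2 == 0 & b.2 \in A]
    then 2 * c b.2 else 0))
   (i.+1 * (2 * (tour_cost (fun x => 1 + absz (c x) %/ amp i)%N + 2 * 2 ^ i)
            + 2 * r)).
Proof.
have [kappa kP] := choice (fun x => amp_digits (c x) i).
have := spells_family_seq rotation_ext rotation0 rotationD
  (r := iota 0 i.+1)
  (fun h (_ : h \in iota 0 i.+1) => spells_level_rotation (kappa^~ h) h).
move=> hs; apply: spells_ext (spells_le _ hs).
  apply: rotation_ext => b; rewrite -[iota 0 _]/(index_iota 0 i.+1) big_mkord.
  case: ifP => _; last by rewrite big1.
  by rewrite -mulr_sumr -(kP b.2).1.
rewrite -[iota 0 _]/(index_iota 0 i.+1) big_mkord.
rewrite -[X in (_ <= X * _)%N]card_ord -sum_nat_const; apply: leq_sum => h _.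
have hi : (h <= i)%N by rewrite -ltnS.
rewrite leq_add2r leq_mul2l leq_add ?leq_mul2l ?leq_exp2l//.
rewrite !leq_add2r; apply: leq_sum => x _.
by rewrite leq_add2r; apply: (kP x).2.
Qed.

End Levels.

Lemma sum_nat_seq_cst (T : Type) (s : seq T) (c : nat) :
  (\sum_(x <- s) c = size s * c)%N.
Proof. by rewrite big_const_seq count_predT iter_addn_0 mulnC. Qed.

Lemma tour_cost1 a k n A :
  tour_cost a k n A (fun=> 1%N) = (size A * (1 + 6 * n) + 2 * k + 2 * a)%N.
Proof. by rewrite /tour_cost sum_nat_seq_cst. Qed.

Lemma tour_costD a k n A (v : epoint -> nat) :
  tour_cost a k n A (fun x => 1 + v x)%N =
  (size A * (1 + 6 * n) + \sum_(x <- A) v x + 2 * k + 2 * a)%N.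
Proof.
rewrite /tour_cost -sum_nat_seq_cst -big_split /=; congr (_ + _ + _)%N.
by apply: eq_bigr => x _; rewrite addnAC.
Qed.

End LampConfigurations.

(** * Short words for the elements reached by the walk *)

Section ShortWords.
Variables (q amp : nat -> nat).
Local Notation spells := (spells q amp).
Implicit Types (b : bpoint) (x : epoint) (u : seq bstep) (w : seq step_type).
#[local] Arguments shifts : simpl never.

(** The effect of flipping the switches at all displacements [d] from the cursor with [f d], on all
    scales together: the bit of index [i] of a lamp of scale [p] lies at displacement
    [i + p - c]. *)
Definition config (f : int -> bool) b : bpoint :=
  (b.1, (b.2.1, fun i => b.2.2 i (+)
     [&& 0 <= i, i < (q (log2 b.1.1))%:Z & f (i + b.1.1 - b.2.1)])).

Lemma spells_config0 (f : int -> bool) (n : nat) :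
  (forall i, f i -> 0 <= i < n%:Z) -> spells (basemap (config f)) (3 * n).
Proof.
elim: n f => [|n IH] f hf.
  rewrite muln0; apply: (spells_ext _ (spells_id q amp)) => -[[x [c e']] k].
  rewrite /basemap /config /=; congr (_, (_, _), _); apply/funext => i.
  have -> : f (i + x.1 - c) = false by apply/negbTE/negP => /hf; lia.
  by rewrite !andbF addbF.
have hf' i : f (i + 1) && (i != -1) -> 0 <= i < n%:Z.
  by move=> /andP[/hf + i1]; lia.
have head : spells (basemap (config (fun i => f 0 && (i == 0)))) 1.
  case: (f 0); last first.
    apply: spells_le (leq0n 1) _; apply: (spells_ext _ (spells_id q amp)).
    move=> -[[x [c e']] k]; congr (_, (_, _), _); apply/funext => i.
    by rewrite /= !andbF addbF.
  apply: (@spells_letter _ _ (Gx, true)) => -[[[p j] [c e']] k].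
  rewrite /= /lmove /= mulr0 addr0; congr (_, (_, _), _); apply/funext => i.
  rewrite /tog /=; congr (_ (+) _).
  have -> : (i == c - p) = (i + p - c == 0) by lia.
  by case: (i + p - c == 0); rewrite /= ?andbT ?andbF.
have tail := spells_conj (spells_site q amp 1) (IH _ hf').
apply: (@spells_le _ _ _ (1 + (3 * n + 2 * absz 1))); first by rewrite /=; lia.
apply: spells_ext (spells_comp head (tail (basemap (config
    (fun i => f i && (i != 0)))) _)).
  move=> -[[x [c e']] k]; rewrite /basemap /config /=.
  congr (_, (_, _), _); apply/funext => i; rewrite -addbA; congr (_ (+) _).
  case: (0 <= i) => //=; case: (_ < _) => //=.
  by case: (eqVneq (i + x.1 - c) 0) => [->|_];
    rewrite ?andbT ?andbF ?addbF.
move=> -[[x [c e']] k]; rewrite /basemap /config /move_site /=.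
congr (_, (_, _), _); apply/funext => i.
have -> : i + x.1 - (c + 1) + 1 = i + x.1 - c by lia.
by have -> : (i + x.1 - (c + 1) != -1) = (i + x.1 - c != 0) by lia.
Qed.

Lemma spells_config (f : int -> bool) (a n : nat) :
  (forall i, f i -> - a%:Z <= i < n%:Z - a%:Z) ->
  spells (basemap (config f)) (3 * n + 2 * a).
Proof.
move=> hf; have hf' i : f (i - a%:Z) -> 0 <= i < n%:Z by move=> /hf; lia.
have h := spells_conj (spells_site q amp (- a%:Z)) (spells_config0 hf').
have := h (basemap (config f)); rewrite abszN absz_nat; apply.
move=> -[[x [c e']] k]; rewrite /basemap /config /move_site /=.
congr (_, (_, _), _); apply/funext => i.
by have -> : i + x.1 - (c - a%:Z) - a%:Z = i + x.1 - c by lia.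
Qed.

Fixpoint walk_config u (d : int) : bool :=
  if u is a :: u' then
    (a.2.1 && (d == 0)) (+) (a.2.2 && (d == sgi a.1)) (+)
    walk_config u' (d - sgi a.1)
  else false.

Lemma walk_config_range u d : walk_config u d ->
  - mn (unzip1 u) <= d <= mx (unzip1 u).
Proof.
elim: u d => [//|a u IH] d /=.
have := mx_ge0 (unzip1 u); have := mn_ge0 (unzip1 u).
have [h|_] := boolP (walk_config u (d - sgi a.1)).
  by move: (IH _ h) => + m0 m1 _; case: (a.1) => /=; lia.
rewrite addbF; case: (eqVneq d 0) => [->|d0]; first by lia.
case: (eqVneq d (sgi a.1)) => [->|d1]; last by rewrite !andbF.
by case: (a.1) => /=; lia.
Qed.

(** Flips commute, so the walk amounts to one configuration of switches, the same for every scale,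
    followed by the translation by its final displacement. *)
Lemma efinE P n x u : efin P n x u = (x.1 + psum (unzip1 u),
  fun i => x.2 i (+) [&& 0 <= i, i < n%:Z & walk_config u (i + P - x.1)]).
Proof.
elim: u x => [|a u IH] [c e].
  rewrite /= /psum big_nil addr0; congr (_, _); apply/funext => i.
  by rewrite !andbF addbF.
rewrite efin_cons IH /= psum_cons addrA; congr (_, _); apply/funext => i.
rewrite /tog -!addbA; congr (_ (+) _).
case: (0 <= i) => /=; last by rewrite !andbF.
case: (i < _) => /=; last by rewrite !andbF.
rewrite !andbT; congr (_ (+) (_ (+) _)).
- by congr (_ && _); lia.
- by congr (_ && _); lia.
- by congr (walk_config _ _); lia.
Qed.

Definition osc (es : seq bool) : nat := absz (mx es + mn es).

Lemma oscE es : (osc es)%:Z = mx es + mn es.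
Proof. by have := mx_ge0 es; have := mn_ge0 es; rewrite /osc; lia. Qed.

Lemma psum_range es : - mn es <= psum es <= mx es.
Proof.
elim: es => [|e es IH]; first by rewrite /psum big_nil.
by rewrite psum_cons /=; case: e => /=; lia.
Qed.

Lemma spells_walk_base u : spells
  (basemap (fun b => (b.1, efin b.1.1 (q (log2 b.1.1)) b.2 u)))
  (6 * osc (unzip1 u) + 3).
Proof.
have hf i : walk_config u i -> - (absz (mn (unzip1 u)))%:Z <= i <
    (osc (unzip1 u)).+1%:Z - (absz (mn (unzip1 u)))%:Z.
  move=> /walk_config_range; have := oscE (unzip1 u).
  by have := mx_ge0 (unzip1 u); have := mn_ge0 (unzip1 u); lia.
have := spells_comp (spells_config hf) (spells_site q amp (psum (unzip1 u))).
move=> h; apply: spells_ext (spells_le _ h).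
  by move=> -[[[p j] [c e]] k]; rewrite /basemap /= efinE.
have := psum_range (unzip1 u); have := oscE (unzip1 u).
by have := mx_ge0 (unzip1 u); have := mn_ge0 (unzip1 u); lia.
Qed.

(** Within a range smaller than [P] no switch of a visited lamp is reached. The parameters [1] and
    [0] stand for a scale without switches, so all scales beyond the range show this one pattern. *)
Lemma addrs_closed (P : int) n u : mx (unzip1 u) + mn (unzip1 u) < P ->
  addrs P n u = addrs 1 0 u.
Proof.
have tog0 c (bit : bool) e : tog 1 0 c bit e = e.
  apply/funext => i; rewrite /tog; case: (ltrP i 0) => i0; rewrite ?andbF ?addbF//.
elim: u => [//|a u IH] /= oP.
have := mx_ge0 (unzip1 u); have := mn_ge0 (unzip1 u) => m0 m1.
have E y : y.1 < P -> y.1 - sgi a.1 < P -> einv P n a y = einv 1 0 a y.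
  by move=> yP yP'; rewrite /einv /= !tog0 !tog_low//; lia.
have sP : 0 - sgi a.1 < P by move: oP; case: (a.1) => /=; lia.
rewrite E//=; last by lia.
congr [:: _, _ & _]; rewrite IH; last by move: oP; case: (a.1) => /=; lia.
apply/eq_in_map => y /mem_addrs[/sites_range + _] => yr.
by apply: E; move: oP yr; case: (a.1) => /=; lia.
Qed.

Definition scale_value s w x : int :=
  ssum (addrs (pow2 s) (q s) (unzip1 w)) (flatp (unzip2 w)) x.

Definition closed_value w x : int :=
  ssum (addrs 1 0 (unzip1 w)) (flatp (unzip2 w)) x.

Definition scale_addrs s w := undup (addrs (pow2 s) (q s) (unzip1 w)).
Definition closed_addrs w := undup (addrs 1 0 (unzip1 w)).

(** The price of writing one pattern: [i] is the top level, [o] the range of the walk, [n] the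
    number of switches of a lamp, [l] the number of lamps, [v] the sum of the leading digits. *)
Definition cost (i o n : nat) (l v : nat) : nat :=
  (i.+1 * (4 * (l * (1 + 6 * n)) + 2 * v + 20 * o + 8 + 4 * 2 ^ i))%N.

Hypotheses (amp0 : amp 0 = 1%N) (amp_gt0 : forall i, (0 < amp i)%N)
  (amp_double : forall i, (amp i.+1 <= 2 * amp i)%N).

(** The conjugates of [Gb] reflect at every scale, so one word writes the switchless pattern on all
    scales together. *)
Lemma spells_closed w i : spells
  (rotation (fun b => if is_pow2 b.1.1 && (b.1.2 == 0)
                      then 2 * closed_value w b.2 else 0))
  (cost i (osc (unzip1 (unzip1 w))) 0 (size (closed_addrs w))
     (\sum_(x <- closed_addrs w) absz (closed_value w x) %/ amp i)).
Proof.
set es := unzip1 (unzip1 w).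
have A_in x : x \in closed_addrs w ->
    - (absz (mx es))%:Z <= x.1 < (osc es).+1%:Z - (absz (mx es))%:Z /\
    (forall j, x.2 j -> 0 <= j < 0%:Z).
  rewrite mem_undup => /mem_addrs[/sites_range xr xe]; split; last exact: xe.
  by have := oscE es; have := mx_ge0 es; have := mn_ge0 es;
    move: xr; rewrite -/es; lia.
have h := @spells_values q amp _ _ _ _ (undup_uniq _) A_in amp0 amp_gt0
  amp_double is_pow2 _ (fun p => id) (spells_reflect_all_scales q amp (undup_uniq _) A_in)
  (closed_value w) i.
apply: spells_ext (spells_le _ h).
  apply: rotation_ext => -[[p j] x] /=; rewrite andbA.
  case: (is_pow2 p && (j == 0)) => //=; case: ifPn => // xA.
  have xA' : x \notin addrs 1 0 (unzip1 w) by rewrite -mem_undup.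
  by rewrite /closed_value ssum_notin// mulr0.
rewrite /cost leq_mul2l /= tour_cost1 tour_costD -/(closed_addrs w).
have := oscE es; have := mx_ge0 es; have := mn_ge0 es.
set V := (\sum_(_ <- _) _)%N.
move: (2 ^ i)%N (size _) V (mx es) (mn es) (osc es) => X Y V' m m' o.
lia.
Qed.

(** Beyond the range the two patterns agree and the empty word will do. Otherwise [2 ^ s] is at most
    the range, which pays for bringing [Ga] to scale [s]. *)
Lemma spells_scale_correction w i s : spells
  (rotation (fun b => if (b.1.1 == pow2 s) && (b.1.2 == 0)
     then 2 * (scale_value s w b.2 - closed_value w b.2) else 0))
  (cost i (osc (unzip1 (unzip1 w))) (q s)
     (size (scale_addrs s w) + size (closed_addrs w))
     (\sum_(x <- undup (scale_addrs s w ++ closed_addrs w))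
        absz (scale_value s w x - closed_value w x) %/ amp i)).
Proof.
set es := unzip1 (unzip1 w).
have [es_s|s_es] := ltP (mx es + mn es) (pow2 s).
  apply: spells_le (leq0n _) _; apply: (spells_ext _ (spells_id q amp)) => z.
  rewrite -[LHS]rotation0; apply: rotation_ext => b.
  rewrite /scale_value /closed_value addrs_closed// subrr mulr0 if_same//.
set A := undup (_ ++ _).
have A_in x : x \in A ->
    - (absz (mx es))%:Z <= x.1 < (osc es).+1%:Z - (absz (mx es))%:Z /\
    (forall j, x.2 j -> 0 <= j < (q s)%:Z).
  rewrite mem_undup mem_cat !mem_undup => /orP[] /mem_addrs[/sites_range xr xe].
    split; last exact: xe.
    by have := oscE es; have := mx_ge0 es; have := mn_ge0 es;
      move: xr; rewrite -/es; lia.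
  split; last by move=> j /xe; lia.
  by have := oscE es; have := mx_ge0 es; have := mn_ge0 es;
    move: xr; rewrite -/es; lia.
have h := @spells_values q amp _ _ _ _ (undup_uniq _) A_in amp0 amp_gt0
  amp_double (fun p => p == pow2 s) _
  (fun p ps => eq_ind_r is_pow2 (is_pow2_pow2 s) (eqP ps))
  (spells_reflect_scale q amp (undup_uniq _) A_in s)
  (fun x => scale_value s w x - closed_value w x) i.
apply: spells_ext (spells_le _ h).
  apply: rotation_ext => -[[p j] x] /=; rewrite andbA.
  case: (_ && (j == 0)) => //=; case: ifPn => // xA.
  have xA' : x \notin A by [].
  rewrite mem_undup mem_cat !mem_undup negb_or in xA'.
  case/andP: xA' => x1 x2.
  by rewrite /closed_value /scale_value !ssum_notin// subrr mulr0.
rewrite /cost leq_mul2l /= tour_cost1 tour_costD -/A.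
have sA : (size A <= size (scale_addrs s w) + size (closed_addrs w))%N.
  by rewrite -size_cat size_undup.
have s2 : (2 ^ s <= osc es)%N.
  by move: s_es; rewrite -oscE /pow2 lez_nat.
set V := (\sum_(x <- A) _)%N.
have sAq := leq_mul sA (leqnn (1 + 6 * q s)).
apply: (@leq_trans (4 * (size A * (1 + 6 * q s)) + 2 * V + 20 * osc es + 8 +
  4 * 2 ^ i)); last by rewrite !leq_add2r leq_mul2l sAq.
have := oscE es; have := mx_ge0 es; have := mn_ge0 es.
move: s2; move: (size A * (1 + 6 * q s))%N (2 ^ i)%N (2 ^ s)%N V => Z X X' V'.
by move: (mx es) (mn es) (osc es) => m m' o; lia.
Qed.

Definition word_bound w i (S : nat) : nat :=
  (6 * osc (unzip1 (unzip1 w)) + 3 +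
   cost i (osc (unzip1 (unzip1 w))) 0 (size (closed_addrs w))
     (\sum_(x <- closed_addrs w) absz (closed_value w x) %/ amp i) +
   \sum_(s < S) cost i (osc (unzip1 (unzip1 w))) (q s)
     (size (scale_addrs s w) + size (closed_addrs w))
     (\sum_(x <- undup (scale_addrs s w ++ closed_addrs w))
        absz (scale_value s w x - closed_value w x) %/ amp i))%N.

Lemma spells_walk w i (S : nat) : (osc (unzip1 (unzip1 w)) < 2 ^ S)%N ->
  spells (wact (walk_word q amp w)) (word_bound w i S).
Proof.
move=> oS.
have corr := spells_family_seq rotation_ext rotation0 rotationD
  (r := iota 0 S)
  (fun s (_ : s \in iota 0 S) => spells_scale_correction w i s).
have rot := spells_family_op rotationD (spells_closed w i) corr.
have := spells_comp rot (spells_walk_base (unzip1 w)).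
have -> : iota 0 S = index_iota 0 S by rewrite /index_iota subn0.
move=> h; apply: spells_ext (spells_le _ h).
  move=> -[[[p j] x] k]; rewrite [RHS]wact_walk_word /= /basemap /rotation /=.
  congr (_, _ + _); rewrite /scale_rot; case: (eqVneq j 0) => [_|_]; last first.
    rewrite !andbF big1 ?addr0// => s _; by rewrite andbF.
  rewrite !andbT; case pp : (is_pow2 p); last first.
    rewrite big1 ?addr0// => s _; case: eqP => //= ps.
    by rewrite ps is_pow2_pow2 in pp.
  pose s0 := log2 p; have ps0 : p = pow2 s0 by apply/eqP.
  (* A scale below [S] is concerned by exactly one correction; from [S] on the range is exceeded and
     the switchless pattern is already right. *)
  rewrite -/s0; have [s0S|Ss0] := ltnP s0 S.
    rewrite big_mkord (bigD1 (Ordinal s0S))//= ps0 eqxx big1 ?addr0 => [|s ss0].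
      by rewrite -mulrDr addrC subrK.
    case: eqP => //= /(congr1 log2); rewrite !log2_pow2 => s0s.
    by move: ss0; rewrite -val_eqE /= s0s eqxx.
  rewrite big_mkord big1 ?addr0 => [|s _].
    rewrite /closed_value ps0 addrs_closed// -oscE ltz_nat.
    by apply: leq_trans oS _; rewrite leq_exp2l.
  case: eqP => //= /(congr1 log2); rewrite -/s0 log2_pow2 => s0s.
  by have := ltn_ord s; rewrite -s0s ltnNge Ss0.
by rewrite /word_bound big_mkord; lia.
Qed.

End ShortWords.

(** * Words are long *)

Section LongWords.
Variables (q amp : nat -> nat).
Local Notation M := (lamp_moves q amp).
Implicit Types (b : bpoint) (v : seq (letter M)).

Fixpoint total_shift v b : nat :=
  if v is l :: v' then
    (absz (shifts amp l.1 b) + total_shift v' (bmove q l.1 l.2 b))%N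
  else 0%N.

(** Reflections preserve the absolute value, so it grows only by the shifts met along the trajectory
    of [b]. *)
Lemma rotation_le_shift v b (k : int) :
  (absz (wact v (b, k)).2 <= absz k + total_shift v b)%N.
Proof.
elim: v b k => [|l v IH] b k /=; first by rewrite addn0.
apply: leq_trans (IH _ _) _; rewrite addnA leq_add2r.
apply: leq_trans (leq_add (leqnn _) (leqnn _)).
have -> : absz (shifts amp l.1 b) = absz (sgi l.2 * shifts amp l.1 b).
  by rewrite abszM; case: (l.2); rewrite mul1n.
by case: ifP => _ /=; move: (sgi _ * _) => z; lia.
Qed.

Lemma sum_uniq_le (K : eqType) (f : K -> nat) (r C : seq K) :
  uniq r -> uniq C -> (forall x, x \in r -> f x != 0%N -> x \in C) ->
  (\sum_(x <- r) f x <= \sum_(x <- C) f x)%N.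
Proof.
move=> ur uC rC.
have -> : (\sum_(x <- r) f x = \sum_(x <- [seq x <- r | x \in C]) f x)%N.
  rewrite big_filter [RHS]big_mkcond /= big_seq [RHS]big_seq.
  apply: eq_bigr => x xr; case: ifPn => // xC.
  by apply/eqP; apply: contraNT xC; exact: rC.
have -> : (\sum_(x <- [seq x <- r | x \in C]) f x =
    \sum_(x <- [seq x <- C | x \in r]) f x)%N.
  apply: perm_big; apply: uniq_perm; rewrite ?filter_uniq// => x.
  by rewrite !mem_filter andbC.
by rewrite big_filter big_mkcond; apply: leq_sum => x _; case: ifP.
Qed.

Lemma log2_le (p : int) (t : nat) : p <= t%:Z -> is_pow2 p ->
  (log2 p <= trunc_log 2 t)%N.
Proof.
by move=> pt p2; apply: leq_trunc_log; have := is_pow2_gt0 p2; lia.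
Qed.

(** Bounds what one letter adds in total over the points of scale up to [t1] and level up to [t2]: a
    turn by 2 or by the values of [amp], at one point per active scale and level. *)
Definition shift_bound (t1 t2 : nat) : nat :=
  ((trunc_log 2 t1).+1 * (2 + \sum_(i < (trunc_log 2 t2).+1) amp i))%N.

Lemma shiftsGy b : shifts amp Gy b =
  if [&& is_pow2 b.1.1, b.1.2 == 0 & b.2 == origin] then 2 else 0.
Proof. by case: b => -[]. Qed.

Lemma sum_shifts_le (t1 t2 : nat) (r : seq bpoint) g : uniq r ->
  (forall b, b \in r -> b.1.1 <= t1%:Z /\ b.1.2 <= t2%:Z) ->
  (\sum_(b <- r) absz (shifts amp g b) <= shift_bound t1 t2)%N.
Proof.
move=> ur rt.
have zero : g <> Gy -> g <> Gf -> (\sum_(b <- r) absz (shifts amp g b) = 0)%N.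
  by move=> gy gf; apply: big1 => -[[p j] x] _; case: (g) gy gf.
case gE : g => //; try by (rewrite -gE zero// gE).
- apply: leq_trans (sum_uniq_le (C := [seq ((pow2 s, 0 : int), origin)
      | s <- iota 0 (trunc_log 2 t1).+1]) ur _ _) _.
  + rewrite map_inj_uniq ?iota_uniq//.
    by apply: (can_inj (g := fun b : bpoint => log2 b.1.1)) => s; exact: log2_pow2.
  + move=> [[p j] x] /rt[pt _]; rewrite shiftsGy.
    case: ifP => // /and3P[p2 /eqP j0 /eqP x0] _.
    rewrite /= in p2 j0 x0 pt; rewrite j0 x0.
    apply/mapP; exists (log2 p); last by rewrite -(eqP p2).
    by rewrite mem_iota leq0n add0n ltnS log2_le.
  rewrite big_map /shift_bound mulnDr; apply: leq_trans (leq_addr _ _).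
  rewrite -[X in (_ <= X * _)%N](size_iota 0) -sum_nat_seq_cst.
  by apply: leq_sum => s _ /=; case: ifP.
apply: leq_trans (sum_uniq_le (C := [seq ((pow2 s, pow2 i), origin)
   | s <- iota 0 (trunc_log 2 t1).+1, i <- iota 0 (trunc_log 2 t2).+1]) ur _ _) _.
- rewrite allpairs_uniq ?iota_uniq// => -[s i] [s' i'] _ _ /= h.
  by have := congr1 (fun b : bpoint => (log2 b.1.1, log2 b.1.2)) h;
    rewrite /= !log2_pow2.
- move=> [[p j] x] /rt[pt jt]; rewrite shiftsGf.
  case: ifP => // /and3P[p2 j2 /eqP x0] _.
  rewrite /= in p2 j2 x0 pt jt; rewrite x0.
  apply/allpairsP; exists (log2 p, log2 j); split.
  + by rewrite mem_iota leq0n add0n ltnS log2_le.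
  + by rewrite mem_iota leq0n add0n ltnS log2_le.
  + by congr (_, _, _); apply/eqP.
rewrite big_allpairs_dep /shift_bound mulnDr; apply: leq_trans (leq_addl _ _).
rewrite -[X in (_ <= X * _)%N](size_iota 0) -sum_nat_seq_cst.
apply: leq_sum => s _; rewrite -[iota 0 _]/(index_iota 0 _.+1) big_mkord.
apply: leq_sum => i _ /=; rewrite !is_pow2_pow2 log2_pow2 eqxx absz_nat.
by [].
Qed.

Lemma bmove_inj g s : injective (bmove q g s).
Proof. exact: can_inj (bmoveK q g s). Qed.

Lemma bmove_scale g s b : (bmove q g s b).1.1 <= b.1.1 + 1.
Proof.
by case: b => [[p j] [c e]]; case: g => /=; rewrite ?lerDl//; case: s => /=; lia.
Qed.

Lemma bmove_level g s b : (bmove q g s b).1.2 <= b.1.2 + 1.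
Proof.
by case: b => [[p j] [c e]]; case: g => /=; rewrite ?lerDl//; case: s => /=; lia.
Qed.

(** Letters permute points, so distinct trajectories stay distinct and each letter of [v] is charged
    once for the whole of [r]. The margin [size v] in the hypothesis is how far [v] can raise a
    coordinate. *)
Lemma sum_total_shift_le (t1 t2 : nat) v (r : seq bpoint) : uniq r ->
  (forall b, b \in r -> b.1.1 + (size v)%:Z <= t1%:Z /\
                        b.1.2 + (size v)%:Z <= t2%:Z) ->
  (\sum_(b <- r) total_shift v b <= size v * shift_bound t1 t2)%N.
Proof.
elim: v r => [|l v IH] r ur rt; first by rewrite big1.
rewrite [X in (X <= _)%N]big_split /= mulSn leq_add//.
  apply: sum_shifts_le => // b /rt /=; lia.
have := IH (map (bmove q l.1 l.2) r); rewrite big_map; apply.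
  by rewrite map_inj_uniq//; exact: bmove_inj.
move=> _ /mapP[b /rt /= [b1 b2] ->].
have h1 := bmove_scale l.1 l.2 b; have h2 := bmove_level l.1 l.2 b.
by split; [apply: le_trans (lerD h1 (lexx _)) _|
           apply: le_trans (lerD h2 (lexx _)) _]; lia.
Qed.

Lemma rotation_amount_le s v (w : seq step_type) :
  @wact M v =1 wact (walk_word q amp w) ->
  (\sum_(x <- scale_addrs q s w) 2 * absz (scale_value q s w x) <=
   size v * shift_bound (2 ^ s + size v) (size v))%N.
Proof.
move=> vw.
have := @sum_total_shift_le (2 ^ s + size v) (size v) v
  [seq ((pow2 s, 0 : int), x) | x <- scale_addrs q s w].
rewrite map_inj_uniq ?undup_uniq; last by move=> x y [].
move=> /(_ isT) h; apply: leq_trans (h _); last first.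
  by move=> _ /mapP[x _ ->] /=; rewrite /pow2; lia.
rewrite big_map; apply: leq_sum => x _.
have := rotation_le_shift v ((pow2 s, 0), x) 0.
rewrite absz0 add0n; apply: leq_trans.
rewrite vw wact_walk_word /= add0r /scale_rot is_pow2_pow2 eqxx log2_pow2 /=.
by rewrite abszM.
Qed.

End LongWords.

(** * The random walk *)

Section WalkEstimates.
Variables (R : realType) (q amp : nat -> nat).
Implicit Types (w : seq step_type) (u : seq bstep).

Local Notation M := (lamp_moves q amp).

Definition group_step (a : step_type) : generated M := of_word (step_word q amp a).

Definition lamp_law : generated M -> R := step_law R group_step.

Lemma card_steps : (0 < #|{: step_type}|)%N.
Proof. by rewrite !card_prod !card_bool. Qed.

Lemma card_signs : (0 < #|{: bool * bool}|)%N.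
Proof. by rewrite !card_prod !card_bool. Qed.

Lemma walk_of_word w : walk group_step w = of_word (walk_word q amp w).
Proof. exact: of_word_flatten. Qed.

Lemma lamp_law_symmetric : symmetric_measure lamp_law.
Proof.
apply: (step_law_symmetric R step_inv_inj) => a; exact: of_step_word_inv.
Qed.

Lemma size_addrs P n u : size (addrs P n u) = (size u).*2.
Proof. by elim: u => //= a u IH; rewrite size_map IH. Qed.

Section OneScale.
Variables (P : int) (m : nat).
Hypothesis P0 : 0 < P.

(* bounds the expected number of returns to the origin *)
Definition green (n : nat) : R :=
  2 * (2 * (P + m%:Z)%:~R + 2^-1 ^+ m * Num.sqrt n.+1%:R).

Local Notation value w x :=
  (ssum (addrs P m (unzip1 w)) (flatp (unzip2 w)) x).

Definition lamp_sum w : R :=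
  \sum_(x <- undup (addrs P m (unzip1 w))) `|value w x|%:~R.

Lemma green_gt0 n : 0 < green n.
Proof.
have h1 : 0 <= 2^-1 ^+ m * Num.sqrt n.+1%:R :> R.
  by rewrite mulr_ge0 ?exprn_ge0 ?invr_ge0 ?sqrtr_ge0.
have h2 : 0 < (P + m%:Z)%:~R :> R by rewrite ltr0z; lia.
rewrite /green; lra.
Qed.

Lemma Ex_signs n (f : seq bstep -> seq bool -> R) :
  Ex n (fun w : seq step_type => f (unzip1 w) (flatp (unzip2 w))) =
  Ex n (fun u => Ex n.*2 (f u)).
Proof.
rewrite Ex_zip; apply: eq_Ex => u un; rewrite -Ex_flatp; apply: eq_Ex => v vn.
by rewrite unzip1_zip ?unzip2_zip// un vn.
Qed.

Lemma Ex_lamp_sumE n :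
  Ex n lamp_sum = Ex n (fun u => Ex n.*2 (absum R (addrs P m u))).
Proof. exact: (Ex_signs n (fun u => absum R (addrs P m u))). Qed.

(** The choice [M = G] with [G = green n] in the bound by coincidences: from [2 * n / G] at most
    [4 * n * G / (4 * G ^+ 2) = n / G] is lost. *)
Lemma Ex_naddr_ge n : (0 < n)%N ->
  n%:R / green n <= Ex n (fun u => (naddr P m u)%:R : R).
Proof.
move=> n0; have g0 := green_gt0 n.
apply: (@le_trans _ _ (Ex n (fun u : seq bstep => n.*2%:R / green n +
    (- (4 * green n ^+ 2)^-1) * (pairs (addrs P m u))%:R))).
  rewrite ExD Ex_cst ?card_bstep// ExZ mulNr.
  have := Ex_pairs_addrs R m P0 n; rewrite -/(green n) => h.
  have : (4 * green n ^+ 2)^-1 * Ex n (fun u => (pairs (addrs P m u))%:R) <=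
      n%:R / green n.
    have d0 : 0 < 4 * green n ^+ 2 by rewrite pmulr_rgt0// exprn_gt0.
    rewrite [leLHS]mulrC ler_pdivrMr//.
    apply: le_trans h _.
    rewrite le_eqVlt; apply/orP; left; apply/eqP; field; by rewrite gt_eqF.
  rewrite -muln2 natrM; lra.
apply: Ex_le => u un; have := size_undup_ge (addrs P m u) g0.
by rewrite size_addrs un mulNr [X in _ - X]mulrC.
Qed.

(** With [M = sqrt (3 * green n)] the fourth-moment term takes away at most half of the main term
    [2 * n / M]. *)
Lemma Ex_lamp_sum_ge n : (0 < n)%N ->
  n%:R / Num.sqrt (3 * green n) <= Ex n lamp_sum.
Proof.
move=> n0; have g0 := green_gt0 n.
have s0 : 0 < Num.sqrt (3 * green n) by rewrite sqrtr_gt0 pmulr_rgt0.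
set r := Num.sqrt _ in s0 *.
have r2 : green n = r ^+ 2 / 3.
  have g3 : 0 <= 3 * green n by rewrite pmulr_rge0// ltW.
  by rewrite (sqr_sqrtr g3); field.
rewrite Ex_lamp_sumE.
apply: (@le_trans _ _ (Ex n (fun u : seq bstep => n.*2%:R / r +
    (- (3 * (4 * r ^+ 3)^-1)) * (pairs (addrs P m u))%:R))).
  rewrite ExD Ex_cst ?card_bstep// ExZ mulNr.
  have := Ex_pairs_addrs R m P0 n; rewrite -/(green n) => h.
  have : 3 * (4 * r ^+ 3)^-1 * Ex n (fun u => (pairs (addrs P m u))%:R) <=
      n%:R / r.
    have c0 : 0 <= 3 * (4 * r ^+ 3)^-1.
      by rewrite mulr_ge0// invr_ge0 mulr_ge0// exprn_ge0// ltW.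
    apply: le_trans (ler_wpM2l c0 h) _; rewrite r2.
    rewrite le_eqVlt; apply/orP; left; apply/eqP; field; by rewrite gt_eqF.
  rewrite -muln2 natrM; lra.
apply: Ex_le => u un; have := Ex_absum_ge (addrs P m u) s0.
rewrite size_addrs un; apply: le_trans; rewrite mulNr lerD2l lerN2.
by rewrite mulrAC.
Qed.

Lemma Ex_lamp_sum2_le n :
  Ex n (fun w => lamp_sum w ^+ 2) <=
  2 * n%:R * Ex n (fun u => (naddr P m u)%:R).
Proof.
have -> := Ex_signs n (fun u es => absum R (addrs P m u) es ^+ 2).
rewrite -ExZ; apply: Ex_le => u un.
have := Ex_absum2 R (addrs P m u); rewrite size_addrs un => /le_trans; apply.
by rewrite mulrC -muln2 natrM mulrC [_ * 2]mulrC mulrC.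
Qed.

Lemma Ex_lamp_sum_le n (r : R) : 0 < r ->
  Ex n lamp_sum <= n%:R / r + Ex n (fun u => (naddr P m u)%:R) * r / 2.
Proof.
move=> r0; rewrite Ex_lamp_sumE.
apply: (@le_trans _ _ (Ex n (fun u : seq bstep => n%:R / r +
    (r / 2) * (naddr P m u)%:R))); last first.
  by rewrite ExD Ex_cst ?card_bstep// ExZ lerD2l [leLHS]mulrC mulrA.
apply: Ex_le => u un; have := Ex_absum_le (addrs P m u) r0.
rewrite size_addrs un => /le_trans; apply; apply: lerD.
  rewrite -muln2 natrM le_eqVlt; apply/orP; left; apply/eqP; field.
  by rewrite gt_eqF.
by rewrite /naddr -mulrA mulrC lexx.
Qed.

End OneScale.

Lemma lamp_sumE s w :
  lamp_sum (pow2 s) (q s) w = \sum_(x <- scale_addrs q s w) `|scale_value q s w x|%:~R.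
Proof. by []. Qed.

(** Given moves and switches, the signs are still independent, and the group element determines the
    sum of the signs at each distinct lamp of scale [s]. *)
Lemma entropy_lamp_ge s n : (0 < n)%N ->
  ln 2 * (n%:R / green (pow2 s) (q s) n) <= entropy lamp_law n.
Proof.
move=> n0; rewrite entropy_walk ?card_steps//.
apply: (@le_trans _ _ (ln 2 * Ex n (fun u => (naddr (pow2 s) (q s) u)%:R))).
  rewrite ler_wpM2l ?ln_ge0 ?ler1n//.
  by apply: Ex_naddr_ge => //; exact: pow2_gt0.
apply: entropy_ge_conditional => [||u g un]; rewrite ?card_bstep ?card_signs//.
(* At level 0 the walk turns by 2, so half the rotation is the sum of signs. *)
pose c (x : epoint) := ((gfun g (((pow2 s, 0), x), 0)).2 %/ 2)%Z.
have := Ex_ssum_all R (addrs (pow2 s) (q s) u) c.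
rewrite size_addrs un -Ex_flatp; apply: le_trans; apply: Ex_le => v vn.
rewrite walk_of_word; case: eqP => [wg|_]; last by rewrite ler0n.
suff -> : all (fun x => ssum (addrs (pow2 s) (q s) u)
    (flatp v) x == c x) (undup (addrs (pow2 s) (q s) u)) by [].
apply/allP => x _; rewrite /c -wg gfun_of_word wact_walk_word /= add0r /scale_rot.
by rewrite is_pow2_pow2 log2_pow2 eqxx /= unzip1_zip ?unzip2_zip ?un ?vn// mulKz.
Qed.

End WalkEstimates.

(** * Bounds on speed and entropy at a fixed time *)

Section SpeedEntropyBounds.
Variables (R : realType) (q amp : nat -> nat).
Implicit Types (w : seq step_type) (u : seq bstep).

Local Notation M := (lamp_moves q amp).

Definition log_scales (n : nat) : nat := (trunc_log 2 n).+1.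

Lemma osc_le_size es : (osc es <= size es)%N.
Proof.
rewrite -lez_nat oscE; elim: es => [//|e es IH] /=.
by have := mx_ge0 es; have := mn_ge0 es; case: e => /=; lia.
Qed.

Lemma osc_lt_scales n w : size w = n ->
  (osc (unzip1 (unzip1 w)) < 2 ^ log_scales n)%N.
Proof.
move=> wn; apply: leq_ltn_trans (osc_le_size _) _.
by rewrite !size_map wn trunc_log_ltn.
Qed.

(** The factor of the last term counts the uses of the switchless pattern: once for all scales
    together, and once more in each correction, which has to remove it. *)
Definition lamp_count (n : nat) : R :=
  \sum_(s < log_scales n) Ex n (fun u => (naddr (pow2 s) (q s) u)%:R) +
  (log_scales n).+1%:R * Ex n (fun u => (naddr 1 0 u)%:R).

Definition lamp_total (n : nat) : R :=
  \sum_(s < log_scales n) Ex n (lamp_sum R (pow2 s) (q s)) +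
  (log_scales n).+1%:R * Ex n (lamp_sum R 1 0).

Lemma Ex_osc n : (0 < n)%N ->
  Ex n (fun es => (osc es)%:R : R) <= 2 * Num.sqrt n%:R.
Proof.
move=> n0; apply: (@le_trans _ _ (Ex n (fun es =>
    (mx es)%:~R + (mn es)%:~R : R))).
  by apply: Ex_le => es _; rewrite -intrD -oscE.
rewrite ExD.
have := Ex_second_moment n0 (Ex_mx2 R n); have := Ex_second_moment n0 (Ex_mn2 R n).
lra.
Qed.

Lemma quotient_sum_le (A B : seq epoint) (f g : epoint -> int) (a : nat) :
  (0 < a)%N -> uniq A -> uniq B ->
  (forall x, f x != 0 -> x \in A) -> (forall x, g x != 0 -> x \in B) ->
  (\sum_(x <- undup (A ++ B)) absz (f x - g x) %/ a)%:R <=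
  (\sum_(x <- A) `|f x|%:~R + \sum_(x <- B) `|g x|%:~R) / a%:R :> R.
Proof.
move=> a0 uA uB fA gB.
have a0' : 0 < a%:R :> R by rewrite ltr0n.
rewrite ler_pdivlMr// -natrM.
have castE (C : seq epoint) (h : epoint -> int) :
    \sum_(x <- C) `|h x|%:~R = (\sum_(x <- C) absz (h x))%:R :> R.
  by rewrite natr_sum; apply: eq_bigr => x _; rewrite -abszE.
rewrite !castE -natrD ler_nat big_distrl /=.
apply: (@leq_trans (\sum_(x <- undup (A ++ B)) (absz (f x) + absz (g x)))).
  by apply: leq_sum => x _; apply: leq_trans (leq_trunc_div _ _) _; lia.
rewrite big_split leq_add//.
  by apply: sum_uniq_le => //; rewrite ?undup_uniq// => x _; rewrite absz_eq0; exact: fA.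
by apply: sum_uniq_le => //; rewrite ?undup_uniq// => x _; rewrite absz_eq0; exact: gB.
Qed.

Lemma ssum_neq0 (K : eqType) (ys : seq K) es a :
  ssum ys es a != 0 -> a \in undup ys.
Proof.
by rewrite mem_undup; apply: contraNT => /ssum_notin ->.
Qed.

Hypothesis amp_gt0 : forall i, (0 < amp i)%N.

Lemma word_bound_le (k i : nat) (Q : nat) w : (forall s, (s < k)%N -> (q s <= Q)%N) ->
  (word_bound q amp w i k)%:R <= i.+1%:R * (
    k.+1%:R * (26 * (osc (unzip1 (unzip1 w)))%:R + 11 + 4 * 2 ^+ i)
    + 4 * (1 + 6 * Q%:R) * (\sum_(s < k) (naddr (pow2 s) (q s) (unzip1 w))%:R +
        k.+1%:R * (naddr 1 0 (unzip1 w))%:R)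
    + 2 * (\sum_(s < k) lamp_sum R (pow2 s) (q s) w +
           k.+1%:R * lamp_sum R 1 0 w) / (amp i)%:R) :> R.
Proof.
move=> qQ; rewrite /word_bound; set o := osc _; set a := (amp i)%:R : R.
set L := (naddr 1 0 (unzip1 w))%:R : R; set Y := lamp_sum R 1 0 w.
have a0 : 0 < a by rewrite ltr0n.
have costE n l v : (cost i o n l v)%:R = i.+1%:R * (4 * (l%:R * (1 + 6 * n%:R))
    + 2 * v%:R + 20 * o%:R + 8 + 4 * 2 ^+ i) :> R.
  by rewrite /cost -natrX -!natrM nat1r -!natrM -!natrD -natrM.
have V0 : (\sum_(x <- closed_addrs w) absz (closed_value w x) %/ amp i)%:R <= Y / a :> R.
  have := @quotient_sum_le (closed_addrs w) [::] (closed_value w) (fun=> 0)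
    (amp i) (amp_gt0 i) (undup_uniq _) isT (@ssum_neq0 _ _ _) _.
  rewrite cats0 big_nil addr0 undup_id ?undup_uniq//.
  by under eq_bigr do rewrite subr0; apply=> x; rewrite eqxx.
have Vs s : (\sum_(x <- undup (scale_addrs q s w ++ closed_addrs w))
    absz (scale_value q s w x - closed_value w x) %/ amp i)%:R <=
    (lamp_sum R (pow2 s) (q s) w + Y) / a.
  by apply: quotient_sum_le; rewrite ?undup_uniq// => x; apply: ssum_neq0.
rewrite natrD natrD natrD natr_sum.
set I := i.+1%:R : R; have I1 : 1 <= I by rewrite ler1n.
set B := 20 * o%:R + 8 + 4 * 2 ^+ i : R.
have o0 : 0 <= o%:R :> R by rewrite ler0n.
have X0 : 0 <= 2 ^+ i :> R by rewrite exprn_ge0.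
have B0 : 0 <= B by rewrite /B; lra.
have L0 : 0 <= L by rewrite ler0n.
have h1 : (6 * o)%:R + 3 <= I * (6 * o%:R + 3) by rewrite natrM; nra.
have h2 : (cost i o 0 (size (closed_addrs w))
    (\sum_(x <- closed_addrs w) absz (closed_value w x) %/ amp i))%:R <=
    I * (4 * L + 2 * (Y / a) + B).
  rewrite costE -/I ler_pM2l; last by lra.
  rewrite mulr0 addr0 mulr1 /B -/L; lra.
have h3 (s : 'I_k) : (cost i o (q s)
    (size (scale_addrs q s w) + size (closed_addrs w))
    (\sum_(x <- undup (scale_addrs q s w ++ closed_addrs w))
       absz (scale_value q s w x - closed_value w x) %/ amp i))%:R <=
    I * (4 * (1 + 6 * Q%:R) * ((naddr (pow2 s) (q s) (unzip1 w))%:R + L) +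
      2 * ((lamp_sum R (pow2 s) (q s) w + Y) / a) + B).
  rewrite costE -/I ler_pM2l; last by lra.
  have -> : (size (scale_addrs q s w) + size (closed_addrs w))%:R =
    (naddr (pow2 s) (q s) (unzip1 w))%:R + L :> R by rewrite natrD.
  have N0 : 0 <= (naddr (pow2 s) (q s) (unzip1 w))%:R + L by rewrite addr_ge0 ?ler0n.
  have qs : (q s)%:R <= Q%:R :> R by rewrite ler_nat qQ.
  have := ler_wpM2l N0 qs; rewrite /B; have := Vs s; nra.
apply: le_trans.
  by apply: lerD (lerD h1 h2) _; apply: ler_sum => s _; exact: h3.
have sc (c : R) : \sum_(s < k) c = k%:R * c.
  by rewrite sumr_const card_ord mulr_natl.
rewrite -mulr_sumr -!mulrDr ler_pM2l; last by lra.
have BE : B = 20 * o%:R + 8 + 4 * 2 ^+ i by [].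
clearbody B.
rewrite !big_split /= -!mulr_sumr -mulr_suml !big_split /= !sc -(natr1 k).
have Q0 : 0 <= Q%:R :> R by rewrite ler0n.
have QL0 := mulr_ge0 Q0 L0.
have k0 : 0 <= k%:R :> R by rewrite ler0n.
have ko := mulr_ge0 k0 o0.
set N := \sum_(s < k) _; set Z := \sum_(s < k) _.
have -> : 2 * (Z + (k%:R + 1) * Y) / a = 2 * ((Z + k%:R * Y) / a) + 2 * (Y / a).
  by field; rewrite gt_eqF.
have kB : (k%:R + 1) * (26 * o%:R + 11 + 4 * 2 ^+ i) =
    6 * o%:R + 3 + B + (k%:R * B + 6 * (k%:R * o%:R) + 3 * k%:R) :> R.
  by rewrite BE; ring.
set W := (Z + _) / a; have -> : 4 * (1 + 6 * Q%:R) * (N + (k%:R + 1) * L) =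
    4 * L + 24 * (Q%:R * L) + 4 * (1 + 6 * Q%:R) * (N + k%:R * L) :> R.
  by ring.
by rewrite kB; lra.
Qed.

Hypotheses (amp0 : amp 0 = 1%N)
  (amp_double : forall i, (amp i.+1 <= 2 * amp i)%N).

Definition length_bound (n i Q : nat) : R := i.+1%:R * (
  (log_scales n).+1%:R * (52 * Num.sqrt n%:R + 11 + 4 * 2 ^+ i)
  + 4 * (1 + 6 * Q%:R) * lamp_count n + 2 * lamp_total n / (amp i)%:R).

Lemma Ex_word_bound_le (n i Q : nat) : (0 < n)%N ->
  (forall s, (s < log_scales n)%N -> (q s <= Q)%N) ->
  Ex n (fun w => (word_bound q amp w i (log_scales n))%:R) <=
  length_bound n i Q.
Proof.
move=> n0 qQ; apply: le_trans (Ex_le (fun w _ => word_bound_le i w qQ)) _.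
set k := log_scales n; set I := i.+1%:R; set K := k.+1%:R.
set a := (amp i)%:R; set C := 4 * (1 + 6 * Q%:R).
have I0 : 0 <= I :> R by rewrite ler0n.
have K0 : 0 <= K :> R by rewrite ler0n.
rewrite ExZ /length_bound -/I ler_wpM2l// !ExD lerD//; last first.
  under eq_Ex => w _ do rewrite [2 * _ / _]mulrAC.
  rewrite ExZ [leRHS]mulrAC ler_wpM2l ?divr_ge0 ?ler0n//.
  by rewrite ExD ExZ Ex_sum.
rewrite lerD//; last first.
  rewrite ExZ ler_wpM2l//.
    by have : 0 <= Q%:R :> R by [rewrite ler0n|]; rewrite /C; lra.
  rewrite ExD ExZ Ex_sum lerD//; first apply: ler_sum => s _.
    by rewrite (Ex_unzip1 n (fun u => (naddr (pow2 s) (q s) u)%:R) card_signs).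
  by rewrite ler_wpM2l// (Ex_unzip1 n (fun u => (naddr 1 0 u)%:R) card_signs).
rewrite ExZ ler_wpM2l// !ExD ExZ !Ex_cst ?card_steps// !lerD2r.
rewrite (Ex_unzip1 n (fun u => (osc (unzip1 u))%:R) card_signs).
rewrite (Ex_unzip1 n (fun es => (osc es)%:R)).
  by have := Ex_osc n0; lra.
by rewrite card_prod card_bool.
Qed.

Lemma speed_lamp_le (S : set (generated M)) : generates S -> exists K : nat,
  forall n i Q : nat, (0 < n)%N ->
  (forall s, (s < log_scales n)%N -> (q s <= Q)%N) ->
  speed S (@lamp_law R q amp) n <= K%:R * length_bound n i Q.
Proof.
move=> /word_length_of_word[K KP]; exists K => n i Q n0 qQ.
rewrite speed_walk ?card_steps//.
apply: le_trans (ler_wpM2l (ler0n _ K) (Ex_word_bound_le i n0 qQ)).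
rewrite -ExZ; apply: Ex_le => w wn; rewrite walk_of_word -natrM ler_nat.
have [v vw vs] := spells_walk q amp0 amp_gt0 amp_double i (osc_lt_scales wn).
have -> : of_word (walk_word q amp w) = of_word v by apply/of_word_eq => z; rewrite vw.
by apply: leq_trans (KP _) _; rewrite leq_mul2l vs orbT.
Qed.

Lemma shift_bound_le (t1 t2 t1' t2' : nat) : (t1 <= t1')%N -> (t2 <= t2')%N ->
  (shift_bound amp t1 t2 <= shift_bound amp t1' t2')%N.
Proof.
move=> h1 h2; apply: leq_mul; first by rewrite ltnS leq_trunc_log.
rewrite leq_add2l -!(big_mkord xpredT amp).
rewrite [leqRHS](@big_cat_nat _ _ _ (trunc_log 2 t2).+1)/= ?leq_addr//.
by rewrite ltnS leq_trunc_log.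
Qed.

(** A second-moment argument. Let [Z] be the sum of the absolute rotations at scale [s], in units of
    2. The expression [2 * Z / r - z / r - Z ^+ 2 / r ^+ 2] is always at most 1, and if the length
    is below [L], then [2 * Z <= z] makes it at most 0; so [L] times it is at most the length. Then
    take expectations. *)
Lemma speed_lamp_ge (S : set (generated M)) : finite_set S -> generates S -> exists K : nat,
  forall (n s L : nat) (r : R), (0 < n)%N -> 0 < r ->
  L%:R * (2 * (n%:R / Num.sqrt (3 * green R (pow2 s) (q s) n)) / r
    - (K * L * shift_bound amp (2 ^ s + K * L) (K * L))%:R / r
    - 2 * n%:R * Ex n (fun u => (naddr (pow2 s) (q s) u)%:R) / r ^+ 2) <=
  speed S (@lamp_law R q amp) n.
Proof.
move=> S_fin S_gen; have [K KP] := of_word_word_length S_fin S_gen.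
exists K => n s L r n0 r0; rewrite speed_walk ?card_steps//.
set z := (_ * shift_bound _ _ _)%N.
pose Z := lamp_sum R (pow2 s) (q s).
apply: (@le_trans _ _ (Ex n (fun w => L%:R * (2 / r * Z w + (- (z%:R / r)) +
    (- (r ^+ 2)^-1) * Z w ^+ 2)))); last first.
  apply: Ex_le => w _; rewrite walk_of_word.
  have [v /of_word_eq vw vs] := KP (of_word (walk_word q amp w)).
  set l := word_length _ _ in vs *.
  have Z0 : 0 <= Z w by apply: sumr_ge0 => x _; rewrite ler0z.
  have le1 : 2 / r * Z w - z%:R / r + - (r ^+ 2)^-1 * Z w ^+ 2 <= 1.
    have : 0 <= z%:R / r by rewrite divr_ge0// ltW.
    have -> : 2 / r * Z w = 2 * (Z w / r) by field; rewrite gt_eqF.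
    have -> : - (r ^+ 2)^-1 * Z w ^+ 2 = - (Z w / r) ^+ 2 by field; rewrite gt_eqF.
    by have := sqr_ge0 (Z w / r - 1); nra.
  have [Ll|lL] := leqP L l.
    apply: (@le_trans _ _ (L%:R * 1)); first by rewrite ler_wpM2l.
    by rewrite mulr1 ler_nat.
  suff Zz : 2 * Z w <= z%:R.
    apply: (@le_trans _ _ 0); last by rewrite ler0n.
    rewrite mulr_ge0_le0//.
    have -> : 2 / r * Z w = 2 * Z w / r by field; rewrite gt_eqF.
    have : 2 * Z w / r <= z%:R / r by rewrite ler_pM2r// invr_gt0.
    have : 0 <= (r ^+ 2)^-1 * Z w ^+ 2 by rewrite mulr_ge0 ?sqr_ge0// invr_ge0 sqr_ge0.
    by rewrite mulNr; lra.
  have vK : (size v <= K * L)%N by apply: leq_trans vs _; rewrite leq_mul2l (ltnW lL) orbT.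
  have := leq_trans (rotation_amount_le s vw) (leq_mul vK
    (shift_bound_le (leq_add (leqnn (2 ^ s)%N) vK) vK)).
  rewrite -(ler_nat R) -/z; apply: le_trans.
  rewrite /Z lamp_sumE -big_distrr natrM /= natr_sum.
  by rewrite ler_pM2l ?ltr0n// ler_sum.
rewrite ExZ !ExD !ExZ Ex_cst ?card_steps// ler_wpM2l// mulNr.
have h1 := Ex_lamp_sum_ge R (q s) (pow2_gt0 s) n0.
have h2 := Ex_lamp_sum2_le R (pow2 s) (q s) n.
rewrite lerD//; last first.
  by rewrite lerN2 mulrC ler_pM2r// invr_gt0 exprn_gt0.
rewrite lerD2r [leRHS]mulrAC ler_pM2r ?invr_gt0//.
by rewrite ler_pM2l// ltr0n.
Qed.

End SpeedEntropyBounds.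

(* The law of the walk on rotation amounts does not involve [amp], so its
   entropy may be bounded with the words of the group built from another
   amplifier. *)
Lemma entropy_lamp_le (R : realType) (q amp amp' : nat -> nat) (n i Q : nat) :
  amp' 0 = 1%N -> (forall i, (0 < amp' i)%N) ->
  (forall i, (amp' i.+1 <= 2 * amp' i)%N) -> (0 < n)%N ->
  (forall s, (s < log_scales n)%N -> (q s <= Q)%N) ->
  entropy (@lamp_law R q amp) n <=
  ln 2 + (ln 2 + ln #|{: generator * bool}|%:R) * length_bound R q amp' n i Q.
Proof.
move=> a0 ap ad n0 qQ; rewrite entropy_walk ?card_steps//.
pose M' := lamp_moves q amp'.
have codeP (w : seq step_type) : exists v : seq (letter M'), size w = n ->
    wact v =1 wact (walk_word q amp' w) /\
    (size v <= word_bound q amp' w i (log_scales n))%N.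
  have [wn|//] := pselect (size w = n); last by exists [::].
  have [v vw vs] := spells_walk q a0 ap ad i (osc_lt_scales wn).
  by exists v.
have [code codeE] := choice codeP.
(* Walk words contain no [Gf] and act alike for both amplifiers, so the action of a code word
   determines the element of the other group. *)
pose decode (v : seq (letter M')) : generated (lamp_moves q amp) :=
  xget 1%g [set g : generated (lamp_moves q amp) |
            forall z : bpoint * int, gfun g z = @wact M' v z].
have dec w : size w = n -> decode (code w) = walk (group_step q amp) w.
  move=> /codeE[cw _]; rewrite walk_of_word /decode; case: xgetP => [g _ /= gE|].
    apply: gfun_inj; apply/funext => -[[[p j] x] k].
    by rewrite gE cw gfun_of_word !wact_walk_word.
  move=> /(_ (of_word (walk_word q amp w))) []; rewrite /= => -[[[p j] x] k].
  by rewrite cw !wact_walk_word.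
have c0 : (0 < #|{: letter M'}|)%N by apply/card_gt0P; exists (Gt, true).
have := entropy_le_code R card_steps c0 dec; move=> /le_trans; apply.
have l2 : 0 <= ln 2 :> R by rewrite ln_ge0// ler1n.
have lg : 0 <= ln #|{: letter M'}|%:R :> R by rewrite ln_ge0// ler1n.
apply: (@le_trans _ _ (Ex n (fun w : seq step_type => ln 2 +
  (ln 2 + ln #|{: letter M'}|%:R) *
  (word_bound q amp' w i (log_scales n))%:R))).
  apply: Ex_le => w /codeE[_ cs]; rewrite -natr1 mulrDl mul1r.
  have : (size (code w))%:R <= (word_bound q amp' w i (log_scales n))%:R :> R.
    by rewrite ler_nat.
  nra.
rewrite ExD Ex_cst ?card_steps// lerD2l ExZ ler_wpM2l ?addr_ge0//.
exact: Ex_word_bound_le.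
Qed.

(** * Exponents *)

Section Exponents.
Variable R : realType.
Implicit Types (f g : nat -> R) (a e c : R).

Definition exponent_le f a := forall e, 0 < e ->
  \forall n \near \oo, f n <= n%:R `^ (a + e).

(** Small [e] carry all the information of a lower bound; [e < 1] keeps the exponents of trial
    lengths nonnegative. *)
Definition exponent_ge f a := forall e, 0 < e < 1 ->
  \forall n \near \oo, n%:R `^ (a - e) <= f n.

Lemma near_powR_ge c e : 0 < e -> \forall n \near \oo, c <= (n%:R : R) `^ e.
Proof.
move=> e0; pose d := Num.max c 1.
have d1 : 1 <= d by rewrite le_max lexx orbT.
apply: filterS (nbhs_infty_ger (d `^ e^-1)) => n dn.
apply: (@le_trans _ _ d); first by rewrite le_max lexx.
have -> : d = (d `^ e^-1) `^ e.
  by rewrite -powRrM mulVf ?powRr1 ?(le_trans ler01)// lt0r_neq0.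
by apply: ge0_ler_powR; rewrite ?nnegrE ?powR_ge0// ltW.
Qed.

Lemma natr_powRD n a b : (0 < n)%N -> (n%:R : R) `^ (a + b) = n%:R `^ a * n%:R `^ b.
Proof. by move=> n0; rewrite powRD// pnatr_eq0 -lt0n n0 implybT. Qed.

Lemma exponent_le_trans f g a b : (\forall n \near \oo, f n <= g n) -> a <= b ->
  exponent_le g a -> exponent_le f b.
Proof.
move=> fg ab ga e e0; apply: filterS3 fg (ga e e0) (nbhs_infty_gt 0).
move=> n fgn gn n0; apply: le_trans fgn (le_trans gn _).
by rewrite ler_powR ?ler1n ?lerD2r.
Qed.

Lemma exponent_le_weaken f a b : a <= b -> exponent_le f a -> exponent_le f b.
Proof. by apply: exponent_le_trans; exact: nearW. Qed.

Lemma exponent_le_powR a : exponent_le (fun n => n%:R `^ a) a.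
Proof.
move=> e e0; apply: filterS (nbhs_infty_gt 0) => n n0.
by rewrite ler_powR ?ler1n// lerDl ltW.
Qed.

Lemma exponent_le_cst c : exponent_le (fun=> c) 0.
Proof.
by move=> e e0; apply: filterS (near_powR_ge c e0) => n; rewrite add0r.
Qed.

Lemma exponent_leD f g a : exponent_le f a -> exponent_le g a ->
  exponent_le (fun n => f n + g n) a.
Proof.
move=> fa ga e e0; have e2 : 0 < e / 2 by rewrite divr_gt0.
have h2 := near_powR_ge 2 e2.
near=> n; have n0 : (0 < n)%N by near: n; exact: nbhs_infty_gt.
have f1 : f n <= n%:R `^ (a + e / 2) by near: n; exact: fa.
have g1 : g n <= n%:R `^ (a + e / 2) by near: n; exact: ga.
have c1 : 2 <= (n%:R : R) `^ (e / 2) by near: n; exact: h2.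
have -> : a + e = (a + e / 2) + e / 2 by rewrite -addrA -splitr.
rewrite natr_powRD//; have := powR_ge0 (n%:R : R) (a + e / 2); nra.
Unshelve. all: by end_near. Qed.

Lemma exponent_leM f g a b : (forall n, 0 <= f n) -> (forall n, 0 <= g n) ->
  exponent_le f a -> exponent_le g b -> exponent_le (fun n => f n * g n) (a + b).
Proof.
move=> f0 g0 fa ga e e0; have e2 : 0 < e / 2 by rewrite divr_gt0.
apply: filterS3 (fa _ e2) (ga _ e2) (nbhs_infty_gt 0) => n f1 g1 n0.
have -> : a + b + e = (a + e / 2) + (b + e / 2) by rewrite addrACA -splitr.
by rewrite natr_powRD//; apply: ler_pM.
Qed.

Lemma exponent_leM0 f g a : (forall n, 0 <= f n) -> (forall n, 0 <= g n) ->
  exponent_le f 0 -> exponent_le g a -> exponent_le (fun n => f n * g n) a.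
Proof. by move=> f0 g0 fa ga; rewrite -[a]add0r; exact: exponent_leM. Qed.

Lemma exponent_leZ c f a : 0 <= c -> exponent_le f a ->
  exponent_le (fun n => c * f n) a.
Proof.
move=> c0 fa e e0; have e2 : 0 < e / 2 by rewrite divr_gt0.
apply: filterS3 (near_powR_ge c e2) (fa _ e2) (nbhs_infty_gt 0) => n h1 h2 n0.
have -> : a + e = e / 2 + (a + e / 2) by rewrite addrCA -splitr.
rewrite natr_powRD//; apply: le_trans (ler_wpM2l c0 h2) _.
by rewrite ler_wpM2r ?powR_ge0.
Qed.

Lemma ln_natr_ge0 n : 0 <= ln (n%:R : R).
Proof. by case: n => [|n]; [rewrite ln0|rewrite ln_ge0// ler1n]. Qed.

Lemma exponent_le_ln : exponent_le (fun n => ln (n%:R : R)) 0.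
Proof.
move=> e e0; rewrite add0r; have e2 : 0 < e / 2 by rewrite divr_gt0.
apply: filterS2 (near_powR_ge (e / 2)^-1 e2) (nbhs_infty_gt 0) => n h n0.
have p0 : 0 < (n%:R : R) `^ (e / 2) by rewrite powR_gt0// ltr0n.
have : ln ((n%:R : R) `^ (e / 2)) <= n%:R `^ (e / 2).
  have := @le_ln1Dx R (n%:R `^ (e / 2) - 1); rewrite subrKC ltrBrDr addNr => /(_ p0).
  by move=> /le_trans; apply; rewrite lerBlDr lerDl.
rewrite ln_powR mulrC -ler_pdivlMr// => /le_trans; apply.
by rewrite [in leRHS](splitr e) natr_powRD// ler_pM2l.
Qed.

Lemma exponent_le_sqrt : exponent_le (fun n => Num.sqrt n%:R) 2^-1.
Proof.
apply: exponent_le_trans (lexx _) (exponent_le_powR _).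
by apply: nearW => n; rewrite powR12_sqrt.
Qed.

Lemma ln2_gt0 : 0 < ln 2 :> R. Proof. by rewrite ln_gt0// ltr1n. Qed.

Lemma natr_trunc_log_le (t : nat) (x : R) : 1 <= x -> t%:R <= x ->
  (trunc_log 2 t)%:R <= ln x / ln 2.
Proof.
move=> x1 tx; have x0 : 0 < x by apply: lt_le_trans x1.
rewrite ler_pdivlMr ?ln2_gt0// -ln_powR powR_mulrn//.
case: t tx => [|t] tx; first by rewrite trunc_log0 expr0 ln1 ln_ge0.
rewrite ler_ln ?posrE ?exprn_gt0//; apply: le_trans tx.
by rewrite -natrX ler_nat trunc_logP.
Qed.

Lemma exponent_le_trunc_log (t : nat -> nat) a : 0 <= a ->
  exponent_le (fun n => (t n)%:R) a ->
  exponent_le (fun n => (trunc_log 2 (t n)).+1%:R) 0.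
Proof.
move=> a0 ta; have l2 := ln2_gt0.
have c0 : 0 <= (a + 1) / ln 2 by rewrite divr_ge0 ?addr_ge0 ?(ltW l2).
apply: (@exponent_le_trans _ (fun n => 1 + (a + 1) / ln 2 * ln n%:R)) (lexx _) _.
  apply: filterS2 (ta 1 ltr01) (nbhs_infty_gt 0) => n tn n0.
  rewrite -natr1 addrC lerD2l mulrAC -ln_powR.
  apply: natr_trunc_log_le tn.
  by rewrite -[leLHS](powRr0 (n%:R : R)) ler_powR ?ler1n ?addr_ge0.
apply: exponent_leD; first exact: exponent_le_cst.
by apply: exponent_leZ => //; exact: exponent_le_ln.
Qed.

Lemma has_exponentP f a : exponent_le f a -> exponent_ge f a -> has_exponent f a.
Proof.
move=> fle fge; apply/cvgrPdist_le => e0 e0_gt0.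
pose e := Num.min e0 2^-1.
have e_gt0 : 0 < e by rewrite lt_min e0_gt0 invr_gt0 ltr0n.
have e1 : 0 < e < 1 by rewrite e_gt0 gt_min invf_lt1 ?ltr1n ?orbT.
apply: filterS3 (fle e e_gt0) (fge e e1) (nbhs_infty_gt 1) => n ub lb n1.
have n0 : 0 < n%:R :> R by rewrite ltr0n ltnW.
have ln0 : 0 < ln (n%:R : R) by rewrite ln_gt0// ltr1n.
have f0 : 0 < f n by apply: lt_le_trans lb; rewrite powR_gt0.
apply: (@le_trans _ _ e); last by rewrite ge_min lexx.
have h1 : ln (f n) <= (a + e) * ln n%:R.
  by rewrite -ln_powR ler_ln ?posrE ?powR_gt0.
have h2 : (a - e) * ln n%:R <= ln (f n).
  by rewrite -ln_powR ler_ln ?posrE ?powR_gt0.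
rewrite -ler_pdivrMr// in h1; rewrite -ler_pdivlMr// in h2.
by rewrite ler_norml; apply/andP; split; lra.
Qed.

Definition lg (n : nat) : R := ln n%:R / ln 2.

Lemma lg_ge0 n : 0 <= lg n.
Proof. by rewrite divr_ge0 ?ln_natr_ge0// ltW// ln2_gt0. Qed.

Lemma exponent_le_lg : exponent_le lg 0.
Proof.
have := exponent_leZ (ltW (_ : 0 < (ln 2)^-1 :> R)) exponent_le_ln.
rewrite invr_gt0 => /(_ ln2_gt0); apply: exponent_le_trans (lexx 0).
by apply: nearW => n; rewrite /lg mulrC.
Qed.

Lemma near_lg_ge c : \forall n \near \oo, c <= lg n.
Proof.
apply: filterS2 (near_powR_ge (expR (c * ln 2)) ltr01) (nbhs_infty_gt 0) => n h n0.
rewrite /lg ler_pdivlMr ?ln2_gt0//.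
by rewrite -[leLHS]expRK ler_ln ?posrE ?expR_gt0 ?ltr0n// -(powRr1 (ler0n _ n)).
Qed.

Lemma pow2_le_powR (m n : nat) a : (0 < n)%N -> m%:R <= a * lg n ->
  2 ^+ m <= (n%:R : R) `^ a.
Proof.
move=> n0; rewrite mulrA ler_pdivlMr ?ln2_gt0// => h.
rewrite -ler_ln ?posrE ?exprn_gt0 ?powR_gt0 ?ltr0n//.
by rewrite ln_powR -powR_mulrn// ln_powR.
Qed.

Lemma powR_le_pow2 (m n : nat) a : (0 < n)%N -> a * lg n <= m%:R ->
  (n%:R : R) `^ a <= 2 ^+ m.
Proof.
move=> n0; rewrite mulrA ler_pdivrMr ?ln2_gt0// => h.
rewrite -ler_ln ?posrE ?exprn_gt0 ?powR_gt0 ?ltr0n//.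
by rewrite ln_powR -powR_mulrn// ln_powR.
Qed.

End Exponents.

(** * Choice of the scales and of the amplifier *)

Section Calibration.
Variable R : realType.
Implicit Types (theta kappa beta : R).

(* For [theta = 1] a superlinear number of bits is needed: it makes lamps at the
   subpolynomial scale [2 ^ sqrt (lg n)] return only [n ^ o(1)] times. *)
Definition scale_bits theta (s : nat) : nat :=
  if theta < 1 then Num.truncn ((2 * theta - 1) / (2 - 2 * theta) * s%:R)
  else (s ^ 2)%N.

Definition amplifier kappa (i : nat) : nat := (2 ^ Num.truncn (kappa * i%:R))%N.

Definition level beta (n : nat) : nat := Num.truncn (beta * lg R n).

Lemma trunc_le (x : R) : 0 <= x -> (Num.truncn x)%:R <= x.
Proof. by rewrite truncn_le. Qed.

Lemma trunc_gt (x : R) : x < (Num.truncn x)%:R + 1.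
Proof. by rewrite natr1 truncnS_gt. Qed.

Lemma amplifier0 kappa : amplifier kappa 0 = 1%N.
Proof. by rewrite /amplifier mulr0 truncn0. Qed.

Lemma amplifier_gt0 kappa i : (0 < amplifier kappa i)%N.
Proof. by rewrite expn_gt0. Qed.

Lemma amplifier_double kappa i : kappa <= 1 ->
  (amplifier kappa i.+1 <= 2 * amplifier kappa i)%N.
Proof.
move=> k1; rewrite -expnS leq_exp2l// truncn_le_nat.
have := trunc_gt (kappa * i%:R).
by rewrite -(natr1 i) -(natr1 _.+1) -(natr1 (Num.truncn _)); lra.
Qed.

Section Amplifier.
Variables (kappa beta : R).
Hypotheses (kappa0 : 0 <= kappa) (kappa1 : kappa <= 1) (beta0 : 0 <= beta).

Lemma level_le n : (level beta n)%:R <= beta * lg R n.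
Proof. by rewrite trunc_le// mulr_ge0// lg_ge0. Qed.

Lemma pow2_level n : (0 < n)%N -> 2 ^+ level beta n <= (n%:R : R) `^ beta.
Proof. by move=> n0; apply: pow2_le_powR => //; exact: level_le. Qed.

(** The factor 4 pays for two roundings, that of the level and that of the exponent of the
    amplifier, each losing at most one bit since [kappa <= 1]. *)
Lemma amplifier_level n : (0 < n)%N ->
  ((amplifier kappa (level beta n))%:R)^-1 <= 4 * (n%:R : R) `^ (- (beta * kappa)).
Proof.
move=> n0; set m := Num.truncn (kappa * (level beta n)%:R).
have m2 : beta * kappa * lg R n <= (m + 2)%N%:R.
  have h1 := trunc_gt (kappa * (level beta n)%:R).
  have h2 := trunc_gt (beta * lg R n); rewrite -/m in h1.
  rewrite -/(level beta n) in h2.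
  have := ler_wpM2l kappa0 (ltW h2); rewrite natrD; move: h1 kappa1; lra.
have := powR_le_pow2 n0 m2; rewrite exprD powRN => h.
rewrite /amplifier -/m natrX.
have p0 : 0 < (n%:R : R) `^ (beta * kappa) by rewrite powR_gt0// ltr0n.
rewrite ler_pdivlMr// mulrC ler_pdivrMr ?exprn_gt0//; apply: le_trans h _.
by rewrite mulrC ler_wpM2r ?exprn_ge0// expr2; lra.
Qed.

Lemma amplifier_sum (t : nat) :
  (\sum_(i < (trunc_log 2 t).+1) amplifier kappa i)%:R <=
  (trunc_log 2 t).+1%:R * (t.+1%:R : R) `^ kappa.
Proof.
rewrite natr_sum mulr_natl -[X in _ *+ X]card_ord -sumr_const.
apply: ler_sum => i _; rewrite /amplifier natrX; apply: pow2_le_powR => //.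
have k0 : 0 <= kappa * i%:R by rewrite mulr_ge0.
apply: le_trans (trunc_le k0) _; rewrite ler_wpM2l//.
apply: (@le_trans _ _ (trunc_log 2 t)%:R).
  by rewrite ler_nat -ltnS ltn_ord.
by apply: natr_trunc_log_le; rewrite ?ler1n// ler_nat.
Qed.

End Amplifier.

Section EntropyExponent.
Variable theta : R.
Hypotheses (theta_ge : 2^-1 <= theta) (theta_le : theta <= 1).

Local Notation q := (scale_bits theta).

(** Origin of the ratio: lamps of scale [2^s = n^(1 - theta)] get [(theta - 1/2) log2 n] switches,
    for which [2^q sqrt n = n^theta] and [2^(- q) sqrt n = n^(1 - theta)] hold together. *)
Lemma bits_ratio : theta < 1 -> let b := (2 * theta - 1) / (2 - 2 * theta) in
  0 <= b /\ b * (1 - theta) = theta - 2^-1.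
Proof.
move=> t1 b; split; first by rewrite divr_ge0//; move: theta_ge theta_le; lra.
by rewrite /b; field; rewrite gt_eqF//; lra.
Qed.

Lemma scale_bits_le s t : (s <= t)%N -> (q s <= q t)%N.
Proof.
move=> st; rewrite /scale_bits; case: ifPn => [t1|_]; last by rewrite leq_sqr.
by have [b0 _] := bits_ratio t1; rewrite le_truncn// ler_wpM2l// ler_nat.
Qed.

Definition addr_bound (n : nat) : R :=
  (2 * Num.sqrt n%:R + 1) * n%:R `^ (theta - 2^-1) + 2 * Num.sqrt n%:R + 2 +
  n%:R `^ theta.

(** Scales below [n^(1 - theta)] are limited by the number of environments, the others by the number
    of climbs; both bounds are of order [n^theta] at the threshold. *)
Lemma Ex_naddr_le s n : (0 < n)%N ->
  Ex n (fun u : seq bstep => (naddr (pow2 s) (q s) u)%:R) <= addr_bound n.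
Proof.
move=> n0; have sq0 : 0 <= Num.sqrt n%:R :> R by rewrite sqrtr_ge0.
have p0 : 0 < (n%:R : R) by rewrite ltr0n.
have p1 := powR_ge0 (n%:R : R) (theta - 2^-1).
have p2 := powR_ge0 (n%:R : R) theta.
have [ns|sn] := leP ((n%:R : R) `^ (1 - theta)) (2 ^+ s).
  apply: le_trans (Ex_naddr_climbs R (q s) (pow2_gt0 s) n0) _.
  rewrite /addr_bound.
  have -> : (pow2 s)%:~R = 2 ^+ s :> R by rewrite /pow2 -natrX.
  have : n%:R / 2 ^+ s <= (n%:R : R) `^ theta.
    rewrite ler_pdivrMr ?exprn_gt0//.
    apply: (@le_trans _ _ (n%:R `^ theta * n%:R `^ (1 - theta))).
      by rewrite -natr_powRD// subrKC powRr1// ltW.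
    by rewrite ler_wpM2l.
  have : 0 <= (2 * Num.sqrt n%:R + 1) * (n%:R : R) `^ (theta - 2^-1).
    by rewrite mulr_ge0// addr_ge0// mulr_ge0.
  lra.
(* For [theta = 1] the threshold is [n^0 = 1], and no scale lies below it. *)
have t1 : theta < 1.
  rewrite lt_neqAle theta_le andbT; apply/eqP => t1; move: sn.
  by rewrite t1 subrr powRr0 ltNge exprn_ege1// ler1n.
have [b0 bE] := bits_ratio t1.
apply: le_trans (Ex_naddr_envs R (q s) (pow2_gt0 s) n0) _.
have : (2 : R) ^+ q s <= n%:R `^ (theta - 2^-1).
  apply: pow2_le_powR => //; rewrite /scale_bits t1 -bE.
  apply: le_trans (trunc_le _) _; first by rewrite mulr_ge0.
  rewrite -[leRHS]mulrA ler_wpM2l// leNgt; apply/negP => h.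
  by have := powR_le_pow2 n0 (ltW h); rewrite leNgt sn.
rewrite /addr_bound; nra.
Qed.

Lemma Ex_naddr_closed_le n : (0 < n)%N ->
  Ex n (fun u : seq bstep => (naddr 1 0 u)%:R) <= addr_bound n.
Proof.
move=> n0; have sq0 : 0 <= Num.sqrt n%:R :> R by rewrite sqrtr_ge0.
apply: le_trans (Ex_naddr_envs R 0 ltr01 n0) _; rewrite expr0 mulr1 /addr_bound.
have p1 := powR_ge0 (n%:R : R) (theta - 2^-1).
have p2 := powR_ge0 (n%:R : R) theta; nra.
Qed.

Lemma addr_bound_ge0 n : 0 <= addr_bound n.
Proof.
by rewrite /addr_bound !addr_ge0 ?mulr_ge0 ?addr_ge0 ?mulr_ge0 ?sqrtr_ge0 ?powR_ge0.
Qed.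

Lemma exponent_addr_bound : exponent_le addr_bound theta.
Proof.
have sq : exponent_le (fun n => 2 * Num.sqrt (n%:R : R)) 2^-1.
  by apply: exponent_leZ => //; exact: exponent_le_sqrt.
have cst c : exponent_le (fun=> c) theta.
  by apply: exponent_le_weaken (exponent_le_cst c); exact: le_trans theta_ge.
have sqt : exponent_le (fun n => 2 * Num.sqrt (n%:R : R)) theta.
  exact: exponent_le_weaken sq.
have sq1 : exponent_le (fun n => 2 * Num.sqrt (n%:R : R) + 1) 2^-1.
  apply: exponent_leD sq _; exact: exponent_le_weaken (exponent_le_cst 1).
rewrite /addr_bound; apply: exponent_leD; last exact: exponent_le_powR.
apply: exponent_leD => //; apply: exponent_leD => //.
rewrite -[theta in exponent_le _ theta](subrKC 2^-1).
apply: exponent_leM => [n|n||]; rewrite ?powR_ge0 ?addr_ge0 ?mulr_ge0 ?sqrtr_ge0//.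
exact: exponent_le_powR.
Qed.

Lemma exponent_log_scales : exponent_le (fun n => (log_scales n)%:R : R) 0.
Proof.
apply: (@exponent_le_trunc_log _ id 1) => //.
apply: exponent_le_trans (lexx 1) (exponent_le_powR 1).
by apply: nearW => n; rewrite powRr1.
Qed.

Lemma exponent_bits : exponent_le (fun n => (q (log_scales n))%:R : R) 0.
Proof.
have k := exponent_log_scales; have [t1|t1] := boolP (theta < 1).
  have [b0 _] := bits_ratio t1.
  apply: exponent_le_trans (lexx 0) (exponent_leZ b0 k).
  by apply: nearW => n; rewrite /scale_bits t1 trunc_le// mulr_ge0.
apply: exponent_le_trans (lexx 0)
  (exponent_leM0 (fun=> ler0n _ _) (fun=> ler0n _ _) k k).
by apply: nearW => n; rewrite -natrM mulnn /scale_bits (negbTE t1).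
Qed.

(* the scale of the lamps which, during [n] steps, are revisited least often *)
Definition best_scale (n : nat) : nat :=
  if theta < 1 then Num.truncn ((1 - theta) * lg R n)
  else (Num.truncn (Num.sqrt (lg R n))).+1.

Lemma best_scale_lt n : theta < 1 ->
  (1 - theta) * lg R n - 1 <= (best_scale n)%:R <= (1 - theta) * lg R n.
Proof.
move=> t1; rewrite /best_scale t1; apply/andP; split.
  by rewrite lerBlDr ltW// trunc_gt.
by rewrite trunc_le// mulr_ge0 ?subr_ge0 ?lg_ge0.
Qed.

Lemma best_scale_eq n : ~~ (theta < 1) ->
  Num.sqrt (lg R n) <= (best_scale n)%:R <= Num.sqrt (lg R n) + 1.
Proof.
move=> /negbTE t1; rewrite /best_scale t1 -natr1 lerD2r; apply/andP; split.
  by rewrite ltW// trunc_gt.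
by rewrite trunc_le// sqrtr_ge0.
Qed.

Lemma theta_eq1 : ~~ (theta < 1) -> theta = 1.
Proof. by rewrite -leNgt => t1; apply/le_anti; rewrite theta_le. Qed.

Lemma exponent_pow2_best_scale :
  exponent_le (fun n => 2 ^+ best_scale n : R) (1 - theta).
Proof.
have [t1|t1] := boolP (theta < 1).
  apply: exponent_le_trans (lexx _) (exponent_le_powR _).
  apply: filterS (nbhs_infty_gt 0) => n n0; apply: pow2_le_powR => //.
  by case/andP: (best_scale_lt n t1).
rewrite theta_eq1// subrr => e e0; rewrite add0r.
apply: filterS2 (nbhs_infty_gt 0) (near_lg_ge (((2 * e)^-1 + 1) / (e / 2))) => n n0.
rewrite ler_pdivrMr ?divr_gt0// => h; apply: pow2_le_powR => //.
case/andP: (best_scale_eq n t1) => _ /le_trans; apply.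
have : lg R n = Num.sqrt (lg R n) ^+ 2 by rewrite sqr_sqrtr// lg_ge0.
move: h; move: (lg R n) (Num.sqrt _) => l z h lz.
have : z <= e * z ^+ 2 / 2 + (2 * e)^-1.
  rewrite -(ler_pM2l (_ : 0 < 2 * e)) ?mulr_gt0//.
  have -> : 2 * e * (e * z ^+ 2 / 2 + (2 * e)^-1) = (e * z) ^+ 2 + 1.
    by field; rewrite gt_eqF.
  by have := sqr_ge0 (e * z - 1); nra.
rewrite -lz; lra.
Qed.

Lemma exponent_bits_best_scale :
  exponent_le (fun n => (q (best_scale n))%:R : R) 0.
Proof.
have k := @exponent_le_lg R; have [t1|t1] := boolP (theta < 1).
  have [b0 bE] := bits_ratio t1.
  have t2 : 0 <= theta - 2^-1 by rewrite subr_ge0.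
  apply: exponent_le_trans (lexx 0) (exponent_leZ t2 k).
  apply: nearW => n; rewrite /scale_bits t1 -bE.
  apply: le_trans (trunc_le _) _; first by rewrite mulr_ge0.
  by rewrite -[leRHS]mulrA ler_wpM2l//; case/andP: (best_scale_lt n t1).
have k2 := exponent_leD (exponent_le_cst (2 : R))
  (exponent_leZ (ler0n R 2) k).
apply: exponent_le_trans (lexx 0) k2.
apply: nearW => n; rewrite /scale_bits (negbTE t1) natrX.
case/andP: (best_scale_eq n t1) => _ h.
have : lg R n = Num.sqrt (lg R n) ^+ 2 by rewrite sqr_sqrtr// lg_ge0.
have := sqrtr_ge0 (lg R n); have : 0 <= (best_scale n)%:R :> R by rewrite ler0n.
move: h; move: (_%:R) (lg R n) (Num.sqrt _) => b l z h b0 z0 ->.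
have := sqr_ge0 (z - 1); nra.
Qed.

Lemma bits_best_scale_ge : exists c : nat, forall n,
  (theta - 2^-1) * lg R n <= (q (best_scale n) + c)%N%:R.
Proof.
have [t1|t1] := boolP (theta < 1); last first.
  exists 0%N => n; rewrite addn0 /scale_bits (negbTE t1) natrX.
  case/andP: (best_scale_eq n t1) => h _.
  have : lg R n = Num.sqrt (lg R n) ^+ 2 by rewrite sqr_sqrtr// lg_ge0.
  have := sqrtr_ge0 (lg R n); rewrite theta_eq1//.
  move: h; move: (_%:R) (lg R n) (Num.sqrt _) => b l z h z0 ->; nra.
have := bits_ratio t1; set b := _ / _ => -[b0 bE].
exists (Num.truncn b + 2)%N => n; case/andP: (best_scale_lt n t1) => h _.
rewrite addnA natrD natrD /scale_bits t1 -/b -bE.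
have := trunc_gt b; have := trunc_gt (b * (best_scale n)%:R).
have := ler_wpM2l b0 h; rewrite mulrBr mulr1 mulrA; lra.
Qed.

Lemma exponent_returns_best_scale :
  exponent_le (fun n => 2^-1 ^+ q (best_scale n) * Num.sqrt n.+1%:R) (1 - theta).
Proof.
have [c cP] := bits_best_scale_ge.
have h : exponent_le (fun n => 2 ^+ c.+1 * n%:R `^ (1 - theta) : R) (1 - theta).
  by apply: exponent_leZ => //; exact: exponent_le_powR.
apply: exponent_le_trans (lexx _) h.
apply: filterS (nbhs_infty_gt 0) => n n0.
have n0' : 0 < n%:R :> R by rewrite ltr0n.
have -> : 1 - theta = - (theta - 2^-1) + 2^-1 by field.
rewrite natr_powRD// powRN powR12_sqrt//.
have hs : Num.sqrt n.+1%:R <= 2 * Num.sqrt (n%:R : R).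
  have -> : (2 : R) = Num.sqrt (2 ^+ 2) by rewrite sqrtr_sqr ger0_norm.
  rewrite -sqrtrM ?exprn_ge0// ler_sqrt ?mulr_ge0 ?exprn_ge0//.
  by rewrite -natrX -natrM ler_nat; lia.
have hq : 2^-1 ^+ q (best_scale n) <= 2 ^+ c * (n%:R `^ (theta - 2^-1))^-1 :> R.
  rewrite exprVn ler_pdivlMr ?powR_gt0// mulrC ler_pdivrMr ?exprn_gt0//.
  by rewrite -exprD addnC; apply: powR_le_pow2.
apply: le_trans (ler_pM _ _ hq hs) _; rewrite ?exprn_ge0 ?invr_ge0 ?sqrtr_ge0//.
by rewrite mulrACA -exprSr.
Qed.

Lemma exponent_green : exponent_le
  (fun n => green R (pow2 (best_scale n)) (q (best_scale n)) n) (1 - theta).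
Proof.
have t0 : 0 <= 1 - theta by rewrite subr_ge0.
have h1 : exponent_le (fun n => 2 * (2 ^+ best_scale n + (q (best_scale n))%:R) : R)
    (1 - theta).
  apply: exponent_leZ => //.
  apply: exponent_leD; first exact: exponent_pow2_best_scale.
  exact: exponent_le_weaken t0 exponent_bits_best_scale.
have h2 := exponent_leD h1 exponent_returns_best_scale.
apply: exponent_le_trans (lexx _) (exponent_leZ (ler0n _ 2) h2).
by apply: nearW => n; rewrite /green intrD /pow2 -natrX.
Qed.

End EntropyExponent.
End Calibration.

(** * Exponent of the length bound *)

Section LengthExponent.
Variables (R : realType) (theta : R).
Hypotheses (theta_ge : 2^-1 <= theta) (theta_le : theta <= 1).

Local Notation q := (scale_bits theta).
Local Notation D := (@addr_bound R theta).

Lemma lamp_count_le n : (0 < n)%N ->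
  lamp_count R q n <= 2 * (log_scales n).+1%:R * D n.
Proof.
move=> n0; have D0 := addr_bound_ge0 theta n.
rewrite /lamp_count; set k := log_scales n.
have h1 : \sum_(s < k) Ex n (fun u : seq bstep => (naddr (pow2 s) (q s) u)%:R) <=
    k%:R * D n.
  rewrite mulr_natl -[X in _ *+ X]card_ord -sumr_const.
  by apply: ler_sum => s _; exact: Ex_naddr_le.
have h2 := ler_wpM2l (ler0n R k.+1) (Ex_naddr_closed_le theta n0).
move: h1 h2; rewrite -!(natr1 k); lra.
Qed.

(* Optimising [n / r + D r] over [r]. *)
Definition sum_bound (n : nat) : R :=
  n%:R `^ ((1 + theta) / 2) + D n * n%:R `^ ((1 - theta) / 2).

Lemma sum_bound_ge0 n : 0 <= sum_bound n.
Proof. by rewrite addr_ge0 ?mulr_ge0 ?powR_ge0 ?addr_bound_ge0. Qed.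

Lemma Ex_lamp_sum_bound (P : int) (m n : nat) : 0 < P -> (0 < n)%N ->
  Ex n (fun u : seq bstep => (naddr P m u)%:R) <= D n ->
  Ex n (lamp_sum R P m) <= sum_bound n.
Proof.
move=> P0 n0 hD; have D0 := addr_bound_ge0 theta n.
have n0' : 0 < n%:R :> R by rewrite ltr0n.
have r0 : 0 < (n%:R : R) `^ ((1 - theta) / 2) by rewrite powR_gt0.
apply: le_trans (Ex_lamp_sum_le P m n r0) _; rewrite /sum_bound lerD//.
  rewrite ler_pdivrMr// -natr_powRD//.
  have -> : (1 + theta) / 2 + (1 - theta) / 2 = 1 by field.
  by rewrite powRr1.
have := ler_wpM2r (ltW r0) hD; have := mulr_ge0 D0 (ltW r0); lra.
Qed.

Lemma lamp_total_le n : (0 < n)%N ->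
  lamp_total R q n <= 2 * (log_scales n).+1%:R * sum_bound n.
Proof.
move=> n0; have D0 := sum_bound_ge0 n.
rewrite /lamp_total; set k := log_scales n.
have h1 : \sum_(s < k) Ex n (lamp_sum R (pow2 s) (q s)) <= k%:R * sum_bound n.
  rewrite mulr_natl -[X in _ *+ X]card_ord -sumr_const.
  apply: ler_sum => s _; apply: Ex_lamp_sum_bound => //; first exact: pow2_gt0.
  exact: Ex_naddr_le.
have h2 : k.+1%:R * Ex n (lamp_sum R 1 0) <= k.+1%:R * sum_bound n.
  rewrite ler_wpM2l//; apply: Ex_lamp_sum_bound => //.
  exact: Ex_naddr_closed_le.
move: h1 h2; rewrite -!(natr1 k); lra.
Qed.

Lemma exponent_sum_bound : exponent_le sum_bound ((1 + theta) / 2).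
Proof.
apply: exponent_leD; first exact: exponent_le_powR.
have -> : (1 + theta) / 2 = theta + (1 - theta) / 2 by field.
apply: exponent_leM => [n|n||]; rewrite ?addr_bound_ge0 ?powR_ge0//.
  exact: exponent_addr_bound.
exact: exponent_le_powR.
Qed.

(** The lower bounds on [c] account, in order, for the range of the walk, the trip to the top level
    [n^beta], the number of lamps, and the leading digits. *)
Lemma exponent_length_bound (kappa beta c : R) :
  0 <= kappa -> kappa <= 1 -> 0 <= beta ->
  2^-1 <= c -> beta <= c -> theta <= c -> (1 + theta) / 2 - beta * kappa <= c ->
  exponent_le (fun n => length_bound R q (amplifier kappa) n (level beta n)
                          (q (log_scales n))) c.
Proof.
move=> k0 k1 b0 c2 bc tc kc; have c0 : 0 <= c by apply: le_trans c2.
have P0 a n : 0 <= (n%:R : R) `^ a by exact: powR_ge0.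
have N0 (t : nat -> nat) n : 0 <= (t n)%:R :> R by rewrite ler0n.
have ks : exponent_le (fun n => (log_scales n).+1%:R : R) 0.
  apply: exponent_le_trans (lexx 0)
    (exponent_leD (@exponent_log_scales R) (exponent_le_cst 1)).
  by apply: nearW => n; rewrite -natr1.
have ls : exponent_le (fun n => (level beta n).+1%:R : R) 0.
  apply: exponent_le_trans (lexx 0)
    (exponent_leD (exponent_leZ b0 (@exponent_le_lg R)) (exponent_le_cst 1)).
  by apply: nearW => n; rewrite -natr1 lerD2r level_le.
pose B1 n : R := (log_scales n).+1%:R *
  (52 * Num.sqrt n%:R + 11 + 4 * n%:R `^ beta).
pose B2 n : R := 4 * (1 + 6 * (q (log_scales n))%:R) *
  (2 * (log_scales n).+1%:R * D n).
pose B3 n : R := (2 * (2 * (log_scales n).+1%:R * sum_bound n)) *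
  (4 * n%:R `^ (- (beta * kappa))).
have B1_0 n : 0 <= B1 n.
  by rewrite mulr_ge0// !addr_ge0 ?mulr_ge0 ?sqrtr_ge0.
have B2_0 n : 0 <= B2 n.
  by rewrite !mulr_ge0 ?addr_bound_ge0// addr_ge0// mulr_ge0.
have B3_0 n : 0 <= B3 n.
  by rewrite !mulr_ge0 ?sum_bound_ge0.
apply: (@exponent_le_trans _ _
  (fun n => (level beta n).+1%:R * (B1 n + B2 n + B3 n)) c) (lexx c) _.
  apply: filterS (nbhs_infty_gt 0) => n n0.
  rewrite ler_wpM2l//; apply: lerD; [apply: lerD|].
  - by rewrite ler_wpM2l// lerD2l ler_wpM2l// pow2_level.
  - by rewrite ler_wpM2l ?lamp_count_le// mulr_ge0// addr_ge0// mulr_ge0.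
  - apply: ler_pM; rewrite ?invr_ge0 ?amplifier_level//.
      rewrite mulr_ge0// addr_ge0 ?mulr_ge0//.
        apply: sumr_ge0 => s _; apply: Ex_ge0 => w _; apply: sumr_ge0 => x _.
        by rewrite ler0z.
      by apply: Ex_ge0 => w _; apply: sumr_ge0 => x _; rewrite ler0z.
    by rewrite ler_wpM2l// lamp_total_le.
apply: exponent_leM0 => [//|n|//|]; first by rewrite !addr_ge0.
apply: exponent_leD; first apply: exponent_leD.
- apply: exponent_leM0 => [//|n|//|].
    by rewrite !addr_ge0 ?mulr_ge0 ?sqrtr_ge0.
  apply: exponent_leD; last first.
    by apply: exponent_leZ => //; apply: exponent_le_weaken (exponent_le_powR beta).
  apply: exponent_leD; last exact: exponent_le_weaken (exponent_le_cst _).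
  by apply: exponent_leZ => //; apply: exponent_le_weaken (@exponent_le_sqrt R).
- apply: exponent_leM0 => [n|n||].
  + by rewrite mulr_ge0// addr_ge0// mulr_ge0.
  + by rewrite !mulr_ge0 ?addr_bound_ge0.
  + apply: exponent_leZ => //.
    apply: exponent_leD; first exact: exponent_le_cst.
    by apply: exponent_leZ => //; exact: exponent_bits.
  apply: exponent_leM0 => [n|n||]; rewrite ?mulr_ge0 ?addr_bound_ge0//.
    exact: exponent_leZ.
  exact: exponent_le_weaken (exponent_addr_bound theta_ge).
apply: exponent_le_weaken kc _; apply: exponent_leM => [n|n||].
- by rewrite !mulr_ge0 ?sum_bound_ge0.
- by rewrite mulr_ge0.
- apply: exponent_leZ => //.
  apply: exponent_leM0 => [n|n||]; rewrite ?mulr_ge0 ?sum_bound_ge0//.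
    exact: exponent_leZ.
  exact: exponent_sum_bound.
by apply: exponent_leZ => //; exact: exponent_le_powR.
Qed.

End LengthExponent.

(** * Exponents of entropy and speed *)

Section WalkExponents.
Variables (R : realType) (theta gamma : R).
Hypotheses (theta_ge : 2^-1 <= theta) (theta_le : theta <= 1).

Local Notation q := (scale_bits theta).

Lemma entropy_exponent (amp : nat -> nat) :
  has_exponent (entropy (@lamp_law R q amp)) theta.
Proof.
apply: has_exponentP => [|e /andP[e0 _]].
  have C0 : 0 <= ln 2 + ln #|{: generator * bool}|%:R :> R.
    by rewrite addr_ge0// ln_natr_ge0.
  (* The code words are taken in the group with amplifier exponent 1 and top level about [sqrt n]:
     the trips cost [n^(1/2)] and the leading digits [n^(theta / 2)], both within [n^theta]. *)
  have h0 : 0 <= 2^-1 :> R by rewrite invr_ge0.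
  have h1 : (1 + theta) / 2 - 2^-1 * 1 <= theta by move: theta_ge; lra.
  have hl := exponent_length_bound theta_ge theta_le ler01 (lexx 1) h0
    theta_ge theta_ge (lexx _) h1.
  have h2 : exponent_le (fun=> ln 2 : R) theta.
    by apply: exponent_le_weaken (exponent_le_cst _); exact: le_trans theta_ge.
  apply: exponent_le_trans (lexx _) (exponent_leD h2 (exponent_leZ C0 hl)).
  apply: filterS (nbhs_infty_gt 0) => n n0.
  apply: entropy_lamp_le => //; first exact: amplifier0.
  - exact: amplifier_gt0.
  - by move=> i; exact: amplifier_double.
  - by move=> s sk; apply: scale_bits_le => //; exact: ltnW.
have e2 : 0 < e / 2 by rewrite divr_gt0.
apply: filterS3 (exponent_green theta_ge theta_le e2)
  (near_powR_ge (ln 2)^-1 e2) (nbhs_infty_gt 0) => n hg h2 n0.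
apply: le_trans (entropy_lamp_ge R _ _ (best_scale theta n) n0).
have g0 := green_gt0 R (q (best_scale theta n)) (pow2_gt0 (best_scale theta n)) n.
set g := green _ _ _ _ in hg g0 *.
have n0' : 0 < n%:R :> R by rewrite ltr0n.
have l2 := ln2_gt0 R.
rewrite mulrA ler_pdivlMr//.
apply: le_trans (ler_wpM2l (powR_ge0 _ _) hg) _.
rewrite -natr_powRD//.
have -> : theta - e + (1 - theta + e / 2) = 1 + - (e / 2) by field.
rewrite natr_powRD// powRr1// [leRHS]mulrC ler_wpM2l//.
by rewrite powRN invf_ple ?posrE// powR_gt0.
Qed.

Hypotheses (gamma_ge : theta <= gamma) (gamma_le : gamma <= (theta + 1) / 2).

Let kappa := (1 + theta) / (2 * gamma) - 1.

Local Notation amp := (amplifier kappa).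

Lemma gamma_gt0 : 0 < gamma.
Proof. by apply: lt_le_trans (le_trans theta_ge gamma_ge). Qed.

Lemma kappaE : gamma * (1 + kappa) = (1 + theta) / 2.
Proof. by rewrite /kappa; have g0 := gamma_gt0; field; rewrite gt_eqF. Qed.

Lemma kappa_ge0 : 0 <= kappa.
Proof.
have g0 := gamma_gt0; rewrite /kappa subr_ge0 ler_pdivlMr ?mulr_gt0//.
by move: gamma_le; lra.
Qed.

(** From [4 * gamma >= 4 * theta >= 1 + theta], as [theta >= 1/2]. This is what makes the amplifier
    at most double from one level to the next. *)
Lemma kappa_le1 : kappa <= 1.
Proof.
have g0 := gamma_gt0; rewrite /kappa lerBlDr ler_pdivrMr ?mulr_gt0//.
by move: gamma_ge theta_ge; lra.
Qed.

Lemma speed_exponent_le (S : set (generated (lamp_moves q amp))) : generates S ->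
  exponent_le (speed S (@lamp_law R q amp)) gamma.
Proof.
move=> S_gen.
have [K KP] := speed_lamp_le R (amplifier_gt0 kappa) (amplifier0 kappa)
  (fun i => amplifier_double i kappa_le1) S_gen.
(* With top level about [n^gamma], the trips to it and the leading digits have the same exponent. *)
have h1 : (1 + theta) / 2 - gamma * kappa <= gamma by rewrite -kappaE; lra.
have hl := exponent_length_bound theta_ge theta_le kappa_ge0 kappa_le1
  (ltW gamma_gt0) (le_trans theta_ge gamma_ge) (lexx _) gamma_ge h1.
apply: exponent_le_trans (lexx _) (exponent_leZ (ler0n _ K) hl).
apply: filterS (nbhs_infty_gt 0) => n n0; apply: KP => // s sk.
by apply: scale_bits_le => //; exact: ltnW.
Qed.

Lemma exponent_shift_bound (t1 t2 : nat -> nat) (a : R) : 0 <= a -> a <= 1 ->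
  exponent_le (fun n => (t1 n)%:R : R) 1 -> exponent_le (fun n => (t2 n)%:R : R) a ->
  exponent_le (fun n => (shift_bound amp (t1 n) (t2 n))%:R : R) (a * kappa).
Proof.
move=> a0 a1 ht1 ht2; have k0 := kappa_ge0; have k1 := kappa_le1.
have ak0 : 0 <= a * kappa by rewrite mulr_ge0.
have hp : exponent_le (fun n => ((t2 n).+1%:R : R) `^ kappa) (a * kappa).
  move=> e e0.
  have := exponent_leD ht2 (exponent_le_weaken a0 (exponent_le_cst 1)).
  move=> /(_ e e0); apply: filterS2 (nbhs_infty_gt 0) => n n0 h.
  apply: le_trans (_ : (n%:R `^ (a + e)) `^ kappa <= _).
    by apply: ge0_ler_powR => //; rewrite ?nnegrE ?powR_ge0// -natr1.
  rewrite -powRrM ler_powR ?ler1n//; nra.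
have h2 := exponent_leD (exponent_le_weaken ak0 (exponent_le_cst (2 : R)))
  (exponent_leM0 (fun=> ler0n _ _) (fun=> powR_ge0 _ _)
     (exponent_le_trunc_log a0 ht2) hp).
have h3 := exponent_leM0 (fun=> ler0n _ _) _ (exponent_le_trunc_log ler01 ht1) h2.
apply: exponent_le_trans (lexx _) (h3 _).
  apply: nearW => n; rewrite /shift_bound natrM natrD ler_wpM2l// lerD2l.
  exact: amplifier_sum.
by move=> n; rewrite addr_ge0// mulr_ge0// powR_ge0.
Qed.

Lemma speed_exponent_ge (S : set (generated (lamp_moves q amp))) :
  finite_set S -> generates S ->
  exponent_ge (speed S (@lamp_law R q amp)) gamma.
Proof.
move=> S_fin S_gen e /andP[e0 e1].
have [K KP] := speed_lamp_ge R S_fin S_gen.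
(* The loss [e] is spent in ten units [h / 2], and [X = n^(h / 2)] below is one unit. The trial
   length [L] gives up four of them; with [r = p * X ^+ 4] the main term is at least [X^-1 ^+ 5],
   against errors of at most [3 * X^-1 ^+ 6]; the tenth unit absorbs the constants, since
   [X >= 8]. *)
pose h := e / 5; have h0 : 0 < h by rewrite divr_gt0.
have h2 : 0 < h / 2 by rewrite divr_gt0.
pose L n := Num.truncn ((n%:R : R) `^ (gamma - 2 * h)).
pose s n := best_scale theta n.
pose z n := (K * L n * shift_bound amp (2 ^ s n + K * L n) (K * L n))%N.
(* Here [e < 1] enters: it gives [2 * h < 2 / 5], which is below [theta]. *)
have a0 : 0 <= gamma - 2 * h by move: theta_ge gamma_ge; rewrite /h; lra.
have a1 : gamma - 2 * h <= 1 by move: theta_le gamma_le h0; lra.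
have hL : exponent_le (fun n => (K * L n)%:R : R) (gamma - 2 * h).
  apply: exponent_le_trans (lexx _)
    (exponent_leZ (ler0n _ K) (exponent_le_powR (gamma - 2 * h))).
  by apply: nearW => n; rewrite natrM ler_wpM2l// trunc_le// powR_ge0.
have hs : exponent_le (fun n => (2 ^ s n + K * L n)%:R : R) 1.
  apply: exponent_le_trans (lexx _) (exponent_leD
    (exponent_le_weaken _ (exponent_pow2_best_scale theta_le))
    (exponent_le_weaken a1 hL)).
    by apply: nearW => n; rewrite natrD natrX.
  by rewrite lerBlDl lerDr; exact: le_trans theta_ge.
(* A word of length [L] produces rotations of exponent [(gamma - 2 * h) * (1 + kappa)], which is at
   least [2 * h] short of the [(1 + theta) / 2] reached by the walk. *)
have hz : exponent_le (fun n => (z n)%:R : R) ((1 + theta) / 2 - 2 * h).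
  have := exponent_leM (fun=> ler0n _ _) (fun=> ler0n _ _) hL
    (exponent_shift_bound a0 a1 hs hL).
  rewrite -[X in X + _]mulr1 -mulrDr => hM.
  apply: exponent_le_trans (lexx _) (exponent_le_weaken _ hM).
    by apply: nearW => n; rewrite -natrM.
  rewrite mulrBl kappaE lerD2l lerN2 ler_peMr ?mulr_ge0 ?(ltW h0) ?(ltW e0)//.
  by rewrite lerDl kappa_ge0.
have hX := near_powR_ge 8 h2.
have hg := exponent_green theta_ge theta_le h0.
have hD := exponent_addr_bound theta_ge h0.
near=> n; have n0 : (0 < n)%N by near: n; exact: nbhs_infty_gt.
have n0' : 0 < n%:R :> R by rewrite ltr0n.
have X8 : 8 <= (n%:R : R) `^ (h / 2) by near: n; exact: hX.
have gn : green R (pow2 (best_scale theta n)) (q (best_scale theta n)) n <=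
    n%:R `^ (1 - theta + h) by near: n; exact: hg.
have Dn : addr_bound theta n <= n%:R `^ (theta + h) by near: n; exact: hD.
have zn : (z n)%:R <= (n%:R : R) `^ ((1 + theta) / 2 - 2 * h + h).
  by near: n; exact: hz.
have XE (m : nat) (c : R) :
    n%:R `^ (c + m%:R * (h / 2)) = n%:R `^ c * (n%:R `^ (h / 2)) ^+ m.
  by rewrite natr_powRD// [m%:R * _]mulrC (powRrM _ (h / 2)) powR_mulrn// powR_ge0.
set X := n%:R `^ (h / 2) in X8 XE; set p := n%:R `^ ((1 + theta) / 2).
set W := n%:R `^ gamma.
have X0 : 0 < X by apply: lt_le_trans X8.
have p0 : 0 < p by rewrite powR_gt0.
have W0 : 0 < W by rewrite powR_gt0.
have r0 : 0 < p * X ^+ 4 by rewrite mulr_gt0// exprn_gt0.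
apply: le_trans (KP n (s n) (L n) _ n0 r0).
rewrite -/(z n) -/(s n).
have LW : W * X^-1 ^+ 4 / 2 <= (L n)%:R.
  have WE : W * X^-1 ^+ 4 = n%:R `^ (gamma - 2 * h).
    apply: (mulIf (lt0r_neq0 (exprn_gt0 4 X0))).
    by rewrite exprVn divfK ?gt_eqF ?exprn_gt0// -XE; congr (_ `^ _); field.
  rewrite WE; have := trunc_gt ((n%:R : R) `^ (gamma - 2 * h)).
  have : (1 : R) <= n%:R `^ (gamma - 2 * h).
    by rewrite -[leLHS](powRr0 (n%:R : R)) ler_powR ?ler1n.
  have := truncn_gt0 ((n%:R : R) `^ (gamma - 2 * h)) => <-.
  rewrite -(ler_nat R) -/(L n); lra.
have zX : (z n)%:R / (p * X ^+ 4) <= X^-1 ^+ 6.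
  rewrite ler_pdivrMr//.
  have -> : X^-1 ^+ 6 * (p * X ^+ 4) = p / X ^+ 2 by field; rewrite gt_eqF.
  rewrite ler_pdivlMr ?exprn_gt0//.
  apply: le_trans (ler_wpM2r (ltW (exprn_gt0 2 X0)) zn) _.
  by rewrite -XE /p le_eqVlt; apply/orP; left; apply/eqP; congr (_ `^ _); field.
have DX : 2 * n%:R * Ex n (fun u : seq bstep =>
    (naddr (pow2 (s n)) (q (s n)) u)%:R) / (p * X ^+ 4) ^+ 2 <= 2 * X^-1 ^+ 6.
  rewrite ler_pdivrMr ?exprn_gt0//.
  have -> : 2 * X^-1 ^+ 6 * (p * X ^+ 4) ^+ 2 = 2 * n%:R * (n%:R `^ theta * X ^+ 2).
    have p2 : p ^+ 2 = n%:R * n%:R `^ theta.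
      rewrite -[X in X * _](powRr1 (ltW n0')) -natr_powRD// expr2 -natr_powRD//.
      by congr (_ `^ _); field.
    rewrite -[RHS]mulrA [n%:R * _]mulrA -p2; field; by rewrite gt_eqF.
  rewrite -XE ler_wpM2l ?mulr_ge0//.
  apply: le_trans (Ex_naddr_le theta_ge theta_le _ n0) (le_trans Dn _).
  by rewrite le_eqVlt; apply/orP; left; apply/eqP; congr (_ `^ _); field.
set g := green _ _ _ _ in gn *.
have g0 : 0 < g by apply: green_gt0; exact: pow2_gt0.
have gX : X^-1 ^+ 5 <= 2 * (n%:R / Num.sqrt (3 * g)) / (p * X ^+ 4).
  rewrite ler_pdivlMr//.
  have -> : X^-1 ^+ 5 * (p * X ^+ 4) = p / X by field; rewrite gt_eqF.
  set t := (n%:R : R) `^ ((1 - theta) / 2).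
  have t0 : 0 < t by rewrite powR_gt0.
  have pt : p * t = n%:R.
    by rewrite -natr_powRD// -[RHS](powRr1 (ltW n0')); congr (_ `^ _); field.
  have st : Num.sqrt (3 * g) <= 2 * t * X.
    rewrite -[leRHS]ger0_norm ?mulr_ge0 ?(ltW t0) ?(ltW X0)//.
    rewrite -sqrtr_sqr ler_sqrt ?sqr_ge0//.
    have -> : (2 * t * X) ^+ 2 = 4 * (n%:R `^ (1 - theta) * X ^+ 2).
      have -> : (n%:R : R) `^ (1 - theta) = t ^+ 2.
        by rewrite expr2 -natr_powRD//; congr (_ `^ _); field.
      by ring.
    have -> : n%:R `^ (1 - theta) * X ^+ 2 = n%:R `^ (1 - theta + h).
      by rewrite -XE; congr (_ `^ _); field.
    by move: g0 gn; rewrite /s -/g; lra.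
  have s0 : 0 < Num.sqrt (3 * g) by rewrite sqrtr_gt0 mulr_gt0.
  rewrite mulrA ler_pdivlMr//.
  apply: le_trans (ler_wpM2l (ltW (divr_gt0 p0 X0)) st) _.
  by rewrite -pt le_eqVlt; apply/orP; left; apply/eqP; field; rewrite gt_eqF.
have -> : n%:R `^ (gamma - e) = W * X^-1 ^+ 10.
  apply: (mulIf (lt0r_neq0 (exprn_gt0 10 X0))).
  by rewrite exprVn divfK ?gt_eqF ?exprn_gt0// -XE; congr (_ `^ _); rewrite /h; field.
set Y := X^-1 in LW zX DX gX *.
have Y0 : 0 < Y by rewrite invr_gt0.
have Y8 : Y <= 8^-1 by rewrite /Y lef_pV2 ?posrE.
set u := 2 * (_ / _) / _ in gX *; set v := (z n)%:R / _ in zX *.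
set x := 2 * n%:R * _ / _ in DX *.
have Y5 : 0 < Y ^+ 5 by rewrite exprn_gt0.
have hb : Y ^+ 5 / 2 <= u - v - x.
  have : Y ^+ 6 = Y * Y ^+ 5 by rewrite -exprS.
  have := ler_wpM2r (ltW Y5) Y8.
  move: Y5 zX DX gX; move: (Y ^+ 5) (Y ^+ 6) => y5 y6; lra.
apply: le_trans (ler_pM _ _ LW hb); rewrite ?divr_ge0 ?mulr_ge0 ?exprn_ge0 ?(ltW W0) ?(ltW Y0) ?(ltW Y5)//.
have -> : W * Y ^+ 4 / 2 * (Y ^+ 5 / 2) = W * Y ^+ 9 / 4 by field.
have -> : W * Y ^+ 10 = Y * (W * Y ^+ 9) by ring.
have c0 : 0 <= W * Y ^+ 9 by rewrite mulr_ge0 ?exprn_ge0 ?(ltW W0) ?(ltW Y0).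
by have := ler_wpM2r c0 Y8; lra.
Unshelve. all: by end_near. Qed.

End WalkExponents.

Theorem corollary1p3 (R : realType) (theta gamma : R)
    (htheta : 2^-1 <= theta <= 1) (hgamma : 2^-1 <= gamma <= 1)
    (h : theta <= gamma <= 2^-1 * (theta + 1)) :
  exists (G : groupType) (mu : G -> R),
    [/\ finitely_generated G,
        finitely_supported_probability mu,
        symmetric_measure mu,
        has_exponent (entropy mu) theta
      & forall S : set G, finite_set S -> generates S ->
          has_exponent (speed S mu) gamma].
Proof.
case/andP: htheta => t0 t1; case/andP: h => tg; rewrite mulrC => gt.
pose q := scale_bits theta; pose amp := amplifier ((1 + theta) / (2 * gamma) - 1).
exists (generated (lamp_moves q amp)), (@lamp_law R q amp); split.
- exact: generated_finitely_generated.
- exact: step_law_probability card_steps.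
- exact: lamp_law_symmetric.
- exact: entropy_exponent.
move=> S S_fin S_gen; apply: has_exponentP.
  exact: speed_exponent_le.
exact: speed_exponent_ge.
Qed.
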